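(* Let $A\in\mathbb{R}^{d\times d}$, $\Lambda\in\mathbb{R}^d$, $B_i\in\mathbb{R}^{d\times d}$ and $\Gamma_i\in\mathbb{R}^d$ for $i=1,\dots,m$, and let $\widetilde Y$ be the solution of the linear Itô SDE $$d\widetilde Y(t)=(A\widetilde Y(t)+\Lambda)\,dt+\sum_{i=1}^m(B_i\widetilde Y(t)+\Gamma_i)\,dW_i(t),\quad t\ge 0,\qquad \widetilde Y(0)=\widetilde Y_0\in\mathbb{R}^d.$$ Let $M(t):=\mathbb{E}[\widetilde Y(t)]$, $P(t):=\mathbb{E}[\widetilde Y(t)\widetilde Y(t)^T]$ and $Q(t):=[\mathrm{vec}(P(t))^T,M(t)^T]^T\in\mathbb{R}^{d^2+d}$ for $t\ge0$, and set $$\tilde A:=(\mathbb{I}_d\otimes A)+(A\otimes\mathbb{I}_d),\qquad \tilde B_i:=(\Gamma_i\otimes B_i)+(B_i\otimes\Gamma_i),\qquad \tilde C_i:=(\Gamma_i\otimes\mathbb{I}_d)\Gamma_i.$$ Then $Q$ satisfies the linear ODE $$Q'(t)=\mathbb{A}\,Q(t)+S,$$ where $\mathbb{A}\in\mathbb{R}^{(d^2+d)\times(d^2+d)}$ is the block matrix $$\mathbb{A}:=\begin{pmatrix}\tilde A+\sum_{i=1}^mB_i\otimes B_i & (\mathbb{I}_d\otimes\Lambda)+(\Lambda\otimes\mathbb{I}_d)+\sum_{i=1}^m\tilde B_i\\ 0& A\end{pmatrix},$$ and $S\in\mathbb{R}^{d^2+d}$ is the stacked vector $S=\left[\left(\sum_{i=1}^m\tilde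 C_i\right)^T,\Lambda^T\right]^T$.
   Context: $W=[W_1,\dots,W_m]^T$ is an $m$-dimensional standard Brownian motion. $\mathbb{I}_d$ is the $d\times d$ identity matrix. For a matrix $C\in\mathbb{R}^{k\times n}$, $\mathrm{vec}(C)\in\mathbb{R}^{kn}$ is the column vector obtained by stacking the columns of $C$ on top of one another. The Kronecker product of $C=(c_{ij})\in\mathbb{R}^{k\times n}$ and $D\in\mathbb{R}^{r\times s}$ is the block matrix $C\otimes D:=(c_{ij}D)_{ij}\in\mathbb{R}^{kr\times ns}$; vectors in $\mathbb{R}^d$ are regarded as $d\times 1$ matrices. *)

(* Defs.v *)
From HB Require Import structures.
From mathcomp Require Export all_boot all_order all_algebra.
From mathcomp Require Export all_classical all_reals all_analysis.
From mathcomp.real_closed Require Export mxtens.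
Set Implicit Arguments.
Unset Strict Implicit.
Unset Printing Implicit Defensive.
Import Order.TTheory GRing.Theory Num.Theory.
Export numFieldNormedType.Exports.
Local Open Scope classical_set_scope.
Local Open Scope ring_scope.

(* [C *t D] is the Kronecker product $C \otimes D$. When one factor is a column
   vector, the product has [1 * n] or [n * 1] columns, numbers that are not
   convertible to [n]: the casts below only rewrite this dimension. *)
Definition kron_cl (R : pzRingType) (r k n : nat)
    (v : 'cV[R]_r) (D : 'M[R]_(k, n)) : 'M[R]_(r * k, n) :=
  castmx (erefl, mul1n n) (v *t D).

Definition kron_cr (R : pzRingType) (r k n : nat)
    (D : 'M[R]_(k, n)) (v : 'cV[R]_r) : 'M[R]_(k * r, n) :=
  castmx (erefl, muln1 n) (D *t v).

(* [mxtens_unindex a = (a %/ k, a %% k)]: entry (i, j) of [C] is at position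
   [j * k + i], i.e. the columns of [C] are stacked. *)
Definition vec (R : Type) (k n : nat) (C : 'M[R]_(k, n)) : 'cV[R]_(n * k) :=
  \col_(a < n * k) C (mxtens_unindex a).2 (mxtens_unindex a).1.

Section stochastic.
Context (R : realType) (disp : measure_display) (T : measurableType disp).
Context (P : probability T R).

Definition Emx (p q : nat) (Z : T -> 'M[R]_(p, q)) : 'M[R]_(p, q) :=
  \matrix_(i, j) fine 'E_P[fun w => Z w i j].

(* Processes are indexed by all of [R], but only the times [0 <= t] matter. *)

Definition filtration (F : R -> set (set T)) : Prop :=
  [/\ forall t : R, 0 <= t -> sigma_algebra setT (F t),
      forall t : R, 0 <= t -> F t `<=` measurable &
      forall s t : R, 0 <= s -> s <= t -> F s `<=` F t].

Context (F : R -> set (set T)).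

Definition adapted (X : R -> T -> R) : Prop :=
  forall t : R, 0 <= t -> forall B : set R, measurable B -> F t (X t @^-1` B).

Definition measurable_process (X : R -> T -> R) : Prop :=
  measurable_fun ([set t : R | 0 <= t] `*` [set: T] : set (measurableTypeR R * T))
    (fun p => X p.1 p.2).

(* The field [bm_increment] says at once that, for s < t, the increments
   [W i t - W i s] are N(0, t - s), independent of each other and of [F s];
   the second argument of [normal_prob] is the standard deviation. *)
Record brownian_motion (m : nat) (W : 'I_m -> R -> T -> R) : Prop := {
  bm_adapted : forall i, adapted (W i);
  bm_start : {ae P, forall w, forall i, W i 0 w = 0};
  bm_continuous : {ae P, forall w, forall i,
    {within [set t : R | 0 <= t], continuous (fun t => W i t w)}};
  bm_increment : forall s t : R, 0 <= s -> s < t ->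
    forall (A : set T) (B : 'I_m -> set R), F s A ->
      (forall i, measurable (B i)) ->
      P (A `&` [set w | forall i, B i (W i t w - W i s w)]) =
      (P A * \prod_(i < m) normal_prob 0 (Num.sqrt (t - s)) (B i))%E }.

(* The simple process
   [\sum_(j < sp_size) sp_coef j * 1_(sp_time j, sp_time j.+1]]. *)
Record simple_process := SimpleProcess {
  sp_size : nat;
  sp_time : nat -> R;
  sp_coef : nat -> T -> R;
  sp_time_ge0 : 0 <= sp_time 0;
  sp_time_homo : {homo sp_time : i j / (i <= j)%N >-> i <= j};
  sp_coef_measurable : forall j (B : set R),
    measurable B -> F (sp_time j) (sp_coef j @^-1` B);
  sp_coef_bounded : exists C : R, forall j w, `|sp_coef j w| <= C }.

Definition simple_val (phi : simple_process) (s : R) (w : T) : R :=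
  \sum_(j < sp_size phi) sp_coef phi j w *
    \1_(`]sp_time phi j, sp_time phi j.+1]%classic) s.

Definition simple_integral (phi : simple_process) (W : R -> T -> R)
    (t : R) (w : T) : R :=
  \sum_(j < sp_size phi) sp_coef phi j w *
    (W (Num.min (sp_time phi j.+1) t) w - W (Num.min (sp_time phi j) t) w).

Definition cvg_prob0 (X : nat -> T -> \bar R) : Prop :=
  forall e : R, 0 < e ->
    P [set w | (e%:E <= `|X n w|)%E] @[n --> \oo] --> (0 : \bar R)%E.

Definition ito_integrand (H : R -> T -> R) : Prop :=
  [/\ measurable_process H, adapted H &
      forall t : R, 0 <= t -> {ae P, forall w,
        (\int[lebesgue_measure]_(s in `[0%R, t]) ((H s w) ^+ 2)%:E < +oo)%E}].

(* [I] is a version of $\int_0^t H dW$ for a measurable adapted [H] with a.s.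
   square-integrable paths: the limit in probability of the
   integrals of simple processes approximating [H] in $L^2([0,t])$ in
   probability. *)
Definition is_ito_integral (W : R -> T -> R) (H : R -> T -> R)
    (t : R) (I : T -> R) : Prop :=
  ito_integrand H /\ measurable_fun [set: T] I /\
  exists phi : nat -> simple_process,
    cvg_prob0 (fun n w => (\int[lebesgue_measure]_(s in `[0%R, t])
      ((simple_val (phi n) s w - H s w) ^+ 2)%:E)%E) /\
    cvg_prob0 (fun n w => (simple_integral (phi n) W t w - I w)%:E).

(* Strong solution of dX = a(X) dt + \sum_i b_i(X) dW_i, X(0) = x0. Itô
   integrals are only defined up to null sets, whence the choice of versions in
   [sde_equation]; no moment bound on X is assumed. *)
Record sde_solution (m d : nat) (W : 'I_m -> R -> T -> R)
    (a : 'cV[R]_d -> 'cV[R]_d) (b : 'I_m -> 'cV[R]_d -> 'cV[R]_d)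
    (x0 : 'cV[R]_d) (X : R -> T -> 'cV[R]_d) : Prop := {
  sde_measurable : forall j, measurable_process (fun t w => X t w j 0);
  sde_adapted : forall j, adapted (fun t w => X t w j 0);
  sde_continuous : {ae P, forall w,
    {within [set t : R | 0 <= t], continuous (fun t => X t w)}};
  sde_start : {ae P, forall w, X 0 w = x0};
  sde_drift : forall t : R, 0 <= t -> {ae P, forall w, forall j,
    lebesgue_measure.-integrable `[0, t] (fun s => (a (X s w) j 0)%:E)};
  sde_equation : exists I : 'I_m -> 'I_d -> R -> T -> R,
    (forall i j (t : R), 0 <= t ->
       is_ito_integral (W i) (fun s w => b i (X s w) j 0) t (I i j t)) /\
    (forall t : R, 0 <= t -> {ae P, forall w, forall j,
       X t w j 0 = x0 j 0
         + \int[lebesgue_measure]_(s in `[0, t]) (a (X s w) j 0)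
         + \sum_(i < m) I i j t w}) }.

End stochastic.

(* Main.v *)
From mathcomp Require Import finmap.
Require Import Defs.
From mathcomp Require Import measurable_realfun lra ring.
Set Implicit Arguments.
Unset Strict Implicit.
Unset Printing Implicit Defensive.
Import Order.TTheory GRing.Theory Num.Theory.
Local Open Scope classical_set_scope.
Local Open Scope ring_scope.

(** The equation for [Q] is what the expectation of Ito's formula gives for
    [Y_j] and [Y_j Y_k]. Here a stochastic integral is a limit in probability of
    integrals of simple processes, and no moment of [Y] is assumed, so the proof
    works instead with increments over short intervals, in mean square.

    Let [h = t - s], let [a] be the drift and [b_i] the coefficient of [W_i].
    Freezing the coefficients at time [s],
    [Y(t) - Y(s) = h a(Y(s)) + \sum_i b_i(Y(s)) (W_i(t) - W_i(s)) + remainder],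
    where the remainder is [O(h)] in mean square, its drift part is
    [O(h^(3/2))], and the stochastic integrals over [[s, t]] are orthogonal to
    the past of [s] ([frozen_increment]). The increments of [W] are independent
    of the past, centred, uncorrelated and of variance [h]; hence
    [M_j(t) - M_j(s)] and [P_jk(t) - P_jk(s)] equal [h] times the expected drift
    of [Y_j] and of [Y_j Y_k] at time [s], up to [O(h^(3/2))] uniformly on
    compacts ([mean_expansion], [product_expansion]). These expected drifts are
    affine in the first two moments. An expansion [Q(t) - Q(s) = h G(s) +
    O(h^(3/2))] with [G] affine in [Q] makes [Q] continuous, and then
    differentiable with derivative [G] ([difference_quotient]). Last, the
    identities [(C *t D) vec X = vec (D X C^T)] and their analogues for one
    vector factor identify [G] with [AA Q + S].

    Two facts carry the estimates.

    - Mean-square control of stochastic integrals. Lenglart's inequality on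
      grids ([lenglart]) shows that an elementary integral is small in
      probability on an event as soon as its energy is. Therefore the
      approximating simple processes, about whose moments nothing is known, can
      be traded for left-endpoint sums of the integrand ([ito_left_sum]). For
      these the isometry and the martingale property are computations
      ([grid_isometry], [grid_martingale]), which pass to the limit by Fatou's
      lemma in probability ([ito_second_moment], [ito_martingale]).

    - Existence of the moments. The argument allows an integrand that has
      moments only after multiplication by a cutoff equal to 1 on some event.
      With the event that the path stays in a ball up to time [r] ([bset]),
      the truncated second moments satisfy an inequality independent of the
      radius: over an interval of a fixed length they grow at most from [u] to
      [4 u + 1] ([trunc_interval]). Iterating and letting the radius tend to
      infinity bounds the second moments on compacts
      ([second_moment_bounded]). *)

(** * Real-valued integrable and square-integrable functions *)

Section integrals.
Context (R : realType) (disp : measure_display) (T : measurableType disp).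
Context (mu : {measure set T -> \bar R}).
Implicit Types (U V Z : T -> R) (A : set T).

Definition L1 U := mu.-integrable [set: T] (EFin \o U).

Definition L2 U := measurable_fun [set: T] U /\ L1 (fun w => U w ^+ 2).

Definition mean U : R := \int[mu]_w U w.

Lemma L1_measurable U : L1 U -> measurable_fun [set: T] U.
Proof. by move=> /measurable_int /measurable_EFinP. Qed.

Lemma L1_le U V : measurable_fun [set: T] U -> L1 V ->
  (forall w, `|U w| <= `|V w|) -> L1 U.
Proof.
move=> mU V1 UV; apply: (le_integrable measurableT _ _ V1).
  exact/measurable_EFinP.
by move=> w _ /=; rewrite lee_fin.
Qed.

Lemma L1D U V : L1 U -> L1 V -> L1 (fun w => U w + V w).
Proof. by move=> U1 V1; have := integrableD measurableT U1 V1. Qed.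

Lemma L1Z (k : R) U : L1 U -> L1 (fun w => k * U w).
Proof. by move=> U1; have := integrableZl measurableT k U1. Qed.

Lemma L1N U : L1 U -> L1 (fun w => - U w).
Proof. by move=> U1; under eq_fun do rewrite -mulN1r; exact: L1Z. Qed.

Lemma L1B U V : L1 U -> L1 V -> L1 (fun w => U w - V w).
Proof. by move=> U1 V1; apply: L1D => //; exact: L1N. Qed.

Lemma L1_0 : L1 (fun=> 0).
Proof. exact: integrable0. Qed.

Lemma mean_0 : mean (fun=> 0) = 0.
Proof. by rewrite /mean /Rintegral integral0. Qed.

Lemma L2_0 : L2 (fun=> 0).
Proof. by split => //; under eq_fun do rewrite expr0n; exact: L1_0. Qed.

Lemma L1_sum (I : Type) (r : seq I) (Q : pred I) (U : I -> T -> R) :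
  (forall i, Q i -> L1 (U i)) -> L1 (fun w => \sum_(i <- r | Q i) U i w).
Proof.
move=> U1; elim: r => [|i r ih].
  by under eq_fun do rewrite big_nil; exact: L1_0.
under eq_fun do rewrite big_cons.
by have [Qi|_] := boolP (Q i); [exact: L1D (U1 _ Qi) ih|exact: ih].
Qed.

Lemma L1_abs U : L1 U -> L1 (fun w => `|U w|).
Proof. by move=> U1; have := integrable_norm U1. Qed.

Lemma meanD U V : L1 U -> L1 V -> mean (fun w => U w + V w) = mean U + mean V.
Proof. by move=> U1 V1; rewrite /mean RintegralD. Qed.

Lemma meanB U V : L1 U -> L1 V -> mean (fun w => U w - V w) = mean U - mean V.
Proof. by move=> U1 V1; rewrite /mean RintegralB. Qed.

Lemma meanZ (k : R) U : L1 U -> mean (fun w => k * U w) = k * mean U.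
Proof. by move=> U1; rewrite /mean RintegralZl. Qed.

Lemma mean_sum (I : Type) (r : seq I) (Q : pred I) (U : I -> T -> R) :
  (forall i, Q i -> L1 (U i)) ->
  mean (fun w => \sum_(i <- r | Q i) U i w) = \sum_(i <- r | Q i) mean (U i).
Proof.
move=> U1; elim: r => [|i r ih].
  by under eq_fun do rewrite big_nil; rewrite mean_0 big_nil.
under eq_fun do rewrite big_cons.
rewrite big_cons; have [Qi|_] := boolP (Q i); last exact: ih.
by rewrite meanD ?ih//; [exact: U1|exact: L1_sum].
Qed.

Lemma mean_ge0 U : (forall w, 0 <= U w) -> 0 <= mean U.
Proof. by move=> U0; apply: Rintegral_ge0. Qed.

Lemma le_mean U V : L1 U -> L1 V -> (forall w, U w <= V w) -> mean U <= mean V.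
Proof. by move=> U1 V1 UV; apply: le_Rintegral. Qed.

Lemma EFin_mean U : L1 U -> (mean U)%:E = (\int[mu]_w (U w)%:E)%E.
Proof. by move=> U1; rewrite fineK//; exact: integrable_fin_num. Qed.

Lemma eq_mean_ae U V : measurable_fun [set: T] U -> measurable_fun [set: T] V ->
  {ae mu, forall w, U w = V w} -> mean U = mean V.
Proof.
move=> mU mV UV; rewrite /mean /Rintegral; congr fine.
apply: ae_eq_integral => //; [exact/measurable_EFinP|exact/measurable_EFinP|].
by apply: filterS UV => w /= -> _.
Qed.

Lemma L1_ae U V : measurable_fun [set: T] U -> L1 V ->
  {ae mu, forall w, U w = V w} -> L1 U.
Proof.
move=> mU V1 UV; apply/integrableP; split; first exact/measurable_EFinP.
have /integrableP[_] := V1; congr (_ < _)%E.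
apply: ae_eq_integral => //.
- by apply: measurableT_comp => //; apply/measurable_EFinP; exact: L1_measurable.
- by apply: measurableT_comp => //; apply/measurable_EFinP.
- by apply: filterS UV => w /= -> _.
Qed.

Lemma ge0_L1 U : measurable_fun [set: T] U -> (forall w, 0 <= U w) ->
  (\int[mu]_w (U w)%:E < +oo)%E -> L1 U.
Proof.
move=> mU U0 Uoo; apply/integrableP; split; first exact/measurable_EFinP.
by under eq_integral do rewrite /= ger0_norm//.
Qed.

Lemma ge0_L1_le (k : R) U : measurable_fun [set: T] U -> (forall w, 0 <= U w) ->
  (\int[mu]_w (U w)%:E <= k%:E)%E -> L1 U /\ mean U <= k.
Proof.
move=> mU U0 Uk; have U1 : L1 U by apply: ge0_L1 => //; exact: le_lt_trans Uk (ltry _).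
by split=> //; rewrite -lee_fin EFin_mean.
Qed.

Lemma L1M_indic U A : measurable A -> L1 U -> L1 (fun w => \1_A w * U w).
Proof.
move=> mA U1; apply: (L1_le _ U1) => [|w].
  by apply: measurable_funM => //; exact: L1_measurable.
by rewrite normrM ler_piMl// indicE; case: (_ \in _); rewrite ?normr1 ?normr0.
Qed.

Lemma L2_measurable U : L2 U -> measurable_fun [set: T] U.
Proof. by case. Qed.

Lemma L2_sqr U : L2 U -> L1 (fun w => U w ^+ 2).
Proof. by case. Qed.

Lemma L2_le U V : measurable_fun [set: T] U -> L2 V ->
  (forall w, `|U w| <= `|V w|) -> L2 U.
Proof.
move=> mU [mV V2] UV; split => //.
apply: (L1_le _ V2) => [|w]; first exact: measurable_funX.
by rewrite !normrX lerXn2r// nnegrE.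
Qed.

Lemma L2M U V : L2 U -> L2 V -> L1 (fun w => U w * V w).
Proof.
move=> [mU U2] [mV V2]; apply: (L1_le _ (L1D U2 V2)) => [|w].
  exact: measurable_funM.
rewrite [leRHS]ger0_norm ?addr_ge0 ?sqr_ge0// ler_norml.
have h1 : 0 <= (U w + V w) ^+ 2 by exact: sqr_ge0.
have h2 : 0 <= (U w - V w) ^+ 2 by exact: sqr_ge0.
have h3 := sqr_ge0 (U w); have h4 := sqr_ge0 (V w).
by apply/andP; split; nra.
Qed.

Lemma L2D U V : L2 U -> L2 V -> L2 (fun w => U w + V w).
Proof.
move=> U2 V2; split; first by apply: measurable_funD; [case: U2|case: V2].
under eq_fun do rewrite sqrrD.
apply: L1D; last exact: L2_sqr.
apply: L1D; first exact: L2_sqr.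
by under eq_fun do rewrite -mulr_natl; apply: L1Z; exact: L2M.
Qed.

Lemma L2Z (k : R) U : L2 U -> L2 (fun w => k * U w).
Proof.
move=> [mU U2]; split; first exact: measurable_funM.
by under eq_fun do rewrite exprMn; exact: L1Z.
Qed.

Lemma L2N U : L2 U -> L2 (fun w => - U w).
Proof. by move=> U1; under eq_fun do rewrite -mulN1r; exact: L2Z. Qed.

Lemma L2B U V : L2 U -> L2 V -> L2 (fun w => U w - V w).
Proof. by move=> U1 V1; apply: L2D => //; exact: L2N. Qed.

Lemma L2_sum (I : Type) (r : seq I) (Q : pred I) (U : I -> T -> R) :
  (forall i, Q i -> L2 (U i)) -> L2 (fun w => \sum_(i <- r | Q i) U i w).
Proof.
move=> U1; elim: r => [|i r ih].
  by under eq_fun do rewrite big_nil; exact: L2_0.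
under eq_fun do rewrite big_cons.
by have [Qi|_] := boolP (Q i); [exact: L2D (U1 _ Qi) ih|exact: ih].
Qed.

Lemma L2M_indic U A : measurable A -> L2 U -> L2 (fun w => \1_A w * U w).
Proof.
move=> mA U2; apply: (L2_le _ U2) => [|w].
  by apply: measurable_funM => //; exact: L2_measurable.
by rewrite normrM ler_piMl// indicE; case: (_ \in _); rewrite ?normr1 ?normr0.
Qed.

Lemma mean_sqr_ge0 U : 0 <= mean (fun w => U w ^+ 2).
Proof. by apply: mean_ge0 => w; exact: sqr_ge0. Qed.

(** The discriminant of the nonnegative quadratic [k |-> E[(k U + V)^2]]. *)
Lemma cauchy_schwarz U V : L2 U -> L2 V ->
  `|mean (fun w => U w * V w)| <=
  Num.sqrt (mean (fun w => U w ^+ 2)) * Num.sqrt (mean (fun w => V w ^+ 2)).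
Proof.
move=> U2 V2.
set a := mean (fun w => U w ^+ 2); set c := mean (fun w => V w ^+ 2).
set b := mean _.
have a0 : 0 <= a := mean_sqr_ge0 _.
have c0 : 0 <= c := mean_sqr_ge0 _.
have quad k : 0 <= k ^+ 2 * a + 2 * k * b + c.
  have := mean_sqr_ge0 (fun w => k * U w + V w).
  rewrite (_ : (fun w => _) =
    fun w => (k ^+ 2 * U w ^+ 2 + (2 * k) * (U w * V w)) + V w ^+ 2); last first.
    by apply/funext => w; ring.
  have L2a : L1 (fun w => k ^+ 2 * U w ^+ 2) by apply: L1Z; exact: L2_sqr.
  have L2b : L1 (fun w => 2 * k * (U w * V w)) by apply: L1Z; exact: L2M.
  rewrite meanD; [|exact: L1D|exact: L2_sqr].
  rewrite meanD// !meanZ//; [exact: L2M|exact: L2_sqr].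
rewrite -sqrtrM// -sqrtr_sqr ler_wsqrtr//.
have [a_eq0|a_neq0] := eqVneq a 0.
  have [->|b_neq0] := eqVneq b 0; first by rewrite expr0n/= mulr_ge0.
  have := quad (- (c + 1) / (2 * b)).
  rewrite a_eq0 mulr0 add0r (_ : 2 * _ * b = - (c + 1)); first by lra.
  by field.
have := quad (- b / a); have ap : 0 < a by rewrite lt0r a_neq0.
rewrite (_ : _ + c = (a * c - b ^+ 2) / a); last by field.
by rewrite pmulr_lge0 ?invr_gt0// subr_ge0.
Qed.

End integrals.

Section probability_integrals.
Context (R : realType) (disp : measure_display) (T : measurableType disp).
Context (P : probability T R).
Implicit Types (U V Z : T -> R) (A : set T).

Lemma L1_cst (k : R) : L1 P (fun=> k).
Proof. exact: finite_measure_integrable_cst. Qed.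

Lemma mean_cst (k : R) : mean P (fun=> k) = k.
Proof. rewrite /mean Rintegral_cst// -[RHS]mulr1; congr (_ * _).
by rewrite [X in fine X](_ : _ = 1%E)//; exact: probability_setT. Qed.

Lemma L1_indic A : measurable A -> L1 P (\1_A).
Proof. by move=> mA; exact: integrable_indic. Qed.

Lemma mean_indic A : measurable A -> mean P (\1_A) = fine (P A).
Proof. by move=> mA; rewrite /mean /Rintegral integral_indic// setIT. Qed.

Lemma L2_bounded U (k : R) : measurable_fun [set: T] U ->
  (forall w, `|U w| <= k) -> L2 P U.
Proof.
move=> mU Uk; split => //.
apply: (L1_le _ (L1_cst (k ^+ 2))) => [|w]; first exact: measurable_funX.
rewrite !normrX lerXn2r// ?nnegrE//.
by rewrite (le_trans (Uk w))// ler_norm.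
Qed.

Lemma L2_cst (k : R) : L2 P (fun=> k).
Proof. by split => //; exact: L1_cst. Qed.

Lemma L2_L1 U : L2 P U -> L1 P U.
Proof.
by move=> U2; have := L2M U2 (L2_cst 1); under eq_fun do rewrite mulr1.
Qed.

End probability_integrals.

Lemma sqr_sum_le (R : realType) (I : finType) (x : I -> R) :
  (\sum_i x i) ^+ 2 <= #|I|%:R * \sum_i x i ^+ 2.
Proof.
have -> : (\sum_i x i) ^+ 2 = \sum_i \sum_j x i * x j.
  by rewrite expr2 mulr_suml; apply: eq_bigr => i _; rewrite mulr_sumr.
have le1 : \sum_i \sum_j x i * x j <=
    \sum_(i : I) \sum_(j : I) (x i ^+ 2 + x j ^+ 2) / 2.
  apply: ler_sum => i _; apply: ler_sum => j _.
  by have := sqr_ge0 (x i - x j); nra.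
apply: le_trans le1 _.
have -> : \sum_(i : I) \sum_(j : I) (x i ^+ 2 + x j ^+ 2) / 2 =
    \sum_(i : I) ((#|I|%:R * x i ^+ 2 + \sum_(j : I) x j ^+ 2) / 2).
  apply: eq_bigr => i _; rewrite -mulr_suml big_split/= sumr_const.
  by rewrite mulr_natl.
rewrite -mulr_suml big_split/= -mulr_sumr sumr_const -mulr_natl.
by rewrite (_ : #|xpredT| = #|I|)//; lra.
Qed.

Lemma mean_sqr_sum_le (R : realType) (disp : measure_display) (T : measurableType disp)
    (mu : {measure set T -> \bar R}) (I : finType) (U : I -> T -> R) (c : R) :
  (forall i, L2 mu (U i)) -> (forall i, mean mu (fun w => U i w ^+ 2) <= c) ->
  mean mu (fun w => (\sum_i U i w) ^+ 2) <= #|I|%:R ^+ 2 * c.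
Proof.
move=> UL Uc; have U1 i : L1 mu (fun w => U i w ^+ 2) := L2_sqr (UL i).
have S1 : L1 mu (fun w => \sum_i U i w ^+ 2) by exact: L1_sum.
apply: (@le_trans _ _ (mean mu (fun w => #|I|%:R * \sum_i U i w ^+ 2))).
  apply: le_mean => [||w]; last exact: sqr_sum_le.
    by apply: L2_sqr; exact: L2_sum.
  exact: L1Z.
rewrite meanZ// expr2 -mulrA ler_wpM2l// mean_sum//.
by apply: le_trans (ler_sum _ (fun i _ => Uc i)) _; rewrite sumr_const mulr_natl.
Qed.

(** * Limit theorems, transfer of laws, moments of the normal law *)

Section limit_theorems.
Context (R : realType) (disp : measure_display) (T : measurableType disp).
Context (mu : {measure set T -> \bar R}).
Implicit Types (U V Z : T -> R) (A : set T).

Lemma cvg_mean (f : nat -> T -> R) U V :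
  (forall n, measurable_fun [set: T] (f n)) -> measurable_fun [set: T] U ->
  L1 mu V -> (forall n w, `|f n w| <= V w) ->
  {ae mu, forall w, f n w @[n --> \oo] --> U w} ->
  L1 mu U /\ mean mu (f n) @[n --> \oo] --> mean mu U.
Proof.
move=> mf mU V1 fV fU.
have := @dominated_convergence _ T R mu _ measurableT (fun n => EFin \o f n)
  (EFin \o U) (EFin \o V).
case => [n|||||U1 _ cvgf].
- exact/measurable_EFinP.
- exact/measurable_EFinP.
- by apply: filterS fU => w fUw _; apply/cvg_EFin => //; exact: nearW.
- exact: V1.
- by apply: aeW => w n _; rewrite lee_fin.
split=> //; apply: (@fine_cvg _ _ _ _ (fun n => \int[mu]_w (f n w)%:E)%E).
by rewrite fineK//; exact: integrable_fin_num.
Qed.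

Lemma mean_fatou (f : nat -> T -> R) U (c : R) :
  (forall n, L1 mu (f n)) -> (forall n w, 0 <= f n w) ->
  (forall n, mean mu (f n) <= c) -> (forall w, f n w @[n --> \oo] --> U w) ->
  L1 mu U /\ mean mu U <= c.
Proof.
move=> f1 f0 fc fU.
have U0 w : 0 <= U w.
  by apply: (cvgr_to_ge (fU w)); exact: nearW.
have mU : measurable_fun [set: T] U.
  apply: (measurable_fun_cvg (fun n => L1_measurable (f1 n))) => w _.
  exact: fU.
apply: ge0_L1_le => //.
have liminfE : (fun w => limn_einf (fun n => (f n w)%:E)) = (fun w => (U w)%:E).
  apply/funext => w.
  have cvgw : (f n w)%:E @[n --> \oo] --> (U w)%:E.
    by apply: cvg_EFin; [exact: nearW|exact: fU].
  by rewrite is_cvg_limn_einfE; [exact/cvg_lim|exact: cvgP cvgw].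
have := @fatou _ _ _ mu _ measurableT (fun n w => (f n w)%:E)
  (fun n => measurable_int _ (f1 n)) (fun n w _ => f0 n w).
rewrite liminfE => /le_trans; apply.
rewrite limn_einf_lim; apply: lime_le; first exact: is_cvg_einfs.
apply: nearW => n; apply: (@le_trans _ _ (\int[mu]_w (f n w)%:E)%E).
  by apply: ereal_inf_lbound; exists n => //=.
by rewrite -EFin_mean// lee_fin.
Qed.

End limit_theorems.

(** Independence is only used in the following form: [h] depends on the past,
    [V] is a later increment, and [V] pushes the possibly signed measure
    [h mu] forward to [c nu]. *)
Section weighted_transfer.
Context (R : realType) (d d' : measure_display).
Context (T : measurableType d) (T' : measurableType d').
Context (mu : {measure set T -> \bar R}) (nu : probability T' R).
Context (h : T -> R) (V : T -> T') (c : R).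
Hypothesis h1 : L1 mu h.
Hypothesis mV : measurable_fun [set: T] V.
Hypothesis hV : forall B, measurable B ->
  mean mu (fun w => h w * \1_B (V w)) = c * fine (nu B).

Import HBNNSimple.

Let simple_transfer (g : {nnsfun T' >-> R}) :
  L1 mu (fun w => h w * g (V w)) /\
  mean mu (fun w => h w * g (V w)) = c * mean nu g.
Proof.
pose s := fset_set (range g).
have gE x : g x = \sum_(i < #|` s|) (s`_i * \1_(g @^-1` [set s`_i]) x).
  by rewrite {1}fimfunEord.
have mg i : measurable (g @^-1` [set s`_i]) by exact: measurable_sfunP.
have hi i : L1 mu (fun w => h w * \1_(g @^-1` [set s`_i]) (V w)).
  apply: (L1_le _ h1) => [|w].
    apply: measurable_funM; first exact: L1_measurable h1.
    by apply: measurableT_comp mV; exact: measurable_indic.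
  by rewrite normrM ler_piMr// indicE; case: (_ \in _); rewrite ?normr1 ?normr0.
have hgE : (fun w => h w * g (V w)) =
    fun w => \sum_(i < #|` s|) s`_i * (h w * \1_(g @^-1` [set s`_i]) (V w)).
  apply/funext => w; rewrite gE mulr_sumr; apply: eq_bigr => i _; ring.
have nui i : L1 nu (fun y => s`_i * \1_(g @^-1` [set s`_i]) y).
  by apply: L1Z; exact: L1_indic.
split; first by rewrite hgE; apply: L1_sum => i _; exact: L1Z.
rewrite hgE mean_sum => [|i _]; last exact: L1Z.
have -> : mean nu g = \sum_(i < #|` s|) s`_i * fine (nu (g @^-1` [set s`_i])).
  transitivity (mean nu (fun x => \sum_(i < #|` s|) (s`_i * \1_(g @^-1` [set s`_i]) x))).
    by congr mean; exact/funext.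
  rewrite mean_sum//; apply: eq_bigr => i _.
  by rewrite meanZ ?mean_indic//; exact: L1_indic (mg i).
rewrite mulr_sumr; apply: eq_bigr => i _.
by rewrite meanZ// hV//; ring.
Qed.

Let approx_le (f : T' -> R) (mf : measurable_fun setT (EFin \o f)) n y :
  (forall y, 0 <= f y) -> nnsfun_approx measurableT mf n y <= f y.
Proof.
move=> f0; rewrite nnsfun_approxE -lee_fin.
by apply: (@le_approx _ _ _ setT (EFin \o f)) => // x _; rewrite lee_fin.
Qed.

Let approx_cvg (f : T' -> R) (mf : measurable_fun setT (EFin \o f)) y :
  (forall y, 0 <= f y) -> nnsfun_approx measurableT mf n y @[n --> \oo] --> f y.
Proof.
move=> f0; apply: (@fine_cvg _ _ _ _ (fun n => (nnsfun_approx measurableT mf n y)%:E)).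
by apply: (cvg_nnsfun_approx measurableT mf) => // x _; rewrite lee_fin.
Qed.

Let ge0_transfer (f : T' -> R) : (forall y, 0 <= f y) -> L1 nu f ->
  L1 mu (fun w => h w * f (V w)) ->
  mean mu (fun w => h w * f (V w)) = c * mean nu f.
Proof.
move=> f0 f1 hf1.
have mf : measurable_fun [set: T'] (EFin \o f) := measurable_int _ f1.
pose g := nnsfun_approx measurableT mf.
have gle n y : g n y <= f y by exact: approx_le.
have g0 n y : 0 <= g n y by [].
have [_ cvg1] : L1 mu (fun w => h w * f (V w)) /\
    mean mu (fun w => h w * g n (V w)) @[n --> \oo] -->
    mean mu (fun w => h w * f (V w)).
  apply: (cvg_mean _ _ (L1_abs hf1)) => [n||n w|].
  - by have [] := simple_transfer (g n); move/L1_measurable.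
  - exact: L1_measurable hf1.
  - by rewrite !normrM ler_wpM2l// !ger0_norm.
  - by apply: aeW => w; apply: cvgM; [exact: cvg_cst|exact: approx_cvg].
have [_ cvg2] : L1 nu f /\ mean nu (g n) @[n --> \oo] --> mean nu f.
  apply: (cvg_mean _ _ f1) => [n||n w|].
  - exact: measurable_funP.
  - exact: L1_measurable f1.
  - by rewrite ger0_norm.
  - by apply: aeW => w; exact: approx_cvg.
have cvg3 : mean mu (fun w => h w * g n (V w)) @[n --> \oo] --> c * mean nu f.
  under eq_cvg do rewrite (simple_transfer _).2.
  by apply: cvgM => //; exact: cvg_cst.
exact: (cvg_unique _ cvg1 cvg3).
Qed.

(** From indicators to simple functions by linearity, to nonnegative functions by
    dominated convergence, and to the difference of positive and negative
    parts. *)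
Lemma weighted_transfer (f : T' -> R) : L1 nu f ->
  L1 mu (fun w => h w * f (V w)) ->
  mean mu (fun w => h w * f (V w)) = c * mean nu f.
Proof.
move=> f1 hf1; have mf := L1_measurable f1.
pose p := f^\+; pose n := f^\-.
have fpn y : f y = p y - n y by rewrite -[in LHS](funrposBneg f).
have pm : measurable_fun [set: T'] p by exact: measurable_funrpos.
have nm : measurable_fun [set: T'] n by exact: measurable_funrneg.
have p0 y : 0 <= p y by exact: funrpos_ge0.
have n0 y : 0 <= n y by exact: funrneg_ge0.
have pnabs y : p y + n y = `|f y| by rewrite -[RHS]/((Num.norm \o f) y) -funrposDneg.
have ple y : `|p y| <= `|f y| by rewrite ger0_norm// -pnabs lerDl.
have nle y : `|n y| <= `|f y| by rewrite ger0_norm// -pnabs lerDr.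
have p1 : L1 nu p by exact: L1_le f1 ple.
have n1 : L1 nu n by exact: L1_le f1 nle.
have mh := L1_measurable h1.
have hp1 : L1 mu (fun w => h w * p (V w)).
  apply: L1_le hf1 _ => [|w]; last by rewrite !normrM ler_wpM2l.
  by apply: measurable_funM => //; exact: measurableT_comp mV.
have hn1 : L1 mu (fun w => h w * n (V w)).
  apply: L1_le hf1 _ => [|w]; last by rewrite !normrM ler_wpM2l.
  by apply: measurable_funM => //; exact: measurableT_comp mV.
rewrite (_ : f = fun y => p y - n y); last exact/funext.
under [X in mean mu X]eq_fun do rewrite mulrBr.
by rewrite !meanB// !ge0_transfer// mulrBr.
Qed.

(** For nonnegative data integrability comes for free, by Fatou's lemma along
    simple functions. This gives square integrability of stochastic
    increments. *)
Lemma ge0_weighted_transfer_L1 (f : T' -> R) : (forall w, 0 <= h w) ->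
  (forall y, 0 <= f y) -> L1 nu f -> L1 mu (fun w => h w * f (V w)).
Proof.
move=> h0 f0 f1.
have mf : measurable_fun [set: T'] (EFin \o f) := measurable_int _ f1.
have mfr := L1_measurable f1.
pose g := nnsfun_approx measurableT mf.
have gle n y : g n y <= f y by exact: approx_le.
have [] := @mean_fatou _ _ _ mu (fun n w => h w * g n (V w))
  (fun w => h w * f (V w)) (c * mean nu f) => //.
- by move=> n; have [] := simple_transfer (g n).
- by move=> n w; rewrite mulr_ge0.
- move=> n; have c0 : 0 <= c.
    have := hV measurableT; rewrite [X in fine X](_ : _ = 1%E); last first.
      exact: probability_setT.
    by rewrite /= mulr1 => <-; apply: mean_ge0 => w; rewrite mulr_ge0// indicE.
  rewrite (simple_transfer _).2 ler_wpM2l// le_mean//.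
  by apply: L1_le f1 _ => [|y]; [exact: measurable_funP|rewrite !ger0_norm].
- by move=> w; apply: cvgM; [exact: cvg_cst|exact: approx_cvg].
Qed.

End weighted_transfer.

Section normal_moments.
Context (R : realType) (sigma : R).
Hypothesis s0 : sigma != 0.
Local Notation mu := (@lebesgue_measure R).
Local Notation pdf := (normal_pdf 0 sigma).
Local Notation N := (normal_prob 0 sigma).

Let pdf1 : L1 mu pdf.
Proof. exact: integrable_normal_pdf. Qed.

Let mean_pdf_indic (B : set R) : measurable B ->
  mean mu (fun x => pdf x * \1_B x) = 1 * fine (N B).
Proof.
move=> mB; rewrite mul1r /mean /Rintegral /normal_prob; congr fine.
rewrite [RHS]integral_mkcond; apply: eq_integral => x _.
by rewrite /patch indicE; case: (x \in B); rewrite ?mulr1 ?mulr0.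
Qed.

Lemma mean_normalE (f : R -> R) : L1 N f -> L1 mu (fun x => pdf x * f x) ->
  mean N f = mean mu (fun x => pdf x * f x).
Proof.
move=> f1 pf1.
by rewrite (weighted_transfer pdf1 (@measurable_id _ _ _) mean_pdf_indic) ?mul1r.
Qed.

Let c : R := - (sigma ^+ 2 *+ 2)^-1.

Let pdfE : pdf = fun x => normal_peak sigma * expR (c * x ^+ 2).
Proof.
rewrite (normal_pdfE _ s0); apply/funext => x.
by rewrite /normal_fun /c subr0; congr (_ * expR _); ring.
Qed.

Let is_derive_pdf (x : R) : is_derive x 1 pdf (- (x / sigma ^+ 2) * pdf x).
Proof.
rewrite pdfE.
have dX : is_derive x 1 (fun y : R => c * y ^+ 2) (c * (2 * x)).
  apply: is_derive_eq; rewrite /GRing.scale/=; ring.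
have dE : is_derive x 1 (expR \o (fun y : R => c * y ^+ 2)) (expR (c * x ^+ 2) * (c * (2 * x))).
  exact: is_derive1_comp.
apply: is_derive_eq; rewrite /GRing.scale/= /c; field.
exact: s0.
Qed.

(** This primitive gives the variance: integrate over [[- a, a]] and let [a] tend
    to infinity, the boundary term vanishing by [tail_pdf]. *)
Let is_derive_xpdf (x : R) :
  is_derive x 1 (fun y => y * pdf y) (pdf x - x ^+ 2 / sigma ^+ 2 * pdf x).
Proof.
have := is_deriveM (is_derive_id x 1) (is_derive_pdf x).
rewrite /GRing.scale/= => h.
have -> : pdf x - x ^+ 2 / sigma ^+ 2 * pdf x =
  x * (- (x / sigma ^+ 2) * pdf x) + pdf x * 1 by field.
exact: h.
Qed.

Let itv_primitive (F f : R -> R) (a : R) : 0 < a ->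
  (forall x : R, is_derive x 1 F (f x)) -> continuous f ->
  L1 mu (fun x => \1_(`[- a, a]%classic) x * f x) /\
  mean mu (fun x => \1_(`[- a, a]%classic) x * f x) = F a - F (- a).
Proof.
move=> a0 dF cf.
have cF : continuous F.
  by move=> x; apply: differentiable_continuous; apply/derivable1_diffP.
have E : (fun x => (\1_(`[- a, a]%classic) x * f x)%:E) =
    (EFin \o f) \_ `[- a, a].
  apply/funext => x; rewrite /patch indicE.
  by case: (x \in _); rewrite ?mul1r ?mul0r.
have fi : mu.-integrable `[- a, a] (EFin \o f).
  apply: continuous_compact_integrable; first exact: segment_compact.
  exact: continuous_subspaceT.
split; first by rewrite /L1 -[EFin \o _]/(fun x => _%:E) E -integrable_mkcond.
rewrite /mean /Rintegral E -integral_mkcond (@continuous_FTC2 _ f F) //=.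
- by rewrite gtrN.
- exact: continuous_subspaceT.
- split=> [x _||]; first exact: ex_derive.
  + by apply: cvg_at_right_filter; exact: cF.
  + by apply: cvg_at_left_filter; exact: cF.
- by move=> x _; rewrite derive1E derive_val.
Qed.

Let ind (n : nat) : R -> R := \1_(`[- n.+1%:R, n.+1%:R]%classic).

Let mind n : measurable_fun setT (ind n).
Proof. exact: measurable_indic. Qed.

Let ind_bound n x : 0 <= ind n x <= 1.
Proof. by rewrite /ind indicE; case: (_ \in _); rewrite lexx ler01. Qed.

Let cvg_ind x : ind n x @[n --> \oo] --> (1 : R).
Proof.
apply: cvg_near_cst; near=> n.
rewrite /ind indicE mem_set//= in_itv/= -ler_norml.
apply: (@le_trans _ _ n%:R); last by rewrite ler_nat.
by near: n; exact: nbhs_infty_ger.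
Unshelve. all: by end_near. Qed.

Let pdfN x : pdf (- x) = pdf x.
Proof. by rewrite pdfE sqrrN. Qed.

Let tail_pdf : n.+1%:R * pdf n.+1%:R @[n --> \oo] --> (0 : R).
Proof.
rewrite pdfE.
have le_tail n : 0 <= n.+1%:R * (normal_peak sigma * expR (c * n.+1%:R ^+ 2))
    <= normal_peak sigma * sigma ^+ 2 *+ 2 * n.+1%:R^-1.
  have n0 : 0 < n.+1%:R :> R by rewrite ltr0n.
  have p0 := normal_peak_ge0 sigma.
  have s20 : 0 < sigma ^+ 2 *+ 2 by rewrite pmulrn_lgt0// exprn_even_gt0.
  apply/andP; split; first by rewrite !mulr_ge0// ?expR_ge0// ltW.
  have y0 : 0 < n.+1%:R ^+ 2 / (sigma ^+ 2 *+ 2) by rewrite divr_gt0// exprn_gt0.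
  have : expR (c * n.+1%:R ^+ 2) <= (n.+1%:R ^+ 2 / (sigma ^+ 2 *+ 2))^-1.
    rewrite /c mulNr expRN lef_pV2 ?posrE ?expR_gt0// mulrC.
    by apply: le_trans (expR_ge1Dx _); rewrite lerDr.
  move=> /(ler_wpM2l p0)/(ler_wpM2l (ltW n0))/le_trans; apply.
  rewrite le_eqVlt; apply/orP; left; apply/eqP; field.
  by rewrite s0 gt_eqF// addrC natr1.
have near_tail : \forall n \near \oo,
    0 <= n.+1%:R * (normal_peak sigma * expR (c * n.+1%:R ^+ 2))
    <= normal_peak sigma * sigma ^+ 2 *+ 2 * n.+1%:R^-1 by exact: nearW.
apply: (squeeze_cvgr near_tail).
- exact: cvg_cst.
- rewrite -[X in _ --> X](mulr0 (normal_peak sigma * sigma ^+ 2 *+ 2)).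
  by apply: cvgM; [exact: cvg_cst|exact: cvg_harmonic].
Qed.

Let mean_ind_sqr n : L1 N (fun x => ind n x * x ^+ 2) /\
  mean N (fun x => ind n x * x ^+ 2) =
  sigma ^+ 2 * (mean N (ind n) - (n.+1%:R * pdf n.+1%:R) *+ 2).
Proof.
have n0 : 0 < n.+1%:R :> R by rewrite ltr0n.
have cpdf : continuous pdf by exact: continuous_normal_pdf.
have cf : continuous (fun x => pdf x - x ^+ 2 / sigma ^+ 2 * pdf x).
  move=> x; apply: continuousB; first exact: cpdf.
  apply: continuousM; last exact: cpdf.
  by apply: continuousM; [exact: exprn_continuous|exact: cst_continuous].
have [i1 e1] := @itv_primitive _ _ n.+1%:R n0 is_derive_xpdf cf.
have i2 : L1 mu (fun x => ind n x * pdf x) by exact: L1M_indic.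
have iN : L1 N (ind n) by exact: L1_indic.
have e2 : mean mu (fun x => ind n x * pdf x) = mean N (ind n).
  rewrite mean_normalE//; last by under eq_fun do rewrite mulrC.
  by congr mean; apply/funext => x; rewrite mulrC.
have E : (fun x => pdf x * (ind n x * x ^+ 2)) = fun x => sigma ^+ 2 *
    (ind n x * pdf x - ind n x * (pdf x - x ^+ 2 / sigma ^+ 2 * pdf x)).
  by apply/funext => x; field.
have iL : L1 mu (fun x => pdf x * (ind n x * x ^+ 2)).
  by rewrite E; apply: L1Z; exact: L1B.
have iNs : L1 N (fun x => ind n x * x ^+ 2).
  apply: L2_L1; apply: (@L2_bounded _ _ _ _ _ (n.+1%:R ^+ 2)) => [|x].
      exact: (@measurable_funM _ _ _ _ (ind n) (fun x => x ^+ 2) (mind n) (exprn_measurable _)).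
  rewrite /ind indicE; have [|_] := boolP (_ \in _); last by rewrite mul0r normr0 sqr_ge0.
  move=> /set_mem /=; rewrite in_itv/= -ler_norml mul1r normrX => xn.
  by rewrite lerXn2r// nnegrE// ltW.
split=> //; rewrite mean_normalE// E meanZ; last exact: L1B.
by rewrite meanB// e2 e1 pdfN; ring.
Qed.

Lemma normal_sqr : L1 N (fun x => x ^+ 2) /\ mean N (fun x => x ^+ 2) = sigma ^+ 2.
Proof.
have cvgN : mean N (ind n) @[n --> \oo] --> (1 : R).
  have [_] : L1 N (cst 1) /\ mean N (ind n) @[n --> \oo] --> mean N (cst 1).
    apply: (cvg_mean _ _ (L1_cst N 1)) => // [n x|].
      by have /andP[h0 h1] := ind_bound n x; rewrite ger0_norm.
    by apply: aeW => x; exact: cvg_ind.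
  by rewrite mean_cst.
have cvgs x : ind n x * x ^+ 2 @[n --> \oo] --> x ^+ 2.
  by rewrite -[X in _ --> X]mul1r; apply: cvgM; [exact: cvg_ind|exact: cvg_cst].
have [i1 _] : L1 N (fun x => x ^+ 2) /\ mean N (fun x => x ^+ 2) <= sigma ^+ 2.
  apply: (@mean_fatou _ _ _ N (fun n x => ind n x * x ^+ 2)) => //.
  - by move=> n; have [] := mean_ind_sqr n.
  - by move=> n x; rewrite mulr_ge0 ?sqr_ge0//; have /andP[] := ind_bound n x.
  - move=> n; rewrite (mean_ind_sqr n).2 ler_piMr ?sqr_ge0// lerBlDr.
    apply: (@le_trans _ _ 1); last by rewrite lerDl mulrn_wge0// mulr_ge0// normal_pdf_ge0.
    rewrite -[leRHS](mean_cst N 1); apply: le_mean; [exact: L1_indic|exact: L1_cst|].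
    by move=> x; have /andP[] := ind_bound n x.
split=> //.
have [_ c1] : L1 N (fun x => x ^+ 2) /\
    mean N (fun x => ind n x * x ^+ 2) @[n --> \oo] --> mean N (fun x => x ^+ 2).
  apply: (cvg_mean _ _ i1) => [n||n x|].
  - by have [/L1_measurable] := mean_ind_sqr n.
  - exact: L1_measurable i1.
  - have /andP[h0 h1] := ind_bound n x.
    rewrite ger0_norm; last by rewrite mulr_ge0 ?sqr_ge0.
    by rewrite ler_piMl ?sqr_ge0.
  - by apply: aeW => x; exact: cvgs.
have c2 : mean N (fun x => ind n x * x ^+ 2) @[n --> \oo] --> sigma ^+ 2.
  rewrite (_ : (fun n => _) =
    fun n => sigma ^+ 2 * (mean N (ind n) - (n.+1%:R * pdf n.+1%:R) *+ 2)); last first.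
    by apply/funext => n; exact: (mean_ind_sqr n).2.
  rewrite -[X in _ --> X]mulr1; apply: cvgM; first exact: cvg_cst.
  rewrite -[X in _ --> X](subr0 1); apply: cvgB => //.
  by rewrite -[X in _ --> X](mul0rn _ 2); apply: cvgMn; exact: tail_pdf.
exact: (cvg_unique _ c1 c2).
Qed.

Lemma normal_L2 : L2 N id.
Proof. by split; [exact: measurable_id|exact: normal_sqr.1]. Qed.

Lemma normal_mean : mean N id = 0.
Proof.
have i1 : L1 N id := L2_L1 normal_L2.
have E n : mean N (fun x => ind n x * x) = 0.
  have n0 : 0 < n.+1%:R :> R by rewrite ltr0n.
  have dF (x : R) : is_derive x 1 (fun y => - sigma ^+ 2 * pdf y) (x * pdf x).
    have -> : x * pdf x = - sigma ^+ 2 * (- (x / sigma ^+ 2) * pdf x) by field.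
    exact: is_deriveZ.
  have cf : continuous (fun x : R => x * pdf x).
    by move=> x; apply: continuousM; [exact: cvg_id|exact: continuous_normal_pdf].
  have [i2 e2] := @itv_primitive _ _ n.+1%:R n0 dF cf.
  rewrite mean_normalE.
  - rewrite -[RHS](subrr (- sigma ^+ 2 * pdf n.+1%:R)) -{2}pdfN -e2.
    by congr mean; apply/funext => x; ring.
  - exact: L1M_indic.
  - by rewrite [X in L1 mu X](_ : _ = fun x => ind n x * (x * pdf x))//; apply/funext => x; ring.
have [_ c1] : L1 N id /\ mean N (fun x => ind n x * x) @[n --> \oo] --> mean N id.
  apply: (cvg_mean _ _ (L1_abs i1)) => [n||n x|].
  - exact: (@measurable_funM _ _ _ _ (ind n) id (mind n) (@measurable_id _ _ _)).
  - exact: L1_measurable i1.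
  - have /andP[h0 h1] := ind_bound n x.
    by rewrite normrM ger0_norm// ler_piMl.
  - apply: aeW => x; rewrite -[X in _ --> X]mul1r.
    by apply: cvgM; [exact: cvg_ind|exact: cvg_cst].
have c2 : mean N (fun x => ind n x * x) @[n --> \oo] --> (0 : R).
  by under eq_cvg do rewrite E; exact: cvg_cst.
exact: (cvg_unique _ c1 c2).
Qed.

End normal_moments.

(** * Convergence in probability on an event *)

Section convergence_in_probability.
Context (R : realType) (disp : measure_display) (T : measurableType disp).
Context (P : probability T R).
Implicit Types (U V Z : T -> R) (A B : set T) (D E : nat -> T -> R).

Definition pr A : R := fine (P A).

Lemma pr_ge0 A : 0 <= pr A.
Proof. exact: fine_ge0. Qed.

Lemma EFin_pr A : measurable A -> (pr A)%:E = P A.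
Proof. by move=> mA; rewrite fineK// fin_num_measure. Qed.

Lemma le_pr A B : measurable A -> measurable B -> A `<=` B -> pr A <= pr B.
Proof.
by move=> mA mB AB; rewrite -lee_fin !EFin_pr// le_measure// inE.
Qed.

Lemma pr_setU A B : measurable A -> measurable B ->
  pr (A `|` B) <= pr A + pr B.
Proof.
move=> mA mB; rewrite -lee_fin EFinD !EFin_pr//; last exact: measurableU.
exact: measureU2.
Qed.

Lemma measurable_ge_abs U (e : R) : measurable_fun [set: T] U ->
  measurable [set w | e <= `|U w|].
Proof.
move=> mU; rewrite -[X in measurable X]setTI.
by apply: measurable_fun_le => //; exact: measurableT_comp.
Qed.

(** Convergence in probability to 0 inside the event [A]: integrands will only be
    controlled on events where the path has stayed bounded. *)
Definition small_on A D : Prop := forall e : R, 0 < e ->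
  pr (A `&` [set w | e <= `|D n w|]) @[n --> \oo] --> (0 : R).

Lemma markov_sqr U (e : R) : L2 P U -> 0 < e ->
  pr [set w | e <= `|U w|] <= mean P (fun w => U w ^+ 2) / e ^+ 2.
Proof.
move=> U2 e0; have mB := measurable_ge_abs e (L2_measurable U2).
rewrite ler_pdivlMr ?exprn_gt0// /pr -mean_indic// mulrC -meanZ; last exact: L1_indic.
apply: le_mean; [by apply: L1Z; exact: L1_indic|exact: L2_sqr|].
move=> w; rewrite indicE; have [/set_mem /= Bw|_] := boolP (_ \in _).
  by rewrite mulr1 -[leRHS]real_normK ?num_real// lerXn2r// nnegrE ltW.
by rewrite mulr0 sqr_ge0.
Qed.

Lemma ae_pr_cvg0 (B : nat -> set T) : (forall n, measurable (B n)) ->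
  {ae P, forall w, \forall n \near \oo, ~ B n w} -> pr (B n) @[n --> \oo] --> (0 : R).
Proof.
move=> mB B0.
have [_] : L1 P (fun=> 0) /\ mean P (\1_(B n)) @[n --> \oo] --> mean P (fun=> 0).
  apply: (cvg_mean _ _ (L1_cst P 1)) => // [n w|].
    by rewrite indicE; case: (_ \in _); rewrite ?normr1 ?normr0.
  apply: filterS B0 => w nBw; apply: cvg_near_cst.
  by apply: filterS nBw => n nBw; rewrite indicE memNset.
by rewrite mean_cst; under eq_cvg do rewrite mean_indic//.
Qed.

Lemma ae_small_on A D : measurable A ->
  (forall n, measurable_fun [set: T] (D n)) ->
  {ae P, forall w, A w -> D n w @[n --> \oo] --> (0 : R)} -> small_on A D.
Proof.
move=> mA mD D0 e e0; apply: ae_pr_cvg0 => [n|].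
  by apply: measurableI => //; exact: measurable_ge_abs.
apply: filterS D0 => w Aw.
have [Ain|nA] := pselect (A w); last by apply: nearW => n -[].
have /cvgrPdist_lt /(_ _ e0) := Aw Ain; apply: filterS => n.
by rewrite sub0r normrN => De [_ /=]; rewrite leNgt De.
Qed.

Lemma small_on_le A D E : measurable A ->
  (forall n, measurable_fun [set: T] (D n)) ->
  (forall n, measurable_fun [set: T] (E n)) ->
  {ae P, forall w, forall n, `|E n w| <= `|D n w|} -> small_on A D -> small_on A E.
Proof.
move=> mA mD mE [N [mN N0 subN]] D0 e e0.
have h n : 0 <= pr (A `&` [set w | e <= `|E n w|]) <=
    pr (A `&` [set w | e <= `|D n w|]).
  rewrite pr_ge0/=.
  have mB : measurable (A `&` [set w | e <= `|D n w|]).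
    by apply: measurableI => //; exact: measurable_ge_abs.
  rewrite -[leRHS]addr0 (_ : 0 = pr N); last by rewrite /pr N0.
  apply: le_trans (pr_setU mB mN); apply: le_pr.
  - by apply: measurableI => //; exact: measurable_ge_abs.
  - exact: measurableU.
  - move=> w [Aw /= Ew]; have [Nw|nNw] := pselect (N w); [by right|left].
    split=> //=; apply: le_trans Ew _.
    by have := @subsetC _ _ _ subN w nNw; rewrite /setC/= notK; exact.
have near_h : \forall n \near \oo, 0 <= pr (A `&` [set w | e <= `|E n w|]) <=
    pr (A `&` [set w | e <= `|D n w|]) by exact: nearW.
exact: (squeeze_cvgr near_h (cvg_cst _) (D0 _ e0)).
Qed.

Lemma small_onD A D E : measurable A ->
  (forall n, measurable_fun [set: T] (D n)) ->
  (forall n, measurable_fun [set: T] (E n)) ->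
  small_on A D -> small_on A E -> small_on A (fun n w => D n w + E n w).
Proof.
move=> mA mD mE D0 E0 e e0.
have e20 : 0 < e / 2 by rewrite divr_gt0.
have h n : 0 <= pr (A `&` [set w | e <= `|D n w + E n w|]) <=
    pr (A `&` [set w | e / 2 <= `|D n w|]) + pr (A `&` [set w | e / 2 <= `|E n w|]).
  rewrite pr_ge0/=.
  have mB1 : measurable (A `&` [set w | e / 2 <= `|D n w|]).
    by apply: measurableI => //; exact: measurable_ge_abs.
  have mB2 : measurable (A `&` [set w | e / 2 <= `|E n w|]).
    by apply: measurableI => //; exact: measurable_ge_abs.
  apply: le_trans (pr_setU mB1 mB2); apply: le_pr.
  - by apply: measurableI => //; apply: measurable_ge_abs; exact: measurable_funD.
  - exact: measurableU.
  - move=> w [Aw /= DEw]; have [Dw|Dw] := leP (e / 2) `|D n w|; [by left|right].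
    by split=> //=; have := ler_normD (D n w) (E n w); lra.
have near_h : \forall n \near \oo,
    0 <= pr (A `&` [set w | e <= `|D n w + E n w|]) <=
    pr (A `&` [set w | e / 2 <= `|D n w|]) + pr (A `&` [set w | e / 2 <= `|E n w|]).
  exact: nearW.
apply: (squeeze_cvgr near_h (cvg_cst _)).
by rewrite -[X in _ --> X](addr0 0); apply: cvgD; [exact: D0|exact: E0].
Qed.

(** Since [min (|.|, K)] is bounded and 1-Lipschitz, the truncated second moment
    of the limit is at most that of [Z n] up to an error controlled by the
    probability of a large deviation, which vanishes. *)
Lemma fatou_in_probability A (Z : nat -> T -> R) U (c : R) : measurable A ->
  (forall n, L2 P (Z n)) -> measurable_fun [set: T] U ->
  (forall n, mean P (fun w => Z n w ^+ 2) <= c) ->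
  small_on A (fun n w => Z n w - U w) ->
  L2 P (fun w => \1_A w * U w) /\ mean P (fun w => (\1_A w * U w) ^+ 2) <= c.
Proof.
move=> mA Z2 mU Zc ZU.
have c0 : 0 <= c by apply: le_trans (Zc 0%N); exact: mean_sqr_ge0.
pose g (K : nat) w : R := \1_A w * Num.min `|U w| K%:R ^+ 2.
have min0 (K : nat) w : 0 <= Num.min `|U w| K%:R by rewrite le_min normr_ge0 ler0n.
have mmin (K : nat) : measurable_fun [set: T] (fun w => Num.min `|U w| K%:R).
  by apply: measurable_minr => //; exact: measurableT_comp.
have g1 K : L1 P (g K).
  apply: L1M_indic => //; apply: L2_sqr; apply: (@L2_bounded _ _ _ _ _ K%:R) => // w.
  by rewrite ger0_norm// ge_min lexx orbT.
have g_c K : mean P (g K) <= c.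
  (* [(z + e)^2 <= (1 + a) z^2 + b e^2] with [b = 1 + 1 / a]; then [a] and [e] are
     such that [a * c] and [b * e^2] are at most [t / 2]. *)
  apply/ler_addgt0Pr => t t0.
  pose a := t / (2 * (c + 1)).
  have a0 : 0 < a by rewrite divr_gt0// mulr_gt0// ltr_wpDl.
  have ac : a * c <= t / 2.
    rewrite -subr_ge0 (_ : t / 2 - a * c = a) ?ltW// /a; field.
    by rewrite gt_eqF// ltr_wpDl.
  pose b := 1 + a^-1.
  have b0 : 0 < b by rewrite addr_gt0// invr_gt0.
  pose e := Num.sqrt (t / (2 * b)).
  have e0 : 0 < e by rewrite sqrtr_gt0 divr_gt0// mulr_gt0.
  have be : b * e ^+ 2 = t / 2.
    by rewrite sqr_sqrtr ?divr_ge0 ?ltW ?mulr_gt0//; field; rewrite gt_eqF.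
  pose B n := A `&` [set w | e <= `|Z n w - U w|].
  have mB n : measurable (B n).
    apply: measurableI => //; apply: measurable_ge_abs.
    by apply: measurable_funB => //; exact: L2_measurable.
  have step n : mean P (g K) <= (1 + a) * c + b * (e ^+ 2 + K%:R ^+ 2 * pr (B n)).
    apply: (@le_trans _ _ (mean P (fun w =>
        (1 + a) * Z n w ^+ 2 + b * (e ^+ 2 + K%:R ^+ 2 * \1_(B n) w)))).
      have i1 : L1 P (fun w => e ^+ 2 + K%:R ^+ 2 * \1_(B n) w).
        by apply: L1D; [exact: L1_cst|apply: L1Z; exact: L1_indic].
      apply: le_mean => //; first by apply: L1D; apply: L1Z => //; exact: L2_sqr.
      move=> w; rewrite /g; set m := Num.min _ _.
      have m0 : 0 <= m := min0 K w.
      have Z0 := sqr_ge0 (Z n w).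
      have r0 : 0 <= e ^+ 2 + K%:R ^+ 2 * \1_(B n) w.
        by rewrite addr_ge0 ?sqr_ge0// mulr_ge0 ?sqr_ge0.
      have rhs0 : 0 <= (1 + a) * Z n w ^+ 2 + b * (e ^+ 2 + K%:R ^+ 2 * \1_(B n) w).
        by rewrite addr_ge0// mulr_ge0// ?ltW// addr_gt0.
      rewrite [\1_A w]indicE; have [/set_mem Aw|_] := boolP (w \in A); last by rewrite mul0r.
      rewrite mul1r; have [ZUe|ZUe] := leP e `|Z n w - U w|.
        rewrite [\1_(B n) w]indicE mem_set// mulr1.
        have mK : m <= K%:R by rewrite ge_min lexx orbT.
        have mK2 : m ^+ 2 <= K%:R ^+ 2 by rewrite lerXn2r// nnegrE.
        have b1 : 1 <= b by rewrite lerDl invr_ge0 ltW.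
        have h1 : m ^+ 2 <= e ^+ 2 + K%:R ^+ 2 by rewrite (le_trans mK2)// lerDr sqr_ge0.
        have h2 : e ^+ 2 + K%:R ^+ 2 <= b * (e ^+ 2 + K%:R ^+ 2).
          by rewrite ler_peMl// addr_ge0 ?sqr_ge0.
        rewrite (le_trans h1)// (le_trans h2)// lerDr mulr_ge0// ltW// addr_gt0//.
      rewrite [\1_(B n) w]indicE memNset; last by move=> [_ /=]; rewrite leNgt ZUe.
      rewrite mulr0 addr0.
      have mU1 : m <= `|Z n w| + e.
        have mU' : m <= `|U w| by rewrite ge_min lexx.
        have := ler_normB (Z n w) (Z n w - U w).
        by rewrite opprB addrCA subrr addr0; lra.
      have h1 : m ^+ 2 <= (`|Z n w| + e) ^+ 2.
        by rewrite lerXn2r// nnegrE addr_ge0// ltW.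
      apply: le_trans h1 _; rewrite -(real_normK (num_real (Z n w))).
      set z := `|Z n w|; rewrite -subr_ge0.
      have -> : (1 + a) * z ^+ 2 + b * e ^+ 2 - (z + e) ^+ 2 = (a * z - e) ^+ 2 / a.
        by rewrite /b; field; rewrite gt_eqF.
      by rewrite divr_ge0 ?sqr_ge0// ltW.
    have i1 : L1 P (fun w => e ^+ 2 + K%:R ^+ 2 * \1_(B n) w).
      by apply: L1D; [exact: L1_cst|apply: L1Z; exact: L1_indic].
    rewrite meanD; [|by apply: L1Z; exact: L2_sqr|exact: L1Z].
    rewrite !meanZ//; [|exact: L2_sqr].
    rewrite meanD; [|exact: L1_cst|by apply: L1Z; exact: L1_indic].
    rewrite mean_cst meanZ; last exact: L1_indic.
    by rewrite mean_indic// lerD2r ler_wpM2l// addr_ge0// ltW.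
  have cvg_step : (1 + a) * c + b * (e ^+ 2 + K%:R ^+ 2 * pr (B n)) @[n --> \oo] -->
      (1 + a) * c + b * (e ^+ 2 + K%:R ^+ 2 * 0).
    apply: cvgD; first exact: cvg_cst.
    apply: cvgM; first exact: cvg_cst.
    apply: cvgD; first exact: cvg_cst.
    by apply: cvgM; [exact: cvg_cst|exact: ZU].
  apply: le_trans (cvgr_to_ge cvg_step _) _; first exact: nearW.
  by rewrite mulr0 addr0 be; lra.
have cvg_g w : g K w @[K --> \oo] --> (\1_A w * U w) ^+ 2.
  apply: cvg_near_cst; near=> K.
  rewrite /g min_l; last by near: K; exact: nbhs_infty_ger.
  by rewrite real_normK ?num_real// exprMn indicE; case: (_ \in _); rewrite ?expr1n ?expr0n.
have [] := mean_fatou g1 _ g_c cvg_g.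
  by move=> K w; rewrite mulr_ge0 ?exprn_ge0.
by split=> //; split=> //; apply: measurable_funM => //; exact: measurable_indic.
Unshelve. all: by end_near. Qed.

End convergence_in_probability.

(** * Brownian increments and stochastic integrals on a grid *)

Section independence.
Context (R : realType) (disp : measure_display) (T : measurableType disp).
Context (P : probability T R).
Implicit Types (U h : T -> R).

Let law U (mU : measurable_fun [set: T] U) : probability _ R :=
  distribution P (mfun_Sub (mem_set mU : U \in mfun)).

Let mean_law U (mU : measurable_fun [set: T] U) : L1 P U ->
  L1 (law mU) id /\ mean (law mU) id = mean P U.
Proof.
move=> U1; split.
  by have := integrable_pushforward mU (@EFin_measurable _ _ : measurable_fun [set: R] EFin) U1 measurableT.
rewrite /mean /Rintegral /law integral_distribution//.
Qed.

(** With [c] the mean of [h], the last hypothesis is the independence of [h] and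
    [U] tested on the events of [U]. *)
Lemma independent_transfer h U (c : R) : L1 P h -> L1 P U ->
  L1 P (fun w => h w * U w) ->
  (forall B, measurable B -> mean P (fun w => h w * \1_B (U w)) = c * pr P (U @^-1` B)) ->
  mean P (fun w => h w * U w) = c * mean P U.
Proof.
move=> h1 U1 hU1 hB; have mU := L1_measurable U1.
have [l1 <-] := mean_law mU U1.
by apply: (weighted_transfer h1 mU _ l1 hU1) => B mB; exact: hB.
Qed.

End independence.

Section filtered.
Context (R : realType) (disp : measure_display) (T : measurableType disp).
Context (P : probability T R) (F : R -> set (set T)).
Hypothesis filtF : filtration F.

(** Measurability for the sigma-algebra generated by [F s], which is [F s] itself
    at the times [0 <= s]. Going through the generated sigma-algebra gives the
    closure properties of measurable functions at every [s]. *)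
Definition Fmeas (s : R) (U : T -> R) :=
  @measurable_fun _ _ (g_sigma_algebraType (F s)) R setT U.

Lemma FmeasP s U : 0 <= s ->
  Fmeas s U <-> forall B, measurable B -> F s (U @^-1` B).
Proof.
move=> s0; have [sF _ _] := filtF.
have FE : <<s F s >> = F s by apply: sigma_algebra_id; exact: sF.
split=> [mU B mB|mU _ B mB].
  by have := mU measurableT B mB; rewrite setTI => H; rewrite -FE; exact: H.
by rewrite setTI; apply: sub_sigma_algebra; exact: mU.
Qed.

Lemma Fmeas_cst s (k : R) : Fmeas s (fun=> k).
Proof. exact: measurable_cst. Qed.

Lemma FmeasD s U V : Fmeas s U -> Fmeas s V -> Fmeas s (fun w => U w + V w).
Proof. exact: measurable_funD. Qed.

Lemma FmeasB s U V : Fmeas s U -> Fmeas s V -> Fmeas s (fun w => U w - V w).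
Proof. exact: measurable_funB. Qed.

Lemma FmeasM s U V : Fmeas s U -> Fmeas s V -> Fmeas s (fun w => U w * V w).
Proof. exact: measurable_funM. Qed.

Lemma Fmeas_sum s (I : Type) (r : seq I) (Q : pred I) (U : I -> T -> R) :
  (forall i, Q i -> Fmeas s (U i)) -> Fmeas s (fun w => \sum_(i <- r | Q i) U i w).
Proof.
move=> mU; elim: r => [|i r ih].
  by under eq_fun do rewrite big_nil; exact: Fmeas_cst.
under eq_fun do rewrite big_cons.
by have [Qi|_] := boolP (Q i); [exact: FmeasD (mU _ Qi) ih|exact: ih].
Qed.

Lemma Fmeas_indic s (A : set T) : F s A -> Fmeas s (\1_A).
Proof. by move=> FA; apply: measurable_indic; exact: sub_sigma_algebra. Qed.

Lemma Fmeas_le s t U : 0 <= s -> s <= t -> Fmeas s U -> Fmeas t U.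
Proof.
move=> s0 st /FmeasP - /(_ s0) mU; apply/FmeasP; first exact: le_trans st.
by have [_ _ sub] := filtF; move=> B mB; apply: (sub s t) => //; exact: mU.
Qed.

Lemma Fmeas_measurable s U : 0 <= s -> Fmeas s U -> measurable_fun [set: T] U.
Proof.
move=> s0 /FmeasP - /(_ s0) mU _ B mB; rewrite setTI.
by have [_ sub _] := filtF; apply: (sub s) => //; exact: mU.
Qed.

Lemma adapted_Fmeas (X : R -> T -> R) s : adapted F X -> 0 <= s -> Fmeas s (X s).
Proof. by move=> aX s0; apply/FmeasP => // B mB; exact: aX. Qed.

Definition L2F (s : R) U := Fmeas s U /\ L2 P U.

Lemma L2FD s U V : L2F s U -> L2F s V -> L2F s (fun w => U w + V w).
Proof. by move=> [? ?] [? ?]; split; [exact: FmeasD|exact: L2D]. Qed.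

Lemma L2FB s U V : L2F s U -> L2F s V -> L2F s (fun w => U w - V w).
Proof. by move=> [? ?] [? ?]; split; [exact: FmeasB|exact: L2B]. Qed.

Lemma L2F_cst s (k : R) : L2F s (fun=> k).
Proof. by split; [exact: Fmeas_cst|exact: L2_cst]. Qed.

Lemma L2F_le s t U : 0 <= s -> s <= t -> L2F s U -> L2F t U.
Proof. by move=> s0 st [? ?]; split => //; exact: (Fmeas_le s0 st). Qed.

Lemma L2F_sum s (I : Type) (r : seq I) (Q : pred I) (U : I -> T -> R) :
  (forall i, Q i -> L2F s (U i)) -> L2F s (fun w => \sum_(i <- r | Q i) U i w).
Proof.
move=> mU; split; first by apply: Fmeas_sum => i /mU[].
by apply: L2_sum => i /mU[].
Qed.

Context (m : nat) (W : 'I_m -> R -> T -> R).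
Hypothesis bmW : brownian_motion P F W.

Section increment.
Context (s t : R).
Hypotheses (s0 : 0 <= s) (st : s < t).
Let N := normal_prob 0 (Num.sqrt (t - s)) : probability _ R.
Let dW i w := W i t w - W i s w.

Let FdW i : Fmeas t (dW i).
Proof.
have t0 : 0 <= t by rewrite (le_trans s0)// ltW.
apply: FmeasB; first by apply: adapted_Fmeas => //; exact: (bm_adapted bmW).
apply: (Fmeas_le s0 (ltW st)).
by apply: adapted_Fmeas => //; exact: (bm_adapted bmW).
Qed.

Let mdW i : measurable_fun [set: T] (dW i).
Proof. by apply: Fmeas_measurable (FdW i); rewrite (le_trans s0)// ltW. Qed.

(** The increments are constrained jointly because the axiom of Brownian motion
    only speaks of all of them at once; one or two of them are isolated by
    leaving the others free. *)
Let incr_in (B : 'I_m -> set R) := [set w | forall i, B i (dW i w)].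

Let incr_in_measurable B : (forall i, measurable (B i)) -> measurable (incr_in B).
Proof.
move=> mB; rewrite (_ : incr_in B = \bigcap_(i in [set: 'I_m]) (dW i @^-1` B i)).
  apply: fin_bigcap_measurable => // i _.
  by rewrite -[X in measurable X]setTI; exact: mdW.
by apply/seteqP; split=> [w wB i _|w wB i]; exact: wB.
Qed.

Let indic_incr1 i (B : set R) w : \1_(incr_in (fun k => if k == i then B else setT)) w =
  \1_B (dW i w) :> R.
Proof.
rewrite !indicE; congr (_ %:R); apply: congr1; apply/idP/idP => /set_mem.
  by move=> /(_ i)/=; rewrite eqxx => ?; exact: mem_set.
by move=> iB; apply/mem_set => k /=; case: eqP => [->|].
Qed.

Let indic_incr2 i j (B C : set R) w : i != j ->
  \1_(incr_in (fun k => if k == i then B else if k == j then C else setT)) w =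
  \1_B (dW i w) * \1_C (dW j w) :> R.
Proof.
move=> ij; rewrite !indicE -natrM mulnb; congr (_ %:R); apply: congr1.
apply/idP/andP => [/set_mem wB|[/set_mem iB /set_mem jC]].
  have := wB i; have := wB j; rewrite !eqxx eq_sym (negbTE ij) => ? ?.
  by split; exact: mem_set.
by apply/mem_set => k /=; case: eqP => [->//|_]; case: eqP => [->|].
Qed.

Let past_event (A : set T) B : F s A -> (forall i, measurable (B i)) ->
  pr P (A `&` incr_in B) = (\prod_i pr N (B i)) * pr P A.
Proof.
move=> FA mB; have [_ sub _] := filtF; have mA : measurable A by exact: (sub s).
apply: EFin_inj; rewrite EFinM -prodEFin EFin_pr; last first.
  by apply: measurableI => //; exact: incr_in_measurable.
rewrite (bm_increment bmW)// muleC EFin_pr//; congr (_ * _)%E.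
by apply: eq_bigr => i _; rewrite (EFin_pr N (mB i)).
Qed.

Let past_transfer U B : Fmeas s U -> L1 P U -> (forall i, measurable (B i)) ->
  mean P (fun w => U w * \1_(incr_in B) w) = mean P U * \prod_i pr N (B i).
Proof.
move=> FU U1 mB; have mU := L1_measurable U1; have mS := incr_in_measurable mB.
rewrite [RHS]mulrC -(@independent_transfer _ _ _ P (\1_(incr_in B)))//.
- by congr mean; apply/funext => w; rewrite mulrC.
- exact: L1_indic.
- exact: L1M_indic.
move=> C mC; rewrite -past_event//; last by have /FmeasP := FU; exact.
rewrite /pr -mean_indic; last first.
  apply: measurableI => //; rewrite -[X in measurable X]setTI; exact: mU.
congr mean; apply/funext => w; rewrite indicI mulrC/=.
by congr (_ * _).
Qed.

Let prod1 (i : 'I_m) (B : set R) :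
  \prod_(k < m) pr N (if k == i then B else setT) = pr N B.
Proof.
rewrite (bigD1 i)//= eqxx big1 ?mulr1// => k /negbTE ->.
by rewrite /pr [X in fine X](_ : _ = 1%E)//; exact: probability_setT.
Qed.

Let prod2 (i j : 'I_m) (B C : set R) : i != j ->
  \prod_(k < m) pr N (if k == i then B else if k == j then C else setT) = pr N B * pr N C.
Proof.
move=> ij; rewrite (bigD1 i)//= eqxx (bigD1 j)/= 1?eq_sym//.
rewrite (negbTE ij) eqxx big1 ?mulr1// => k /andP[/negbTE -> /negbTE ->].
by rewrite /pr [X in fine X](_ : _ = 1%E)//; exact: probability_setT.
Qed.

Let transfer1 i U (B : set R) : Fmeas s U -> L1 P U -> measurable B ->
  mean P (fun w => U w * \1_B (dW i w)) = mean P U * pr N B.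
Proof.
move=> FU U1 mB; rewrite -(prod1 i) -past_transfer//; last by move=> k; case: ifP.
by congr mean; apply/funext => w; rewrite indic_incr1.
Qed.

Let sigma0 : Num.sqrt (t - s) != 0.
Proof. by rewrite gt_eqF// sqrtr_gt0 subr_gt0. Qed.

Let meanN : mean N id = 0. Proof. exact: normal_mean. Qed.

Lemma mean_mul_increment i U : Fmeas s U -> L1 P U ->
  L1 P (fun w => U w * dW i w) -> mean P (fun w => U w * dW i w) = 0.
Proof.
move=> FU U1 UW1.
rewrite (weighted_transfer (nu := N) (c := mean P U) U1 (mdW i) _ (L2_L1 (normal_L2 sigma0)) UW1).
  by rewrite meanN mulr0.
by move=> B mB; exact: transfer1.
Qed.

Lemma L2_mul_increment i U : L2F s U -> L2 P (fun w => U w * dW i w) /\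
  mean P (fun w => (U w * dW i w) ^+ 2) = (t - s) * mean P (fun w => U w ^+ 2).
Proof.
move=> [FU U2]; have [n1 n2] := normal_sqr sigma0.
have mU := L2_measurable U2.
have FU2 : Fmeas s (fun w => U w ^+ 2).
  by under eq_fun do rewrite expr2; exact: FmeasM.
have tr B : measurable B ->
  mean P (fun w => U w ^+ 2 * \1_B (dW i w)) = mean P (fun w => U w ^+ 2) * pr N B.
  by move=> mB; apply: transfer1 => //; exact: L2_sqr.
have i1 : L1 P (fun w => U w ^+ 2 * dW i w ^+ 2).
  apply: (ge0_weighted_transfer_L1 (nu := N) (L2_sqr U2) (mdW i) tr _ _ n1) => w;
  exact: sqr_ge0.
split.
  split; first exact: measurable_funM.
  by under eq_fun do rewrite exprMn.
under eq_fun do rewrite exprMn.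
rewrite (weighted_transfer (nu := N) (L2_sqr U2) (mdW i) tr n1 i1) n2.
by rewrite sqr_sqrtr ?subr_ge0 1?ltW// mulrC.
Qed.

(** Two transfers in a row. The weight [U * V * \1_C (dW j)] gives [dW i] the
    normal law up to a factor, so its product with [dW i] has mean zero; as [C]
    is arbitrary, the weight [U * V * dW i] gives [dW j] the zero measure. *)
Lemma mean_cross_increment i j U V : i != j -> L2F s U -> L2F s V ->
  mean P (fun w => (U w * dW i w) * (V w * dW j w)) = 0.
Proof.
move=> ij U2 V2; have [UW2 _] := L2_mul_increment i U2.
have [VW2 _] := L2_mul_increment j V2.
have UV1 : L1 P (fun w => U w * V w) by apply: L2M; [case: U2|case: V2].
have FUV : Fmeas s (fun w => U w * V w) by apply: FmeasM; [case: U2|case: V2].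
have UWV1 : L1 P (fun w => (U w * V w) * dW i w).
  have := L2M UW2 V2.2; congr L1; apply/funext => w; ring.
have I1 : L1 P (fun w => (U w * V w) * dW i w * dW j w).
  have := L2M UW2 VW2; congr L1; apply/funext => w; ring.
have n1 := L2_L1 (normal_L2 sigma0).
rewrite [LHS](_ : _ = mean P (fun w => (U w * V w) * dW i w * dW j w)); last first.
  congr mean; apply/funext => w; ring.
rewrite (weighted_transfer (nu := N) (c := 0) UWV1 (mdW j) _ n1 I1) ?mul0r// => C mC.
have mC' : measurable (dW j @^-1` C).
  by rewrite -[X in measurable X]setTI; exact: mdW.
have UVC1 : L1 P (fun w => U w * V w * \1_C (dW j w)).
  by have := L1M_indic mC' UV1; congr L1; apply/funext => w; rewrite mulrC.
have UWVC1 : L1 P (fun w => U w * V w * \1_C (dW j w) * dW i w).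
  have := L1M_indic mC' UWV1; congr L1.
  apply/funext => w; rewrite (_ : \1_(_ @^-1` _) w = \1_C (dW j w) :> R)//; ring.
rewrite [LHS](_ : _ = mean P (fun w => U w * V w * \1_C (dW j w) * dW i w)); last first.
  congr mean; apply/funext => w; ring.
rewrite (weighted_transfer (nu := N) (c := mean P (fun w => U w * V w) * pr N C) UVC1 (mdW i) _ n1 UWVC1) => [|B mB].
  by rewrite meanN mulr0 mul0r.
rewrite [LHS](_ : _ = mean P (fun w => U w * V w *
    \1_(incr_in (fun k => if k == i then B else if k == j then C else setT)) w)); last first.
  by congr mean; apply/funext => w; rewrite indic_incr2//; ring.
rewrite past_transfer//; last by move=> k; case: ifP => // _; case: ifP.
by rewrite prod2//; rewrite -/(pr N B); ring.
Qed.

End increment.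

(** The same facts hold trivially for an empty interval, so that grids need not
    be strictly increasing. *)
Lemma L2_mul_increment_le i s t U : 0 <= s -> s <= t -> L2F s U ->
  L2 P (fun w => U w * (W i t w - W i s w)) /\
  mean P (fun w => (U w * (W i t w - W i s w)) ^+ 2) =
  (t - s) * mean P (fun w => U w ^+ 2).
Proof.
move=> s0; rewrite le_eqVlt => /predU1P[<- _|st]; last exact: L2_mul_increment.
rewrite subrr mul0r.
under eq_fun do rewrite subrr mulr0; split; first exact: L2_0.
by under eq_fun do rewrite subrr mulr0 expr0n; rewrite mean_0.
Qed.

Lemma mean_mul_increment_le i s t U : 0 <= s -> s <= t -> Fmeas s U -> L1 P U ->
  L1 P (fun w => U w * (W i t w - W i s w)) ->
  mean P (fun w => U w * (W i t w - W i s w)) = 0.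
Proof.
move=> s0; rewrite le_eqVlt => /predU1P[<- _ _ _|st]; last exact: mean_mul_increment.
by under eq_fun do rewrite subrr mulr0; rewrite mean_0.
Qed.

Lemma Fmeas_W i s t : 0 <= s -> s <= t -> Fmeas t (W i s).
Proof.
move=> s0 st; apply: (Fmeas_le s0 st); apply: adapted_Fmeas => //.
exact: (bm_adapted bmW).
Qed.

(** The integrator [f] is an argument: [f = W i] gives a stochastic integral,
    [f = id] a time integral, and a step function gives the value at one time of
    the integrand itself. *)
Definition grid_sum (g : nat -> R) (c : nat -> T -> R) n (f : R -> R) w : R :=
  \sum_(l < n) c l w * (f (g l.+1) - f (g l)).

Section grid_integral.
Context (i : 'I_m) (g : nat -> R).
Hypotheses (g0 : 0 <= g 0%N) (gle : {homo g : k l / (k <= l)%N >-> k <= l}).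

Let gl0 l : 0 <= g l. Proof. by rewrite (le_trans g0)// gle. Qed.

Local Notation Wp w := (fun t => W i t w).

Lemma grid_integral_L2F (c : nat -> T -> R) n :
  (forall l, (l < n)%N -> L2F (g l) (c l)) ->
  L2F (g n) (fun w => grid_sum g c n (Wp w) w).
Proof.
move=> cF; apply: L2F_sum => -[l /= ln] _; have cl := cF _ ln.
have [h _] := L2_mul_increment_le i (gl0 l) (gle (leqnSn l)) cl.
split=> //; apply: FmeasM; first exact: (Fmeas_le (gl0 l) (gle (ltnW ln))) cl.1.
by apply: FmeasB; apply: Fmeas_W => //; apply: gle => //; exact: ltnW.
Qed.

(** Each new term [c_n * (increment of W)] is orthogonal to everything that is
    known at time [g n], in particular to the sum of the previous terms. *)
Lemma grid_isometry (c : nat -> T -> R) n :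
  (forall l, (l < n)%N -> L2F (g l) (c l)) ->
  mean P (fun w => grid_sum g c n (Wp w) w ^+ 2) =
  \sum_(l < n) (g l.+1 - g l) * mean P (fun w => c l w ^+ 2).
Proof.
elim: n => [_|n ih cF].
  by rewrite big_ord0; under eq_fun do rewrite /grid_sum big_ord0 expr0n; rewrite mean_0.
have cF' l : (l < n)%N -> L2F (g l) (c l) by move=> ln; apply: cF; exact: ltnW.
have SF := grid_integral_L2F cF'; have cn := cF n (ltnSn n).
rewrite big_ord_recr/= -ih//.
have [h1 <-] := L2_mul_increment_le i (gl0 n) (gle (leqnSn n)) cn.
pose S w := grid_sum g c n (Wp w) w.
pose X w := c n w * (W i (g n.+1) w - W i (g n) w).
have SX1 : L1 P (fun w => S w * X w) by apply: L2M => //; exact: SF.2.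
have SX0 : mean P (fun w => S w * X w) = 0.
  have E : (fun w => S w * X w) =
      fun w => (S w * c n w) * (W i (g n.+1) w - W i (g n) w).
    by apply/funext => w; rewrite /X mulrA.
  rewrite E; apply: mean_mul_increment_le => //; last by rewrite -E.
  - exact: gle.
  - by apply: FmeasM; [exact: SF.1|exact: cn.1].
  - by apply: L2M; [exact: SF.2|exact: cn.2].
have -> : (fun w => grid_sum g c n.+1 (Wp w) w ^+ 2) =
    fun w => (S w ^+ 2 + 2 * (S w * X w)) + X w ^+ 2.
  apply/funext => w; rewrite (_ : grid_sum g c n.+1 (Wp w) w = S w + X w).
    ring.
  by rewrite /grid_sum big_ord_recr.
rewrite meanD; [|by apply: L1D; [exact: L2_sqr SF.2|exact: L1Z]|exact: L2_sqr].
by rewrite meanD; [|exact: L2_sqr SF.2|exact: L1Z]; rewrite meanZ// SX0 mulr0 addr0.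
Qed.

(** Termwise: [U * c_l] is known at time [g l]. *)
Lemma grid_martingale (c : nat -> T -> R) n U :
  (forall l, (l < n)%N -> L2F (g l) (c l)) -> L2F (g 0%N) U ->
  mean P (fun w => U w * grid_sum g c n (Wp w) w) = 0.
Proof.
move=> cF UF.
have cL (l : 'I_n) : L2 P (fun w => c l w * (W i (g l.+1) w - W i (g l) w)).
  by have [] := L2_mul_increment_le i (gl0 l) (gle (leqnSn l)) (cF _ (ltn_ord l)).
have -> : (fun w => U w * grid_sum g c n (Wp w) w) =
    fun w => \sum_(l < n) U w * (c l w * (W i (g l.+1) w - W i (g l) w)).
  by apply/funext => w; rewrite mulr_sumr.
rewrite mean_sum => [|l _]; last exact: L2M UF.2 (cL l).
rewrite big1// => l _; have cl := cF _ (ltn_ord l).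
have E : (fun w => U w * (c l w * (W i (g l.+1) w - W i (g l) w))) =
    fun w => (U w * c l w) * (W i (g l.+1) w - W i (g l) w).
  by apply/funext => w; rewrite mulrA.
rewrite E; apply: mean_mul_increment_le => //; first exact: gle.
- by apply: FmeasM; [exact: (Fmeas_le g0 (gle (leq0n l)) UF.1)|exact: cl.1].
- by apply: L2M; [exact: UF.2|exact: cl.2].
- by rewrite -E; exact: L2M UF.2 (cL l).
Qed.

Definition grid_energy (c : nat -> T -> R) n w : R :=
  \sum_(l < n) c l w ^+ 2 * (g l.+1 - g l).

Let q0 (c : nat -> T -> R) l w : 0 <= c l w ^+ 2 * (g l.+1 - g l).
Proof. by rewrite mulr_ge0 ?sqr_ge0// subr_ge0 gle. Qed.

Lemma grid_energy_le (c : nat -> T -> R) k n w : (k <= n)%N ->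
  grid_energy c k w <= grid_energy c n w.
Proof.
move=> /subnK <-; elim: (n - k)%N => [|l ih]; first by rewrite add0n.
by apply: le_trans ih _; rewrite addSn /grid_energy big_ord_recr/= lerDl.
Qed.

Lemma grid_energy_Fmeas (c : nat -> T -> R) n k :
  (forall l, (l < n)%N -> L2F (g l) (c l)) -> (k < n)%N ->
  Fmeas (g k) (grid_energy c k.+1).
Proof.
move=> cF kn; apply: Fmeas_sum => -[l /= lk] _.
apply: FmeasM; last exact: Fmeas_cst.
have ln : (l < n)%N by exact: leq_trans lk kn.
have mc : Fmeas (g k) (c l) by exact: (Fmeas_le (gl0 l) (gle (lk : (l <= k)%N)) (cF _ ln).1).
by under eq_fun do rewrite expr2; exact: FmeasM.
Qed.

(** Stopping the coefficients when the energy exceeds [del] gives an integral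
    whose second moment is at most [del]; it differs from the original one only
    if the total energy exceeds [del]. *)
Lemma lenglart (c : nat -> T -> R) n (A : set T) (e del : R) :
  (forall l, (l < n)%N -> L2F (g l) (c l)) -> measurable A -> 0 < e -> 0 < del ->
  pr P (A `&` [set w | e <= `|grid_sum g c n (Wp w) w|]) <=
  pr P (A `&` [set w | del <= grid_energy c n w]) + del / e ^+ 2.
Proof.
move=> cF mA e0 d0.
pose B l := [set w | grid_energy c l.+1 w <= del].
pose c' l w := \1_(B l) w * c l w.
have FB l : (l < n)%N -> F (g l) (B l).
  move=> ln; have /FmeasP := grid_energy_Fmeas cF ln.
  move=> /(_ (gl0 l) `]-oo, del]%classic) H.
  rewrite (_ : B l = grid_energy c l.+1 @^-1` `]-oo, del]%classic); first exact: H.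
  by apply/seteqP; split=> w /=; rewrite in_itv.
have c'F l : (l < n)%N -> L2F (g l) (c' l).
  move=> ln; have cl := cF _ ln; split.
    by apply: FmeasM cl.1; apply: Fmeas_indic; exact: FB.
  apply: L2M_indic cl.2; have [_ sub _] := filtF.
  by apply: (sub (g l)) => //; exact: FB.
have stopped w : grid_energy c' n w <= del.
  suff : grid_energy c' n w <= del /\ grid_energy c' n w <= grid_energy c n w by case.
  elim: n {cF FB c'F} => [|k [ih1 ih2]]; first by rewrite /grid_energy !big_ord0 ltW.
  have E : grid_energy c' k.+1 w = grid_energy c' k w + \1_(B k) w * (c k w ^+ 2 * (g k.+1 - g k)).
    rewrite /grid_energy big_ord_recr/= /c' exprMn; congr (_ + _).
    by rewrite indicE; case: (_ \in _); rewrite ?expr1n ?mul1r ?expr0n ?mul0r.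
  have E2 : grid_energy c k.+1 w = grid_energy c k w + c k w ^+ 2 * (g k.+1 - g k).
    by rewrite /grid_energy big_ord_recr.
  have qk := q0 c k w.
  rewrite E indicE; have [/set_mem /= Bk|_] := boolP (w \in B k).
    by have : grid_energy c k.+1 w <= del := Bk; rewrite mul1r E2; split; lra.
  by rewrite mul0r addr0 E2; split=> //; lra.
have c'E w : grid_energy c n w < del ->
    grid_sum g c' n (Wp w) w = grid_sum g c n (Wp w) w.
  move=> wd; apply: eq_bigr => -[l /= ln] _; rewrite /c' indicE mem_set ?mul1r//.
  by rewrite /B/= (le_trans (grid_energy_le _ _ ln))// ltW.
have SF := (grid_integral_L2F cF).2; have SF' := (grid_integral_L2F c'F).2.
have mE : measurable_fun [set: T] (grid_energy c n).
  apply: measurable_sum => l; apply: measurable_funM => //.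
  by apply: measurable_funX; exact: L2_measurable (cF _ (ltn_ord l)).2.
have mD : measurable [set w | del <= grid_energy c n w].
  by rewrite -[X in measurable X]setTI; exact: measurable_fun_le.
have mS' := measurable_ge_abs e (L2_measurable SF').
have h1 : pr P [set w | e <= `|grid_sum g c' n (Wp w) w|] <= del / e ^+ 2.
  apply: le_trans (markov_sqr SF' e0) _.
  rewrite ler_pM2r ?invr_gt0 ?exprn_gt0// grid_isometry//.
  have -> : \sum_(l < n) (g l.+1 - g l) * mean P (fun w => c' l w ^+ 2) =
      mean P (grid_energy c' n).
    rewrite /grid_energy mean_sum => [|l _].
      apply: eq_bigr => l _; under [in RHS]eq_fun do rewrite mulrC.
      by rewrite meanZ//; exact: L2_sqr (c'F _ (ltn_ord l)).2.
    by under eq_fun do rewrite mulrC; apply: L1Z; exact: L2_sqr (c'F _ (ltn_ord l)).2.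
  rewrite -[leRHS](mean_cst P del); apply: le_mean => //; last exact: L1_cst.
  apply: L1_sum => l _; under eq_fun do rewrite mulrC.
  by apply: L1Z; exact: L2_sqr (c'F _ (ltn_ord l)).2.
apply: (@le_trans _ _ (pr P (A `&` [set w | del <= grid_energy c n w]) +
    pr P [set w | e <= `|grid_sum g c' n (Wp w) w|])); last by rewrite lerD2l.
have mAD : measurable (A `&` [set w | del <= grid_energy c n w]) by exact: measurableI.
apply: le_trans (pr_setU _ mAD mS'); apply: le_pr.
- by apply: measurableI => //; exact: measurable_ge_abs (L2_measurable SF).
- exact: measurableU.
- move=> w [Aw /= Sw]; have [dw|wd] := leP del (grid_energy c n w); first by left.
  by right; rewrite /= c'E.
Qed.

End grid_integral.

End filtered.

(** * Elementary integrands *)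

Section elementary_processes.
Context (R : realType) (disp : measure_display) (T : measurableType disp).
Context (P : probability T R) (F : R -> set (set T)).
Hypothesis filtF : filtration F.

(** Finite sums of [xi * (f q - f p)] with [xi] known at time [p], as functionals
    of the integrator [f]. The intervals may overlap, which makes the class
    closed under sums without a common refinement. *)
Inductive elementary : ((R -> R) -> T -> R) -> Prop :=
| elementary0 : elementary (fun _ _ => 0)
| elementary_add p q xi Phi : 0 <= p -> p <= q -> L2F P F p xi ->
    elementary Phi -> elementary (fun f w => xi w * (f q - f p) + Phi f w).

(** The integrator that evaluates at time [r]: the increment of [step r] over
    [`]p, q]] is the indicator of [`]p, q]] at [r]. *)
Definition step (r u : R) : R := (r <= u)%R%:R.

Lemma elementaryD Phi Psi : elementary Phi -> elementary Psi ->
  elementary (fun f w => Phi f w + Psi f w).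
Proof.
move=> ePhi ePsi; elim: ePhi => [|p q xi Phi' p0 pq xiF _ ih].
  by rewrite (_ : (fun _ => _) = Psi)//; apply/funext => f; apply/funext => w; rewrite add0r.
rewrite (_ : (fun _ => _) = fun f w => xi w * (f q - f p) + (Phi' f w + Psi f w)).
  exact: elementary_add.
by apply/funext => f; apply/funext => w; rewrite addrA.
Qed.

Lemma elementaryN Phi : elementary Phi -> elementary (fun f w => - Phi f w).
Proof.
elim=> [|p q xi Phi' p0 pq xiF _ ih].
  rewrite (_ : (fun _ => _) = fun _ _ => 0); first exact: elementary0.
  by apply/funext => f; apply/funext => w; rewrite oppr0.
rewrite (_ : (fun _ => _) = fun f w => (0 - xi w) * (f q - f p) + - Phi' f w).
  by apply: elementary_add => //; apply: L2FB => //; exact: L2F_cst.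
by apply/funext => f; apply/funext => w; ring.
Qed.

Lemma elementaryB Phi Psi : elementary Phi -> elementary Psi ->
  elementary (fun f w => Phi f w - Psi f w).
Proof. by move=> ePhi ePsi; apply: elementaryD => //; exact: elementaryN. Qed.

Lemma elementary1 p q xi : 0 <= p -> p <= q -> L2F P F p xi ->
  elementary (fun f w => xi w * (f q - f p)).
Proof.
move=> p0 pq xiF.
rewrite (_ : (fun _ => _) = fun f w => xi w * (f q - f p) + 0).
  by apply: elementary_add => //; exact: elementary0.
by apply/funext => f; apply/funext => w; rewrite addr0.
Qed.

Lemma elementary_sum (I : Type) (s : seq I) (Q : pred I) (Phi : I -> (R -> R) -> T -> R) :
  (forall i, Q i -> elementary (Phi i)) ->
  elementary (fun f w => \sum_(i <- s | Q i) Phi i f w).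
Proof.
move=> ePhi; elim: s => [|i s ih].
  rewrite (_ : (fun _ => _) = fun _ _ => 0); first exact: elementary0.
  by apply/funext => f; apply/funext => w; rewrite big_nil.
rewrite (_ : (fun _ => _) = fun f w => (if Q i then Phi i f w else 0) +
    \sum_(i <- s | Q i) Phi i f w).
  apply: elementaryD => //; have [Qi|_] := boolP (Q i); first exact: ePhi.
  exact: elementary0.
apply/funext => f; apply/funext => w; rewrite big_cons.
by case: ifP; rewrite ?add0r.
Qed.

Lemma elementary_grid_sum (g : nat -> R) (c : nat -> T -> R) n :
  0 <= g 0%N -> {homo g : k l / (k <= l)%N >-> k <= l} ->
  (forall l, (l < n)%N -> L2F P F (g l) (c l)) -> elementary (grid_sum g c n).
Proof.
move=> g0 gle cF; apply: elementary_sum => l _; apply: elementary1.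
- by rewrite (le_trans g0)// gle.
- exact: gle.
- exact: cF.
Qed.

Let grid_step (f : R -> R) (g : nat -> R) (x : R) a b n : (a <= b <= n)%N ->
  \sum_(l < n) ((a <= l < b)%N%:R * x) * (f (g l.+1) - f (g l)) =
  x * (f (g b) - f (g a)).
Proof.
move=> /andP[ab bn].
rewrite -(big_mkord xpredT (fun l => ((a <= l < b)%N%:R * x) * (f (g l.+1) - f (g l)))).
rewrite (big_cat_nat (n := a))//=; last exact: leq_trans bn.
rewrite (big_cat_nat (n := b) (m := a))//=.
rewrite big_nat big1 => [|l /andP[_ la]]; last by rewrite leqNgt la !mul0r.
rewrite add0r [X in _ + X]big_nat [X in _ + X]big1 => [|l /andP[bl _]]; last first.
  by rewrite [(l < b)%N]ltnNge bl andbF !mul0r.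
rewrite addr0 -(telescope_sumr (fun l => f (g l))) // mulr_sumr big_nat [RHS]big_nat.
by apply: eq_bigr => l ->; rewrite mul1r.
Qed.

(** Over a grid through [p] and [q], the difference [f q - f p] telescopes. Only
    the endpoints matter, so the terms of a sum can share one grid. *)
Lemma elementary_on_grids Phi : elementary Phi ->
  exists E : seq R, (forall x, x \in E -> 0 <= x) /\
  forall (g : nat -> R) n, 0 <= g 0%N -> {homo g : k l / (k <= l)%N >-> k <= l} ->
    (forall x, x \in E -> exists2 k, (k <= n)%N & x = g k) ->
    exists c, (forall l, (l < n)%N -> L2F P F (g l) (c l)) /\
      Phi = grid_sum g c n.
Proof.
elim=> [|p q xi Phi' p0 pq xiF _ [E [E0 ih]]].
  exists [::]; split=> // g n _ _ _; exists (fun _ _ => 0); split=> [l _|].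
    exact: L2F_cst.
  apply/funext => f; apply/funext => w; rewrite /grid_sum big1// => l _.
  by rewrite mul0r.
exists [:: p, q & E]; split=> [x|g n g0 gle gE].
  rewrite !inE => /or3P[/eqP ->//|/eqP ->|]; [exact: le_trans pq|exact: E0].
have [a an pa] := gE p ltac:(by rewrite inE eqxx).
have [b bn qb] := gE q ltac:(by rewrite !inE eqxx orbT).
have [c [cF cE]] := ih g n g0 gle ltac:(by move=> x xE; apply: gE; rewrite !inE xE !orbT).
move: pq; rewrite le_eqVlt => /predU1P[pq|pq].
  exists c; split=> //; apply/funext => f; apply/funext => w.
  by rewrite pq subrr mulr0 add0r cE.
have ab : (a <= b)%N.
  rewrite leqNgt; apply/negP => /ltnW /gle; rewrite -pa -qb.
  by rewrite leNgt pq.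
exists (fun l w => (a <= l < b)%N%:R * xi w + c l w); split=> [l ln|].
  apply: L2FD; last exact: cF.
  have [/andP[al _]|_] := boolP (a <= l < b)%N.
    under eq_fun do rewrite mul1r; apply: (L2F_le filtF p0) => //.
    by rewrite pa; exact: gle.
  by under eq_fun do rewrite mul0r; exact: L2F_cst.
apply/funext => f; apply/funext => w; rewrite cE /grid_sum.
under [in RHS]eq_bigr do rewrite mulrDl.
rewrite big_split/=; congr (_ + _).
by rewrite qb pa (grid_step f g (xi w))// ab.
Qed.

Lemma elementary_grid Phi : elementary Phi -> exists n (g : nat -> R) c,
  [/\ 0 <= g 0%N, {homo g : k l / (k <= l)%N >-> k <= l},
      forall l, (l < n)%N -> L2F P F (g l) (c l) & Phi = grid_sum g c n].
Proof.
move=> /elementary_on_grids[E [E0 EP]].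
pose s := sort <=%R (0 :: E); pose n := size E.
have ss : size s = n.+1 by rewrite size_sort.
pose g k := s`_(minn k n).
have s_ge0 x : x \in s -> 0 <= x.
  by rewrite mem_sort inE => /predU1P[->//|/E0].
have g0 : 0 <= g 0%N by apply: s_ge0; apply: mem_nth; rewrite ss min0n.
have gle : {homo g : k l / (k <= l)%N >-> k <= l}.
  move=> k l kl; rewrite /g; apply: (sorted_leq_nth le_trans lexx).
  - by apply: sort_sorted; exact: le_total.
  - by rewrite inE ss ltnS geq_minr.
  - by rewrite inE ss ltnS geq_minr.
  - by rewrite leq_min geq_minr andbT (leq_trans (geq_minl _ _)).
have gE x : x \in E -> exists2 k, (k <= n)%N & x = g k.
  move=> xE; have xs : x \in s by rewrite mem_sort inE xE orbT.
  have xn : (index x s <= n)%N by rewrite -ltnS -ss index_mem.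
  by exists (index x s) => //; rewrite /g (minn_idPl xn) nth_index.
by have [c [cF cE]] := EP g n g0 gle gE; exists n, g, c.
Qed.

Local Notation mu := (@lebesgue_measure R).

Lemma step_indic (a b r : R) : a <= b -> step r b - step r a = \1_(`]a, b]%classic) r.
Proof.
move=> ab; rewrite /step indicE mem_setE in_itv/=.
have [ra|ar] := leP r a; first by rewrite (le_trans ra ab) subrr.
by rewrite subr0.
Qed.

(** The cells of the grid are disjoint, so the cross terms vanish. *)
Lemma grid_sum_step_sqr (g : nat -> R) (c : nat -> T -> R) n r w :
  {homo g : k l / (k <= l)%N >-> k <= l} ->
  grid_sum g c n (step r) w ^+ 2 =
  \sum_(l < n) c l w ^+ 2 * \1_(`]g l, g l.+1]%classic) r.
Proof.
move=> gle; pose d l : R := \1_(`]g l, g l.+1]%classic) r.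
have dE l : step r (g l.+1) - step r (g l) = d l by apply: step_indic; exact: gle.
have -> : grid_sum g c n (step r) w = \sum_(l < n) c l w * d l.
  by apply: eq_bigr => l _; rewrite dE.
elim: n => [|n ih]; first by rewrite !big_ord0 expr0n.
rewrite !big_ord_recr/= sqrrD ih exprMn.
have d2 l : d l ^+ 2 = d l.
  by rewrite /d indicE; case: (_ \in _); rewrite ?expr1n ?expr0n.
have -> : (\sum_(l < n) c l w * d l) * (c n w * d n) = 0.
  rewrite mulr_suml big1// => -[l /= ln] _.
  suff dd : d l * d n = 0 by rewrite mulrACA dd mulr0.
  rewrite /d !indicE !mem_setE !in_itv/= -natrM mulnb.
  apply/eqP; rewrite pnatr_eq0 eqb0; apply/negP.
  move=> /andP[/andP[_ r1] /andP[r2 _]]; have := le_lt_trans (le_trans r1 (gle _ _ ln)) r2.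
  by rewrite ltxx.
by rewrite mul0rn addr0 d2.
Qed.

Lemma grid_energyE (g : nat -> R) (c : nat -> T -> R) n w :
  {homo g : k l / (k <= l)%N >-> k <= l} ->
  (\int[mu]_r (grid_sum g c n (step r) w ^+ 2)%:E = (grid_energy g c n w)%:E)%E.
Proof.
move=> gle; under eq_integral do rewrite grid_sum_step_sqr// -sumEFin.
rewrite (@ge0_integral_sum _ _ _ mu _ _ _ (fun (l : 'I_n) r =>
  (c l w ^+ 2 * \1_(`]g l, g l.+1]%classic) r)%:E))//; last 2 first.
- move=> l; apply/measurable_EFinP; apply: measurable_funM => //.
- by move=> l r _; rewrite lee_fin mulr_ge0 ?sqr_ge0.
rewrite /grid_energy -sumEFin; apply: eq_bigr => l _.
under eq_integral do rewrite EFinM.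
rewrite integralZl//; last first.
  by have := integrable_indic_itv (g l) (g l.+1) false false.
rewrite integral_indic// setIT [RHS]EFinM; congr (_ * _)%E.
rewrite [LHS](lebesgue_measure_itv `]g l, g l.+1])/= lte_fin; case: ltP => [_|h]; first by rewrite EFinB.
by rewrite (@le_anti _ R (g l.+1) (g l)) ?subrr// h gle.
Qed.

Lemma elementary_step_measurable Phi : elementary Phi ->
  measurable_fun [set: measurableTypeR R * T] (fun p => Phi (step p.1) p.2).
Proof.
elim=> [|p q xi Phi' p0 pq xiF _ ih]; first exact: measurable_cst.
have mstep (u : R) : measurable_fun [set: measurableTypeR R * T] (fun z => step z.1 u).
  have -> : (fun z : measurableTypeR R * T => step z.1 u) = \1_(`]-oo, u]%classic) \o fst.
    by apply/funext => z; rewrite /step/= indicE mem_setE in_itv.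
  by apply: measurableT_comp => //; exact: measurable_indic.
apply: measurable_funD => //; apply: measurable_funM; last exact: measurable_funB.
by apply: (@measurableT_comp _ _ _ _ _ _ xi) => //; exact: L2_measurable xiF.2.
Qed.

Lemma elementary_step_le0 Phi r w : elementary Phi -> r <= 0 -> Phi (step r) w = 0.
Proof.
move=> ePhi r0; elim: ePhi => [//|p q xi Phi' p0 pq _ _ ->].
by rewrite /step !(le_trans r0) ?(le_trans p0)// subrr mulr0 addr0.
Qed.

(** Cutting at the horizon [t] keeps the integral up to [t], and makes the process
    vanish after [t], where an approximation in [L^2([0, t])] says nothing. *)
Lemma simple_elementary (phi : simple_process F) (t : R) : 0 <= t ->
  exists Phi, [/\ elementary Phi,
    forall r w, r <= t -> Phi (step r) w = simple_val phi r w,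
    forall r w, t < r -> Phi (step r) w = 0 &
    forall (V : R -> T -> R) w, Phi (fun u => V u w) w = simple_integral phi V t w].
Proof.
move=> t0; pose tau := sp_time phi; pose xi := sp_coef phi.
have tau_le : {homo tau : k l / (k <= l)%N >-> k <= l} := @sp_time_homo _ _ _ _ phi.
have tau0 l : 0 <= tau l by rewrite (le_trans (sp_time_ge0 phi))// tau_le.
have xiF l : L2F P F (tau l) (xi l).
  have Fxi : Fmeas F (tau l) (xi l).
    by apply/(FmeasP filtF) => // B mB; exact: sp_coef_measurable.
  split=> //; have [C xiC] := sp_coef_bounded phi.
  by apply: (@L2_bounded _ _ _ _ _ C) => //; exact: (Fmeas_measurable filtF (tau0 l)).
exists (fun f w => \sum_(j < sp_size phi | tau j <= t)
  xi j w * (f (Num.min (tau j.+1) t) - f (tau j))); split.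
- apply: elementary_sum => j jt; apply: elementary1 => //.
  by rewrite le_min jt andbT tau_le.
- move=> r w rt; rewrite /simple_val big_mkcond; apply: eq_bigr => j _.
  rewrite -/(tau j) -/(tau j.+1) -/(xi j).
  case: leP => [jt|tj].
    rewrite -step_indic ?tau_le//; congr (_ * (_ - _)).
    by rewrite /step le_min rt andbT.
  by rewrite indicE mem_setE in_itv/= ltNge (le_trans rt (ltW tj)) mulr0.
- move=> r w tr; rewrite big1// => j jt; rewrite /step le_min [r <= t]leNgt tr andbF.
  by rewrite leNgt (le_lt_trans jt tr) subrr mulr0.
- move=> V w; rewrite /simple_integral big_mkcond; apply: eq_bigr => j _.
  rewrite -/(tau j) -/(tau j.+1) -/(xi j).
  case: leP => [//|tj]; rewrite min_r ?subrr ?mulr0//.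
  by rewrite (le_trans (ltW tj))// tau_le.
Qed.

(** Extended-real valued, since the paths of [H] may be far from square
    integrable outside an event of probability one. *)
Definition gap Phi (H : R -> T -> R) (E : set R) (w : T) : \bar R :=
  (\int[mu]_(r in E) ((Phi (step r) w - H r w) ^+ 2)%:E)%E.

Lemma gap_ge0 Phi H E w : (0 <= gap Phi H E w)%E.
Proof. by apply: integral_ge0 => r _; rewrite lee_fin sqr_ge0. Qed.

Lemma process_path_measurable (H : R -> T -> R) (E : set (measurableTypeR R)) w :
  measurable E -> E `<=` [set r | 0 <= r] -> measurable_process H ->
  measurable_fun E (fun r => H r w).
Proof.
move=> mE E0 mH.
apply: (@measurable_comp _ _ _ _ _ _ ([set t : R | 0 <= t] `*` [set: T])
  (fun p => H p.1 p.2) E (fun r => (r, w))) => //.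
- apply: measurableX => //.
  rewrite (_ : [set t : R | 0 <= t] = `[0, +oo[%classic)//.
  by apply/seteqP; split=> r /=; rewrite in_itv/= andbT.
- by move=> _ [r Er <-]; split => //=; exact: E0.
- exact: measurable_funTS (pair2_measurable w).
Qed.

Let gap_fun Phi (H : R -> T -> R) (E : set R) (z : measurableTypeR R * T) : R :=
  \1_E z.1 * (Phi (step z.1) z.2 - H z.1 z.2) ^+ 2.

Let gap_fun_measurable Phi H (E : set (measurableTypeR R)) : elementary Phi ->
  measurable_process H -> measurable E -> E `<=` [set r | 0 <= r] ->
  measurable_fun [set: measurableTypeR R * T] (gap_fun Phi H E).
Proof.
move=> ePhi mH mE E0.
have mD : measurable ([set t : R | 0 <= t] `*` [set: T] : set (measurableTypeR R * T)).
  apply: measurableX => //.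
  rewrite (_ : [set t : R | 0 <= t] = `[0, +oo[%classic)//.
  by apply/seteqP; split=> r /=; rewrite in_itv/= andbT.
have -> : gap_fun Phi H E = (fun z => \1_E z.1 * (Phi (step z.1) z.2 -
    ((fun p => H p.1 p.2) \_ ([set t : R | 0 <= t] `*` [set: T])) z) ^+ 2).
  apply/funext => z; rewrite /gap_fun patchE indicE.
  have [/set_mem Ez|_] := boolP (z.1 \in E); last by rewrite !mul0r.
  by rewrite mem_set//; split=> //; exact: E0.
apply: measurable_funM.
  apply: (@measurableT_comp _ _ _ _ _ _ (\1_E : measurableTypeR R -> R)) => //.
apply: measurable_funX; apply: measurable_funB; first exact: elementary_step_measurable.
by apply/(measurable_restrictT _ mD).
Qed.

Let gapE Phi H (E : set (measurableTypeR R)) w : measurable E ->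
  gap Phi H E w = (\int[mu]_r (gap_fun Phi H E (r, w))%:E)%E.
Proof.
move=> mE; rewrite /gap integral_mkcond; apply: eq_integral => r _.
by rewrite /gap_fun /patch indicE/=; case: (_ \in _); rewrite ?mul1r ?mul0r.
Qed.

Lemma gap_measurable Phi H (E : set (measurableTypeR R)) : elementary Phi ->
  measurable_process H -> measurable E -> E `<=` [set r | 0 <= r] ->
  measurable_fun [set: T] (gap Phi H E).
Proof.
move=> ePhi mH mE E0; have mG := gap_fun_measurable ePhi mH mE E0.
rewrite (_ : gap Phi H E = fubini_G mu (EFin \o gap_fun Phi H E)); last first.
  by apply/funext => w; rewrite gapE.
apply: measurable_fun_fubini_tonelli_G => /=; first exact/measurable_EFinP.
by move=> z; rewrite lee_fin mulr_ge0// sqr_ge0.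
Qed.

End elementary_processes.

(** * Uniform grids and locality of the Ito integral *)

Section riemann_sums.
Context (R : realType).
Local Notation mu := (@lebesgue_measure R).

Lemma heine_cantor (u : R -> R) (a b e : R) : 0 < e ->
  {within `[a, b], continuous u} ->
  exists2 del, 0 < del & forall x y, a <= x <= b -> a <= y <= b ->
    `|x - y| < del -> `|u x - u y| < e.
Proof.
move=> e0 /subspace_continuousP cu.
have /compact_near_coveringP cpt := @segment_compact R a b.
pose Q (d x : R) := a <= x <= b -> forall y, a <= y <= b -> `|x - y| < d -> `|u x - u y| < e.
have near_d : \forall d \near (0 : R)^'+, `[a, b] `<=` Q d.
  apply: cpt => x; rewrite /= in_itv/= => xab.
  have := cu x; rewrite /= in_itv/= => /(_ xab) /cvgrPdist_lt /(_ (e / 2)).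
  rewrite divr_gt0// => /(_ isT) /nbhs_ballP[eta /= eta0 xeta].
  have near_x z : `|x - z| < eta -> a <= z <= b -> `|u x - u z| < e / 2.
    by move=> xz zab; apply: xeta => //=; rewrite in_itv.
  exists (ball x (eta / 2), [set d | d < eta / 2]) => /=.
    split; first by apply: nbhsx_ballx; rewrite divr_gt0.
    by apply: nbhs_right_lt; rewrite divr_gt0.
  move=> [z d] /= [xz deta] zab y yab zy.
  have h1 := near_x z; have h2 := near_x y.
  have xy : `|x - y| < eta.
    have := ler_distD z x y; rewrite /ball/= in xz; lra.
  have xz' : `|x - z| < eta by rewrite /ball/= in xz; lra.
  have := ler_distD (u x) (u z) (u y).
  by rewrite (distrC (u z) (u x)); move: (h1 xz' zab) (h2 xy yab); lra.
have [d [d0 Hd]] := filter_ex (filterI (nbhs_right_gt (0 : R)) near_d).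
by exists d => // x y xab yab xy; apply: (Hd x _ xab) => //=; rewrite in_itv.
Qed.

Definition ugrid (s t : R) (N l : nat) : R := s + l%:R * ((t - s) / N.+1%:R).

Section uniform_grid.
Context (s t : R) (N : nat).
Hypothesis st : s <= t.
Let h := (t - s) / N.+1%:R.

Let h0 : 0 <= h. Proof. by rewrite divr_ge0// subr_ge0. Qed.

Lemma ugrid0 : ugrid s t N 0 = s.
Proof. by rewrite /ugrid mul0r addr0. Qed.

Lemma ugrid_last : ugrid s t N N.+1 = t.
Proof. by rewrite /ugrid mulrCA divff ?mulr1 ?subrKC// pnatr_eq0. Qed.

Lemma ugrid_homo : {homo ugrid s t N : k l / (k <= l)%N >-> k <= l}.
Proof. by move=> k l kl; rewrite lerD2l ler_wpM2r// ler_nat. Qed.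

Lemma ugridS l : ugrid s t N l.+1 - ugrid s t N l = h.
Proof. by rewrite /ugrid -/h -natr1; ring. Qed.

Lemma ugrid_ge l : s <= ugrid s t N l.
Proof. by rewrite -[leLHS]ugrid0 ugrid_homo. Qed.

Lemma ugrid_le l : (l <= N.+1)%N -> ugrid s t N l <= t.
Proof. by move=> lN; rewrite -[leRHS]ugrid_last ugrid_homo. Qed.

Lemma ugrid_cell r : s < r <= t ->
  exists2 l, (l < N.+1)%N & ugrid s t N l < r <= ugrid s t N l.+1.
Proof.
move=> /andP[sr rt].
have ex : exists k, r <= ugrid s t N k by exists N.+1; rewrite ugrid_last.
case: (ex_minnP ex) => -[|l]; first by rewrite ugrid0 leNgt sr.
move=> rl lmin; exists l; first by apply: lmin; rewrite ugrid_last.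
rewrite rl andbT ltNge; apply/negP => /lmin; by rewrite ltnn.
Qed.

Lemma ugrid_sum_step disp (T : measurableType disp) (c : nat -> T -> R) r w l : (l < N.+1)%N ->
  ugrid s t N l < r <= ugrid s t N l.+1 ->
  grid_sum (ugrid s t N) c N.+1 (step r) w = c l w.
Proof.
move=> lN /andP[lr rl]; rewrite /grid_sum (bigD1 (Ordinal lN))//= big1.
  by rewrite /step rl leNgt lr subr0 mulr1 addr0.
move=> [k /= kN] kl.
have {}kl : k != l by apply: contra kl => /eqP kl; apply/eqP/val_inj.
rewrite /step; have [kl'|lk] := ltnP k l.
  have k1 : ugrid s t N k.+1 < r by apply: le_lt_trans lr; exact: ugrid_homo.
  have k0 : ugrid s t N k < r by apply: le_lt_trans lr; exact: ugrid_homo (ltnW kl').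
  by rewrite [r <= _]leNgt k1 [r <= _]leNgt k0 subrr mulr0.
have {}lk : (l < k)%N by rewrite ltn_neqAle eq_sym kl lk.
have k0 : r <= ugrid s t N k by rewrite (le_trans rl)// ugrid_homo.
have k1 : r <= ugrid s t N k.+1 by rewrite (le_trans k0)// ugrid_homo.
by rewrite k0 k1 subrr mulr0.
Qed.

Lemma ugrid_sum_step_le disp (T : measurableType disp) (c : nat -> T -> R) r w : r <= s ->
  grid_sum (ugrid s t N) c N.+1 (step r) w = 0.
Proof.
move=> rs; rewrite /grid_sum big1// => l _.
by rewrite /step !(le_trans rs (ugrid_ge _)) subrr mulr0.
Qed.

Lemma ugrid_sum_step_gt disp (T : measurableType disp) (c : nat -> T -> R) r w : t < r ->
  grid_sum (ugrid s t N) c N.+1 (step r) w = 0.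
Proof.
move=> tr; rewrite /grid_sum big1// => -[l /= lN] _.
rewrite /step leNgt (le_lt_trans (ugrid_le _) tr)// leNgt.
by rewrite (le_lt_trans (ugrid_le (ltnW lN)) tr) subrr mulr0.
Qed.

End uniform_grid.

(** By uniform continuity: a time and the left end of its cell are at most
    [(t - s) / N.+1] apart. *)
Lemma ugrid_unif_cvg (u : R -> R) (s t e : R) : s < t -> 0 < e ->
  {within `[s, t], continuous u} ->
  \forall N \near \oo, forall disp (T : measurableType disp) (c : nat -> T -> R) w,
    (forall l, (l < N.+1)%N -> c l w = u (ugrid s t N l)) ->
    forall r, s < r <= t ->
    `|grid_sum (ugrid s t N) c N.+1 (step r) w - u r| < e.
Proof.
move=> st e0 cu; have [del del0 udel] := heine_cantor e0 cu.
near=> N => disp T c w cE r srt.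
have [l lN lr] := ugrid_cell N srt.
rewrite (ugrid_sum_step (ltW st) c w lN lr) cE//; apply: udel.
- by rewrite (ugrid_ge _ (ltW st))/= (ugrid_le (ltW st))// ltnW.
- by move: srt => /andP[/ltW -> ->].
have /andP[l1 l2] := lr; rewrite distrC ger0_norm ?subr_ge0 1?ltW//.
apply: (@le_lt_trans _ _ ((t - s) / N.+1%:R)).
  by rewrite -(ugridS s t N l) lerD2r.
rewrite ltr_pdivrMr// -ltr_pdivrMl// mulrC.
apply: (@lt_le_trans _ _ N.+1%:R)=> //; rewrite -natr1 ltr_pwDr//.
by near: N; exact: nbhs_infty_ger.
Unshelve. all: by end_near. Qed.

Lemma mean_ugrid_sum disp (T : measurableType disp) (s t : R) N (c : nat -> T -> R) w : s <= t ->
  L1 mu (fun r => grid_sum (ugrid s t N) c N.+1 (step r) w) /\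
  mean mu (fun r => grid_sum (ugrid s t N) c N.+1 (step r) w) =
  grid_sum (ugrid s t N) c N.+1 id w.
Proof.
move=> st; have gle := ugrid_homo N st; set g := ugrid s t N in gle *.
have E : (fun r => grid_sum g c N.+1 (step r) w) =
    fun r => \sum_(l < N.+1) c l w * \1_(`]g l, g l.+1]%classic) r.
  by apply/funext => r; apply: eq_bigr => l _; rewrite step_indic// gle.
have i1 (l : nat) : L1 mu (\1_(`]g l, g l.+1]%classic)).
  exact: (integrable_indic_itv (g l) (g l.+1) false false).
rewrite E; split; first by apply: L1_sum => l _; exact: L1Z.
rewrite mean_sum => [|l _]; last exact: L1Z.
apply: eq_bigr => l _; rewrite meanZ//; congr (_ * _).
rewrite /mean /Rintegral integral_indic// setIT.
rewrite [X in fine X](lebesgue_measure_itv `]g l, g l.+1])/= lte_fin.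
case: ltP => [_|h]; first by rewrite -EFinB.
by rewrite (@le_anti _ R (g l.+1) (g l)) ?subrr// h gle.
Qed.

End riemann_sums.

Section ito_locality.
Context (R : realType) (disp : measure_display) (T : measurableType disp).
Context (P : probability T R) (F : R -> set (set T)).
Hypothesis filtF : filtration F.
Context (m : nat) (W : 'I_m -> R -> T -> R).
Hypothesis bmW : brownian_motion P F W.
Local Notation mu := (@lebesgue_measure R).
Local Notation elem := (elementary P F).

(** The counterpart of [small_on] for gaps and energies, which may be infinite. *)
Definition ge_small_on (A : set T) (X : nat -> T -> \bar R) := forall e : R, 0 < e ->
  pr P (A `&` [set w | (e%:E <= X n w)%E]) @[n --> \oo] --> (0 : R).

Lemma elementary_integral_L2 (i : 'I_m) Phi : elem Phi ->
  L2 P (fun w => Phi (fun u => W i u w) w).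
Proof.
move=> /(elementary_grid filtF)[n [g [c [g0 gle cF ->]]]].
exact: (grid_integral_L2F filtF bmW i g0 gle cF).2.
Qed.

Lemma measurable_ge_ereal (X : T -> \bar R) (e : R) : measurable_fun [set: T] X ->
  measurable [set w | (e%:E <= X w)%E].
Proof.
by move=> mX; rewrite -[X in measurable X]setTI; exact: emeasurable_fun_le.
Qed.

Lemma squeeze_pr (A B : nat -> set T) : (forall n, measurable (A n)) ->
  (forall n, measurable (B n)) -> (forall n, A n `<=` B n) ->
  pr P (B n) @[n --> \oo] --> (0 : R) -> pr P (A n) @[n --> \oo] --> (0 : R).
Proof.
move=> mA mB AB B0.
have near_h : \forall n \near \oo, 0 <= pr P (A n) <= pr P (B n).
  by apply: nearW => n; rewrite pr_ge0 le_pr.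
exact: (squeeze_cvgr near_h (cvg_cst _) B0).
Qed.

Lemma squeeze_pr3 (A B C D : nat -> set T) : (forall n, measurable (A n)) ->
  (forall n, measurable (B n)) -> (forall n, measurable (C n)) ->
  (forall n, measurable (D n)) -> (forall n, A n `<=` B n `|` C n `|` D n) ->
  pr P (B n) @[n --> \oo] --> (0 : R) -> pr P (C n) @[n --> \oo] --> (0 : R) ->
  pr P (D n) @[n --> \oo] --> (0 : R) -> pr P (A n) @[n --> \oo] --> (0 : R).
Proof.
move=> mA mB mC mD AB B0 C0 D0.
have near_h : \forall n \near \oo, 0 <= pr P (A n) <= pr P (B n) + pr P (C n) + pr P (D n).
  apply: nearW => n; rewrite pr_ge0/=.
  have mBC : measurable (B n `|` C n) by exact: measurableU.
  apply: le_trans (le_pr P _ _ (AB n)) _ => //; first exact: measurableU.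
  by apply: le_trans (pr_setU P mBC (mD n)) _; rewrite lerD2r pr_setU.
apply: (squeeze_cvgr near_h (cvg_cst _)).
rewrite -[X in _ --> X](addr0 0) -[X in _ --> X + _](addr0 0).
by apply: cvgD => //; exact: cvgD.
Qed.

(** The definition of the integral, in terms of elementary functionals that vanish
    after [t]. *)
Lemma ito_elementary i H (t : R) I : 0 <= t ->
  is_ito_integral P F (W i) H t I -> exists Phi, [/\ forall n, elem (Phi n),
    forall n r w, t < r -> Phi n (step r) w = 0,
    ge_small_on setT (fun n => gap (Phi n) H `[0, t]) &
    small_on P setT (fun n w => Phi n (fun u => W i u w) w - I w)].
Proof.
move=> t0 [[mH _ _] [mI [phi [gap0 int0]]]].
have [Phi PhiP] := choice (fun n => simple_elementary P filtF (phi n) t0).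
exists Phi; split=> [n|n r w|e e0|e e0].
- by have [] := PhiP n.
- by have [_ _ + _] := PhiP n; exact.
- have := gap0 e e0; set X := fun n => P _.
  rewrite (_ : X = fun n => (pr P (setT `&` [set w | (e%:E <= gap (Phi n) H `[0%R, t] w)%E]))%:E).
    by move/fine_cvg.
  apply/funext => n; have [ePhi PhiE _ _] := PhiP n.
  rewrite EFin_pr; last first.
    apply: measurableI => //; apply: measurable_ge_ereal; apply: (gap_measurable ePhi mH) => //.
    by move=> r /=; rewrite in_itv/= => /andP[].
  rewrite setTI /X; congr (P _); apply/seteqP.
  have E w : (\int[mu]_(s in `[0%R, t]) ((simple_val (phi n) s w - H s w) ^+ 2)%:E)%E
      = gap (Phi n) H `[0, t] w.
    apply: eq_integral => r; rewrite inE/= in_itv/= => /andP[_ rt].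
    by rewrite PhiE.
  by split=> w /=; rewrite E gee0_abs// gap_ge0.
- have := int0 e e0; set X := fun n => P _.
  rewrite (_ : X = fun n => (pr P (setT `&` [set w | e <= `|Phi n (fun u => W i u w) w - I w|]))%:E).
    by move/fine_cvg.
  apply/funext => n; have [ePhi _ _ PhiE] := PhiP n.
  rewrite EFin_pr; last first.
    apply: measurableI => //; apply: measurable_ge_abs; apply: measurable_funB => //.
    exact: L2_measurable (elementary_integral_L2 i ePhi).
  by rewrite setTI /X; congr (P _); apply/seteqP; split=> w /=; rewrite PhiE lee_fin.
Qed.

Definition energy Phi (w : T) : \bar R := (\int[mu]_r (Phi (step r) w ^+ 2)%:E)%E.

(** Lenglart's inequality with [del] proportional to [e ^+ 2]. The isometry would
    need an energy small in mean and on the whole space. *)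
Lemma energy_small_on i (A : set T) (Phi : nat -> (R -> R) -> T -> R) :
  measurable A -> (forall n, elem (Phi n)) ->
  ge_small_on A (fun n => energy (Phi n)) ->
  small_on P A (fun n w => Phi n (fun u => W i u w) w).
Proof.
move=> mA ePhi E0 e e0; apply/cvgrPdist_le => eta eta0.
pose del := eta / 2 * e ^+ 2.
have d0 : 0 < del by rewrite mulr_gt0 ?exprn_gt0// divr_gt0.
have eta20 : 0 < eta / 2 by rewrite divr_gt0.
have /cvgrPdist_le /(_ _ eta20) := E0 _ d0; apply: filterS => n.
rewrite !sub0r !normrN !ger0_norm ?pr_ge0// => En.
have [k [g [c [g0 gle cF PhiE]]]] := elementary_grid filtF (ePhi n).
have := lenglart filtF bmW i g0 gle cF mA e0 d0.
rewrite -PhiE => /le_trans; apply; rewrite /del mulfK ?gt_eqF ?exprn_gt0//.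
suff -> : [set w | del <= grid_energy g c k w] = [set w | (del%:E <= energy (Phi n) w)%E] by lra.
by apply/seteqP; split=> w /=; rewrite /energy PhiE grid_energyE// lee_fin.
Qed.

Let sub_pos (E : set R) (t : R) : E `<=` `[0, t]%classic -> E `<=` [set r | 0 <= r].
Proof. by move=> Et r /Et /=; rewrite in_itv/= => /andP[]. Qed.

(** Locality. Subtract from the approximations of the integral up to [t] those of
    the integral up to [s] and [e]: on [A] the energy of the difference is at
    most twice the sum of the three gaps, so its integral is small there,
    whatever [e] does outside [A]. *)
Lemma ito_increment_limit i H (s t : R) Is It (e : nat -> (R -> R) -> T -> R) (A : set T) :
  0 <= s -> s <= t ->
  is_ito_integral P F (W i) H s Is -> is_ito_integral P F (W i) H t It ->
  (forall n, elem (e n)) ->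
  (forall n r w, r <= s -> e n (step r) w = 0) ->
  (forall n r w, t < r -> e n (step r) w = 0) -> measurable A ->
  ge_small_on A (fun n => gap (e n) H `]s, t]) ->
  small_on P A (fun n w => e n (fun u => W i u w) w - (It w - Is w)).
Proof.
move=> s0 st HIs HIt ee e_le e_gt mA e0.
have t0 : 0 <= t by exact: le_trans st.
have [mH _ _] := HIs.1.
have [mIs mIt] : measurable_fun setT Is /\ measurable_fun setT It.
  by split; [exact: HIs.2.1|exact: HIt.2.1].
have [Phis [es s_gt gaps ints]] := ito_elementary s0 HIs.
have [Phit [et t_gt gapt intt]] := ito_elementary t0 HIt.
pose Psi n f w := Phit n f w - Phis n f w - e n f w.
have ePsi n : elem (Psi n).
  exact: elementaryB (elementaryB (et n) (es n)) (ee n).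
have pos_t : `[0, t] `<=` [set r | 0 <= r] by apply: sub_pos; exact: subset_refl.
have pos_s : `[0, s] `<=` [set r | 0 <= r] by apply: sub_pos; exact: subset_refl.
have pos_st : `]s, t] `<=` [set r | 0 <= r].
  by move=> r /=; rewrite in_itv/= => /andP[sr _]; rewrite (le_trans s0)// ltW.
have mgap Phi (ePhi : elem Phi) (E : set (measurableTypeR R)) : measurable E ->
    E `<=` [set r | 0 <= r] -> measurable_fun [set: T] (gap Phi H E).
  by move=> mE E0; exact: (gap_measurable ePhi mH mE E0).
have mfix Phi (ePhi : elem Phi) w (E : set (measurableTypeR R)) : measurable E ->
    E `<=` [set r | 0 <= r] ->
    measurable_fun setT ((fun r => ((Phi (step r) w - H r w) ^+ 2)%:E) \_ E).
  move=> mE E0; apply/(measurable_restrictT _ mE); apply/measurable_EFinP.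
  apply: measurable_funX; apply: measurable_funB; last exact: process_path_measurable.
  apply: measurable_funTS.
  apply: (@measurableT_comp _ _ _ _ _ _ (fun p => Phi (step p.1) p.2) _ (fun r => (r, w))).
    exact: (elementary_step_measurable ePhi).
  exact: pair2_measurable.
pose Et : set R := `[0, t]%classic; pose Es : set R := `[0, s]%classic.
pose Est : set R := `]s, t]%classic.
have inEt x : Et x = (0 <= x <= t) :> Prop by rewrite /Et /= in_itv.
have inEs x : Es x = (0 <= x <= s) :> Prop by rewrite /Es /= in_itv.
have inEst x : Est x = (s < x <= t) :> Prop by rewrite /Est /= in_itv.
have energy_le n w : (energy (Psi n) w <= 2%:E * (gap (Phit n) H Et w +
    gap (Phis n) H Es w + gap (e n) H Est w))%E.
  pose f Phi (E : set R) := (fun r => ((Phi (step r) w - H r w) ^+ 2)%:E) \_ E.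
  have gapE Phi E : gap Phi H E w = (\int[mu]_r f Phi E r)%E.
    by rewrite /gap integral_mkcond.
  rewrite !gapE; pose f1 := f (Phit n) Et; pose f2 := f (Phis n) Es; pose f3 := f (e n) Est.
  rewrite -/f1 -/f2 -/f3.
  have f10 r : (0 <= f1 r)%E by rewrite /f1 /f patchE; case: ifP => // _; rewrite lee_fin sqr_ge0.
  have f20 r : (0 <= f2 r)%E by rewrite /f2 /f patchE; case: ifP => // _; rewrite lee_fin sqr_ge0.
  have f30 r : (0 <= f3 r)%E by rewrite /f3 /f patchE; case: ifP => // _; rewrite lee_fin sqr_ge0.
  have m1 : measurable_fun setT f1 by exact: (mfix _ (et n) w Et (measurable_itv _) pos_t).
  have m2 : measurable_fun setT f2 by exact: (mfix _ (es n) w Es (measurable_itv _) pos_s).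
  have m3 : measurable_fun setT f3 by exact: (mfix _ (ee n) w Est (measurable_itv _) pos_st).
  have m12 : measurable_fun setT (fun r => (f1 r + f2 r)%E) by exact: emeasurable_funD.
  rewrite -ge0_integralD// -ge0_integralD//; last by move=> r _; rewrite adde_ge0.
  rewrite -ge0_integralZl//; last 2 first.
  - exact: emeasurable_funD.
  - by move=> r _; rewrite !adde_ge0.
  apply: ge0_le_integral => //.
  - by move=> r _; rewrite lee_fin sqr_ge0.
  - apply/measurable_EFinP; apply: measurable_funX.
    apply: (@measurableT_comp _ _ _ _ _ _ (fun p => Psi n (step p.1) p.2) _ (fun r => (r, w))).
      exact: (elementary_step_measurable (ePsi n)).
    exact: pair2_measurable.
  - by apply: measurable_funeM; exact: emeasurable_funD.
  move=> r _; have Psi0 : Psi n (step r) w = 0 -> (((Psi n (step r) w) ^+ 2)%:E <= 2%:E * (f1 r + f2 r + f3 r))%E.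
    by move=> ->; rewrite expr0n mule_ge0// !adde_ge0.
  have [r0|r0] := ltP r 0.
    by apply: Psi0; exact: (elementary_step_le0 _ (ePsi n) (ltW r0)).
  have [tr|rt] := ltP t r.
    by apply: Psi0; rewrite /Psi t_gt// s_gt ?(le_lt_trans st)// e_gt// !subrr.
  have -> : f1 r = ((Phit n (step r) w - H r w) ^+ 2)%:E.
    by rewrite /f1 /f patchE mem_set// inEt r0.
  have [sr|rs] := ltP s r.
    have -> : f2 r = 0%E by rewrite /f2 /f patchE memNset// inEs r0 leNgt sr.
    have -> : f3 r = ((e n (step r) w - H r w) ^+ 2)%:E.
      by rewrite /f3 /f patchE mem_set// inEst sr.
    rewrite adde0 -EFinD -EFinM lee_fin /Psi s_gt// subr0.
    set a := Phit _ _ _; set b := e _ _ _; set x := H r w.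
    by have := sqr_ge0 ((a - x) + (b - x)); nra.
  have -> : f3 r = 0%E by rewrite /f3 /f patchE memNset// inEst ltNge rs.
  have -> : f2 r = ((Phis n (step r) w - H r w) ^+ 2)%:E.
    by rewrite /f2 /f patchE mem_set// inEs r0.
  rewrite adde0 -EFinD -EFinM lee_fin /Psi e_le// subr0.
  set a := Phit _ _ _; set b := Phis _ _ _; set x := H r w.
  by have := sqr_ge0 ((a - x) + (b - x)); nra.
have Psi_small : small_on P A (fun n w => Psi n (fun u => W i u w) w).
  apply: energy_small_on => // del d0.
  have d60 : 0 < del / 6 by rewrite divr_gt0.
  have mAg Phi (ePhi : elem Phi) (E : set (measurableTypeR R)) : measurable E ->
      E `<=` [set r | 0 <= r] -> measurable (A `&` [set w | ((del / 6)%:E <= gap Phi H E w)%E]).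
    by move=> mE E0; apply: measurableI => //; apply: measurable_ge_ereal; exact: mgap.
  have mSg Phi (ePhi : elem Phi) (E : set (measurableTypeR R)) : measurable E ->
      E `<=` [set r | 0 <= r] -> measurable (setT `&` [set w | ((del / 6)%:E <= gap Phi H E w)%E]).
    by move=> mE E0; apply: measurableI => //; apply: measurable_ge_ereal; exact: mgap.
  apply: (squeeze_pr3 _ _ _ _ _ (gapt _ d60) (gaps _ d60) (e0 _ d60)).
  - move=> n; apply: measurableI => //; have [k [g [c [g0 gle cF PsiE]]]] := elementary_grid filtF (ePsi n).
    rewrite (_ : [set w | _] = [set w | del <= grid_energy g c k w]); last first.
      by apply/seteqP; split=> w /=; rewrite /energy PsiE grid_energyE// lee_fin.
    rewrite -[X in measurable X]setTI; apply: measurable_fun_le => //.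
    apply: measurable_sum => l; apply: measurable_funM => //.
    by apply: measurable_funX; exact: L2_measurable (cF _ (ltn_ord l)).2.
  - by move=> n; exact: (mSg _ (et n) Et (measurable_itv _) pos_t).
  - by move=> n; exact: (mSg _ (es n) Es (measurable_itv _) pos_s).
  - by move=> n; exact: (mAg _ (ee n) Est (measurable_itv _) pos_st).
  - move=> n w [Aw /= dw]; have := le_trans dw (energy_le n w).
    have [ga|ga] := leP (del / 6)%:E (gap (Phit n) H Et w); first by left; left.
    have [gb|gb] := leP (del / 6)%:E (gap (Phis n) H Es w); first by left; right.
    have [gc|gc] := leP (del / 6)%:E (gap (e n) H Est w); first by right.
    move: ga gb gc (gap_ge0 (Phit n) H Et w) (gap_ge0 (Phis n) H Es w) (gap_ge0 (e n) H Est w).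
    case: gap => [x| |]//; case: gap => [y| |]//; case: gap => [z| |]//.
    rewrite -!EFinD -EFinM !lte_fin !lee_fin => xd yd zd x0 y0 z0 dxyz.
    exfalso; lra.
have to_A D : small_on P setT D -> (forall n, measurable_fun setT (D n)) -> small_on P A D.
  move=> D0 mD eps eps0; apply: squeeze_pr (D0 eps eps0) => n.
  - by apply: measurableI => //; exact: measurable_ge_abs.
  - by apply: measurableI => //; exact: measurable_ge_abs.
  - by move=> w [_ Dw]; split.
have mD1 n : measurable_fun setT (fun w => Phit n (fun u => W i u w) w - It w).
  by apply: measurable_funB => //; exact: L2_measurable (elementary_integral_L2 i (et n)).
have mD2 n : measurable_fun setT (fun w => Phis n (fun u => W i u w) w - Is w).
  by apply: measurable_funB => //; exact: L2_measurable (elementary_integral_L2 i (es n)).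
have mD3 n : measurable_fun setT (fun w => Psi n (fun u => W i u w) w).
  exact: L2_measurable (elementary_integral_L2 i (ePsi n)).
have smallN D : (forall n, measurable_fun setT (D n)) -> small_on P A D ->
    small_on P A (fun n w => - D n w).
  move=> mD; apply: small_on_le => //; last by apply: aeW => w n; rewrite normrN.
  by move=> n; exact: measurableT_comp.
have mND2 n : measurable_fun setT (fun w => - (Phis n (fun u => W i u w) w - Is w)).
  exact: measurableT_comp.
have mND3 n : measurable_fun setT (fun w => - Psi n (fun u => W i u w) w).
  exact: measurableT_comp.
have h12 := small_onD mA mD1 mND2 (to_A _ intt mD1) (smallN _ mD2 (to_A _ ints mD2)).
have h123 := small_onD mA (fun n => measurable_funD (mD1 n) (mND2 n)) mND3 h12 (smallN _ mD3 Psi_small).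
rewrite (_ : (fun n w => _) = fun n w => Phit n (fun u => W i u w) w - It w +
    - (Phis n (fun u => W i u w) w - Is w) + - Psi n (fun u => W i u w) w) //.
by apply/funext => n; apply/funext => w; rewrite /Psi; ring.
Qed.

End ito_locality.

(** * Mean-square estimates for increments of integrals *)

Section riemann_limits.
Context (R : realType) (disp : measure_display) (T : measurableType disp).
Context (P : probability T R) (F : R -> set (set T)).
Hypothesis filtF : filtration F.
Context (m : nat) (W : 'I_m -> R -> T -> R).
Hypothesis bmW : brownian_motion P F W.
Local Notation mu := (@lebesgue_measure R).

Definition time_set : set R := [set t : R | 0 <= t].

Lemma continuous_on_itv (u : R -> R) (s t : R) : 0 <= s ->
  {within time_set, continuous u} -> {within `[s, t], continuous u}.
Proof.
move=> s0; apply: continuous_subspaceW => r /=.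
by rewrite in_itv/= => /andP[sr _]; exact: le_trans sr.
Qed.

Definition left_coef (eta H : R -> T -> R) (s t : R) (N l : nat) (w : T) : R :=
  eta (ugrid s t N l) w * H (ugrid s t N l) w.

Definition left_sum eta H (s t : R) (N : nat) (f : R -> R) (w : T) : R :=
  grid_sum (ugrid s t N) (left_coef eta H s t N) N.+1 f w.

(** [eta] is a cutoff equal to 1 on the event [A]: the product [eta * H] is square
    integrable at each time, while nothing is assumed on the moments of [H]. *)
Section limits.
Context (H eta : R -> T -> R) (A : set T) (s t : R).
Hypotheses (s0 : 0 <= s) (st : s < t) (mA : measurable A).
Hypothesis cH : {ae P, forall w, {within time_set, continuous (H^~ w)}}.
Hypothesis etaH : forall r, 0 <= r -> L2F P F r (fun w => eta r w * H r w).
Hypothesis eta1 : {ae P, forall w, A w -> forall r, s <= r <= t -> eta r w = 1}.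

Let ge0_grid N l : 0 <= ugrid s t N l.
Proof. by rewrite (le_trans s0)// ugrid_ge// ltW. Qed.

Lemma left_coef_L2F N l : L2F P F (ugrid s t N l) (left_coef eta H s t N l).
Proof. exact: etaH. Qed.

Let left_sum_elementary N : elementary P F (left_sum eta H s t N).
Proof.
apply: elementary_grid_sum => //; first exact: ugrid_homo (ltW st).
by move=> l _; exact: left_coef_L2F.
Qed.

Let left_sum_near w e : {within time_set, continuous (H^~ w)} ->
  (forall r, s <= r <= t -> eta r w = 1) -> 0 < e ->
  \forall N \near \oo, forall r, s < r <= t ->
    `|left_sum eta H s t N (step r) w - H r w| < e.
Proof.
move=> cHw eta1w e0.
have := ugrid_unif_cvg st e0 (continuous_on_itv s0 cHw).
apply: filterS => N HN r srt; apply: HN => // l lN.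
rewrite /left_coef eta1w ?mul1r//.
by rewrite (ugrid_ge _ (ltW st))/= (ugrid_le (ltW st))// ltnW.
Qed.

(** On [A] these are left-endpoint step functions of the continuous path of [H],
    hence uniformly close to it. *)
Lemma left_sum_gap_small : measurable_process H ->
  ge_small_on P A (fun N => gap (left_sum eta H s t N) H `]s, t]).
Proof.
move=> mH e e0; apply: ae_pr_cvg0 => [N|].
  apply: measurableI => //; apply: measurable_ge_ereal.
  apply: (gap_measurable (left_sum_elementary N) mH) => //.
  by move=> r /=; rewrite in_itv/= => /andP[sr _]; rewrite (le_trans s0)// ltW.
apply: filterS2 cH eta1 => w cHw eta1w.
have [Aw|nA] := pselect (A w); last by apply: nearW => N -[].
pose d := Num.sqrt (e / (2 * (t - s))).
have ts0 : 0 < t - s by rewrite subr_gt0.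
have d0 : 0 < d by rewrite sqrtr_gt0 divr_gt0// mulr_gt0.
have := left_sum_near cHw (eta1w Aw) d0; apply: filterS => N HN [_ /=].
apply/negP; rewrite -ltNge.
apply: (@le_lt_trans _ _ (\int[mu]_(r in `]s, t]%classic) (d ^+ 2)%:E)%E).
  apply: ge0_le_integral => //.
  - by move=> r _; rewrite lee_fin sqr_ge0.
  - apply/measurable_EFinP; apply: measurable_funX; apply: measurable_funB.
      apply: measurable_funTS.
      apply: (@measurableT_comp _ _ _ _ _ _ (fun p => left_sum eta H s t N (step p.1) p.2) _ (fun r => (r, w))).
        exact: (elementary_step_measurable (left_sum_elementary N)).
      exact: pair2_measurable.
    apply: process_path_measurable => //.
    by move=> r /=; rewrite in_itv/= => /andP[sr _]; rewrite (le_trans s0)// ltW.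
  move=> r /=; rewrite in_itv/= => srt; rewrite lee_fin -[leLHS]real_normK ?num_real//.
  by rewrite lerXn2r// ?nnegrE ?ltW//; exact: HN.
rewrite integral_cst//= lebesgue_measure_itv/= lte_fin st -EFinB -EFinM lte_fin.
rewrite sqr_sqrtr ?divr_ge0 ?ltW ?mulr_gt0//.
rewrite invfM mulrA -[ltLHS]mulrA mulVf ?gt_eqF// mulr1.
by rewrite ltr_pdivrMr ?ltr0n// ltr_pMr// ltr1n.
Qed.

Lemma ito_left_sum i Is It :
  is_ito_integral P F (W i) H s Is -> is_ito_integral P F (W i) H t It ->
  small_on P A (fun N w => left_sum eta H s t N (fun u => W i u w) w - (It w - Is w)).
Proof.
move=> HIs HIt; have [mH _ _] := HIs.1.
apply: (ito_increment_limit filtF bmW s0 (ltW st) HIs HIt left_sum_elementary) => //.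
- by move=> N r w rs; apply: ugrid_sum_step_le => //; exact: ltW.
- by move=> N r w tr; apply: ugrid_sum_step_gt => //; exact: ltW.
- exact: left_sum_gap_small.
Qed.

Lemma drift_left_sum D : measurable_fun [set: T] D ->
  {ae P, forall w, D w = \int[mu]_(r in `[0, t]) H r w - \int[mu]_(r in `[0, s]) H r w} ->
  small_on P A (fun N w => left_sum eta H s t N id w - D w).
Proof.
move=> mD DE; apply: ae_small_on => // [N|].
  apply: measurable_funB => //; apply: measurable_sum => l.
  apply: measurable_funM => //; exact: L2_measurable (left_coef_L2F N l).2.
apply: filterS3 cH eta1 DE => w cHw eta1w Dw Aw.
have t0 : 0 <= t by rewrite (le_trans s0)// ltW.
have ts0 : 0 < t - s by rewrite subr_gt0.
have Hi : mu.-integrable `[0, t] (EFin \o H^~ w).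
  apply: continuous_compact_integrable; first exact: segment_compact.
  exact: continuous_on_itv cHw.
have Dst : D w = \int[mu]_(r in `]s, t]) H r w.
  by rewrite Dw Rintegral_itvB// bnd_simp// ltW.
have Hist : mu.-integrable `]s, t] (EFin \o H^~ w).
  apply: integrableS Hi => //; apply: subset_itv; rewrite bnd_simp//.
apply/cvgrPdist_lt => e e0.
have d0 : 0 < e / (2 * (t - s)) by rewrite divr_gt0// mulr_gt0.
have := left_sum_near cHw (eta1w Aw) d0; apply: filterS => N HN.
have [i1 m1] := mean_ugrid_sum N (left_coef eta H s t N) w (ltW st).
have m2 : left_sum eta H s t N id w = \int[mu]_(r in `]s, t]) left_sum eta H s t N (step r) w.
  rewrite /left_sum -m1 /mean [RHS]Rintegral_mkcond; apply: eq_Rintegral => r _.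
  rewrite patchE; case: ifPn => //; rewrite mem_setE in_itv/= negb_and -leNgt -ltNge.
  by move=> /orP[rs|tr]; [apply: ugrid_sum_step_le|apply: ugrid_sum_step_gt] => //; exact: ltW.
have i2 : mu.-integrable `]s, t] (EFin \o (fun r => left_sum eta H s t N (step r) w)).
  exact: integrableS i1.
have mst : measurable (`]s, t]%classic : set (measurableTypeR R)) by exact: measurable_itv.
have i3 : mu.-integrable `]s, t] (EFin \o (fun r => left_sum eta H s t N (step r) w - H r w)).
  exact: (integrableB mst i2 Hist).
rewrite sub0r normrN Dst m2 -RintegralB//.
apply: le_lt_trans (le_normr_Rintegral _ _) _ => //.
apply: (@le_lt_trans _ _ (\int[mu]_(r in `]s, t]%classic) (e / (2 * (t - s))))).
  apply: le_Rintegral => //.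
  - exact: integrable_norm i3.
  - apply/integrableP; split; first exact: measurable_cst.
    rewrite integral_cst//= lebesgue_measure_itv/= lte_fin st -EFinB -EFinM; exact: ltry.
  move=> r /=; rewrite in_itv/= => srt; apply/ltW; exact: HN.
rewrite Rintegral_cst// [X in fine X](lebesgue_measure_itv `]s, t])/= lte_fin st -EFinB /=.
rewrite invfM mulrA -[ltLHS]mulrA mulVf ?gt_eqF// mulr1.
by rewrite ltr_pdivrMr ?ltr0n// ltr_pMr// ltr1n.
Qed.

Let grid0 N : 0 <= ugrid s t N 0%N.
Proof. by rewrite ugrid0. Qed.

Let grid_homo N := ugrid_homo N (ltW st).

Let grid_sum_sub (V : T -> R) N f w :
  left_sum eta H s t N f w - V w * (f t - f s) =
  grid_sum (ugrid s t N) (fun l w => left_coef eta H s t N l w - V w) N.+1 f w.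
Proof.
have -> : V w * (f t - f s) = \sum_(l < N.+1) V w * (f (ugrid s t N l.+1) - f (ugrid s t N l)).
  rewrite -mulr_sumr -(big_mkord xpredT (fun l => f (ugrid s t N l.+1) - f (ugrid s t N l))).
  by rewrite (telescope_sumr (fun l => f (ugrid s t N l)))// ugrid0 ugrid_last.
by rewrite /left_sum /grid_sum -sumrB; apply: eq_bigr => l _; rewrite mulrBl.
Qed.

Let grid_length N (C : R) :
  \sum_(l < N.+1) (ugrid s t N l.+1 - ugrid s t N l) * C = (t - s) * C.
Proof.
rewrite -mulr_suml -(big_mkord xpredT (fun l => ugrid s t N l.+1 - ugrid s t N l)).
by rewrite telescope_sumr// ugrid0 ugrid_last.
Qed.

Section second_moment.
Context (V : T -> R) (C : R).
Hypothesis VF : L2F P F s V.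
Hypothesis etaHV : forall r, s <= r <= t ->
  mean P (fun w => (eta r w * H r w - V w) ^+ 2) <= C.

Let cF N l : L2F P F (ugrid s t N l) (fun w => left_coef eta H s t N l w - V w).
Proof.
apply: L2FB; first exact: left_coef_L2F.
exact: (L2F_le filtF s0 (ugrid_ge _ (ltW st) l) VF).
Qed.

Let coef_le N l : (l < N.+1)%N ->
  mean P (fun w => (left_coef eta H s t N l w - V w) ^+ 2) <= C.
Proof.
move=> lN; apply: etaHV.
by rewrite (ugrid_ge _ (ltW st))/= (ugrid_le (ltW st))// ltnW.
Qed.

(** Subtracting [V] from all coefficients of the left sum subtracts
    [V * (W i t - W i s)] from its integral. The isometry on each grid bounds the
    second moment of the difference, and Fatou's lemma passes to the limit. *)
Lemma ito_second_moment i Is It :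
  is_ito_integral P F (W i) H s Is -> is_ito_integral P F (W i) H t It ->
  let Z w := \1_A w * (It w - Is w - V w * (W i t w - W i s w)) in
  L2 P Z /\ mean P (fun w => Z w ^+ 2) <= (t - s) * C.
Proof.
move=> HIs HIt Z.
have t0 : 0 <= t by rewrite (le_trans s0)// ltW.
have [VW2 _] := L2_mul_increment_le filtF bmW i s0 (ltW st) VF.
apply: (@fatou_in_probability _ _ _ _ _ (fun N w =>
  left_sum eta H s t N (fun u => W i u w) w - V w * (W i t w - W i s w))) => //.
- move=> N; under eq_fun do rewrite (grid_sum_sub V N (fun u => W i u _)).
  exact: (grid_integral_L2F filtF bmW i (grid0 N) (@grid_homo N) (fun l _ => cF N l)).2.
- apply: measurable_funB; last exact: L2_measurable VW2.
  by apply: measurable_funB; [exact: HIt.2.1|exact: HIs.2.1].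
- move=> N; under eq_fun do rewrite (grid_sum_sub V N (fun u => W i u _)).
  rewrite (grid_isometry filtF bmW i (grid0 N) (@grid_homo N) (fun l _ => cF N l)).
  rewrite -(grid_length N C).
  by apply: ler_sum => l _; rewrite ler_wpM2l ?coef_le// subr_ge0 grid_homo.
- have := ito_left_sum HIs HIt; congr small_on.
  by apply/funext => N; apply/funext => w; ring.
Qed.

(** The same argument for the time integral. Instead of the isometry, the square
    of a sum of [N + 1] terms is at most [N + 1] times the sum of the squares,
    which yields one more factor [t - s]. *)
Lemma drift_second_moment D : measurable_fun [set: T] D ->
  {ae P, forall w, D w = \int[mu]_(r in `[0, t]) H r w - \int[mu]_(r in `[0, s]) H r w} ->
  let Z w := \1_A w * (D w - V w * (t - s)) in
  L2 P Z /\ mean P (fun w => Z w ^+ 2) <= (t - s) ^+ 2 * C.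
Proof.
move=> mD DE Z.
have VL : L2 P (fun w => V w * (t - s)).
  by under eq_fun do rewrite mulrC; exact: L2Z VF.2.
have cL N l : L2 P (fun w => (left_coef eta H s t N l w - V w) * ((t - s) / N.+1%:R)).
  by under eq_fun do rewrite mulrC; apply: L2Z; exact: (cF N l).2.
have E N : (fun w => left_sum eta H s t N id w - V w * (t - s)) =
    fun w => \sum_(l < N.+1) (left_coef eta H s t N l w - V w) * ((t - s) / N.+1%:R).
  apply/funext => w; rewrite (grid_sum_sub V N id).
  by apply: eq_bigr => l _; rewrite ugridS.
apply: (@fatou_in_probability _ _ _ _ _ (fun N w =>
  left_sum eta H s t N id w - V w * (t - s))) => //.
- by move=> N; rewrite E; apply: L2_sum => l _.
- by apply: measurable_funB => //; exact: L2_measurable VL.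
- move=> N; rewrite (_ : (t - s) ^+ 2 * C =
      #|'I_N.+1|%:R ^+ 2 * (((t - s) / N.+1%:R) ^+ 2 * C)); last first.
    by rewrite card_ord; field; rewrite addrC natr1 pnatr_eq0.
  rewrite -[X in mean P X]/(fun w => (fun w => left_sum eta H s t N id w - V w * (t - s)) w ^+ 2) E.
  apply: mean_sqr_sum_le => l //; under eq_fun do rewrite exprMn mulrC.
  by rewrite meanZ ?ler_wpM2l ?sqr_ge0 ?coef_le//; exact: L2_sqr (cF N l).2.
- have := drift_left_sum mD DE; congr small_on.
  by apply/funext => N; apply/funext => w; ring.
Qed.

End second_moment.

(** A bound in mean square does not make expectations converge, so orthogonality
    is recovered from second moments. The grid sums [Z_N] are orthogonal to [U],
    so [E(Z_N + k U)^2 <= C' + k^2 E U^2] for all real [k], where [C'] is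
    [(t - s) * C]. Their limit [Z] satisfies the same bound, hence
    [2 k E(U Z) <= C'] for all [k], which forces [E(U Z) = 0]. *)
Lemma ito_martingale i Is It U (C : R) : A = setT ->
  is_ito_integral P F (W i) H s Is -> is_ito_integral P F (W i) H t It ->
  (forall r, s <= r <= t -> mean P (fun w => (eta r w * H r w) ^+ 2) <= C) ->
  L2F P F s U -> L2 P (fun w => It w - Is w) -> mean P (fun w => U w * (It w - Is w)) = 0.
Proof.
move=> AT HIs HIt etaC UF I2.
have cF N l : L2F P F (ugrid s t N l) (left_coef eta H s t N l).
  exact: left_coef_L2F.
pose S N w := left_sum eta H s t N (fun u => W i u w) w.
have SL N : L2 P (S N).
  exact: (grid_integral_L2F filtF bmW i (grid0 N) (@grid_homo N) (fun l _ => cF N l)).2.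
have S2 N : mean P (fun w => S N w ^+ 2) <= (t - s) * C.
  rewrite (grid_isometry filtF bmW i (grid0 N) (@grid_homo N) (fun l _ => cF N l)).
  rewrite -(grid_length N C).
  apply: ler_sum => l _; rewrite ler_wpM2l//; first by rewrite subr_ge0 grid_homo.
  by apply: etaC; rewrite (ugrid_ge _ (ltW st))/= (ugrid_le (ltW st))// ltnW.
have US N : mean P (fun w => U w * S N w) = 0.
  apply: (grid_martingale filtF bmW i (grid0 N) (@grid_homo N) (fun l _ => cF N l)).
  by rewrite ugrid0.
pose u2 := mean P (fun w => U w ^+ 2); pose x := mean P (fun w => U w * (It w - Is w)).
have sqrD k V : L2 P V -> mean P (fun w => (V w + k * U w) ^+ 2) =
    mean P (fun w => V w ^+ 2) + 2 * k * mean P (fun w => U w * V w) + k ^+ 2 * u2.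
  move=> V2; have UV : L1 P (fun w => U w * V w) := L2M UF.2 V2.
  have -> : (fun w => (V w + k * U w) ^+ 2) = fun w =>
      (V w ^+ 2 + (2 * k) * (U w * V w)) + k ^+ 2 * U w ^+ 2.
    by apply/funext => w; ring.
  have i1 : L1 P (fun w => 2 * k * (U w * V w)) by exact: L1Z.
  have i2 : L1 P (fun w => k ^+ 2 * U w ^+ 2) by apply: L1Z; exact: L2_sqr UF.2.
  rewrite meanD//; last by apply: L1D => //; exact: L2_sqr.
  by rewrite meanD ?meanZ//; [exact: L2_sqr UF.2|exact: L2_sqr].
have lin k : 2 * k * x <= (t - s) * C.
  have [] := @fatou_in_probability _ _ _ P A (fun N w => S N w + k * U w)
      (fun w => (It w - Is w) + k * U w) ((t - s) * C + k ^+ 2 * u2) mA.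
  - by move=> N; apply: L2D => //; exact: L2Z UF.2.
  - by apply: measurable_funD; [exact: L2_measurable I2|exact: L2_measurable (L2Z k UF.2)].
  - by move=> N; rewrite sqrD// US mulr0 addr0 lerD2r.
  - have := ito_left_sum HIs HIt; congr small_on.
    by apply/funext => N; apply/funext => w; rewrite /S; ring.
  move=> _; rewrite AT; under eq_fun do rewrite indicT mul1r.
  rewrite sqrD// -/x lerD2r; apply: le_trans; rewrite lerDr; exact: mean_sqr_ge0.
have C0 : 0 <= (t - s) * C by have := lin 0; rewrite mulr0 mul0r.
apply/eqP; rewrite -/x; apply/negPn/negP => x0.
have := lin (((t - s) * C + 1) / (2 * x)).
rewrite (_ : 2 * _ * x = (t - s) * C + 1); first by lra.
by field.
Qed.

End limits.

End riemann_limits.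

(** * Affine stochastic differential equations *)

Section affine_coefficients.
Context (R : realType) (m d : nat).
Context (A : 'M[R]_d) (Lam : 'cV[R]_d) (B : 'I_m -> 'M[R]_d) (Gam : 'I_m -> 'cV[R]_d).

Definition nsq (y : 'cV[R]_d) : R := \sum_(k < d) y k 0 ^+ 2.

Lemma nsq_ge0 y : 0 <= nsq y.
Proof. by apply: sumr_ge0 => k _; exact: sqr_ge0. Qed.

Lemma sqr_le_nsq (y : 'cV[R]_d) k : y k 0 ^+ 2 <= nsq y.
Proof.
rewrite /nsq (bigD1 k)//= lerDl; apply: sumr_ge0 => l _; exact: sqr_ge0.
Qed.

Definition coef_mx (o : option 'I_m) : 'M[R]_d := if o is Some i then B i else A.

Definition coef_cst (o : option 'I_m) : 'cV[R]_d := if o is Some i then Gam i else Lam.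

(** The drift is the coefficient [None], that of [W i] is [Some i]. *)
Definition coef (o : option 'I_m) (j : 'I_d) (y : 'cV[R]_d) : R :=
  (coef_mx o *m y + coef_cst o) j 0.

Lemma coefE o j y : coef o j y = \sum_k coef_mx o j k * y k 0 + coef_cst o j 0.
Proof. by rewrite /coef !mxE. Qed.

Lemma coef_bounds : exists2 K, 0 <= K & forall o j,
  (forall y, coef o j y ^+ 2 <= K * (1 + nsq y)) /\
  (forall y z, (coef o j y - coef o j z) ^+ 2 <= K * nsq (y - z)).
Proof.
pose L := \sum_o \sum_j \sum_k coef_mx o j k ^+ 2.
pose V := \sum_o \sum_j coef_cst o j 0 ^+ 2.
have L0 : 0 <= L by do 3 (apply: sumr_ge0 => ? _); exact: sqr_ge0.
have V0 : 0 <= V by do 2 (apply: sumr_ge0 => ? _); exact: sqr_ge0.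
have LM o j k : coef_mx o j k ^+ 2 <= L.
  rewrite /L (bigD1 o)//= (bigD1 j)//= (bigD1 k)//= -!addrA lerDl.
  by rewrite !addr_ge0//; repeat (apply: sumr_ge0 => ? _); exact: sqr_ge0.
have VM o j : coef_cst o j 0 ^+ 2 <= V.
  rewrite /V (bigD1 o)//= (bigD1 j)//= -!addrA lerDl.
  by rewrite !addr_ge0//; repeat (apply: sumr_ge0 => ? _); exact: sqr_ge0.
have lin o j (y : 'cV[R]_d) : (\sum_k coef_mx o j k * y k 0) ^+ 2 <= d%:R * L * nsq y.
  apply: le_trans (sqr_sum_le _) _; rewrite card_ord -mulrA ler_wpM2l// mulr_sumr.
  by apply: ler_sum => k _; rewrite exprMn ler_wpM2r ?sqr_ge0.
have dL0 : 0 <= d%:R * L by rewrite mulr_ge0.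
exists (2 * (d%:R * L) + 2 * V); first by rewrite addr_ge0// mulr_ge0.
move=> o j; split=> [y|y z].
  have y0 := nsq_ge0 y; rewrite coefE; set a := \sum_k _; set b := coef_cst o j 0.
  have h1 := lin o j y; have h2 := VM o j; rewrite -/a -/b in h1 h2.
  have h3 := sqr_ge0 (a - b); have h4 := mulr_ge0 V0 y0.
  have h5 := mulr_ge0 dL0 y0; nra.
have -> : coef o j y - coef o j z = \sum_k coef_mx o j k * (y - z) k 0.
  rewrite !coefE opprD addrACA subrr addr0 -sumrB.
  by apply: eq_bigr => k _; rewrite !mxE mulrBr.
apply: le_trans (lin o j (y - z)) _; rewrite ler_wpM2r ?nsq_ge0//.
by set x := d%:R * L in dL0 *; lra.
Qed.

End affine_coefficients.

Section affine_sde.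
Context (R : realType) (disp : measure_display) (T : measurableType disp).
Context (P : probability T R) (F : R -> set (set T)).
Hypothesis filtF : filtration F.
Context (m d : nat) (W : 'I_m -> R -> T -> R).
Hypothesis bmW : brownian_motion P F W.
Local Notation mu := (@lebesgue_measure R).
Context (A : 'M[R]_d) (Lam : 'cV[R]_d) (B : 'I_m -> 'M[R]_d) (Gam : 'I_m -> 'cV[R]_d).
Local Notation coef := (coef A Lam B Gam).
Context (Y0 : 'cV[R]_d) (Y : R -> T -> 'cV[R]_d) (I : 'I_m -> 'I_d -> R -> T -> R).
Hypothesis mY : forall k r, 0 <= r -> Fmeas F r (fun w => Y r w k 0).
Hypothesis cY : {ae P, forall w, {within @time_set R, continuous (fun t => Y t w)}}.
Hypothesis startY : {ae P, forall w, Y 0 w = Y0}.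
Hypothesis HI : forall i j t, 0 <= t ->
  is_ito_integral P F (W i) (fun s w => coef (Some i) j (Y s w)) t (I i j t).
Hypothesis EI : forall t, 0 <= t -> {ae P, forall w, forall j,
  Y t w j 0 = Y0 j 0 + \int[mu]_(s in `[0, t]) coef None j (Y s w)
              + \sum_(i < m) I i j t w}.

Lemma coef_Fmeas o j r : 0 <= r -> Fmeas F r (fun w => coef o j (Y r w)).
Proof.
move=> r0; under eq_fun do rewrite coefE.
apply: FmeasD; last exact: Fmeas_cst.
by apply: Fmeas_sum => k _; apply: FmeasM; [exact: Fmeas_cst|exact: mY].
Qed.

Lemma Y_measurable k r : 0 <= r -> measurable_fun [set: T] (fun w => Y r w k 0).
Proof. by move=> r0; apply: (Fmeas_measurable filtF r0); exact: mY. Qed.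

Lemma continuous_coef w o j : {within @time_set R, continuous (fun t => Y t w)} ->
  {within @time_set R, continuous (fun t => coef o j (Y t w))}.
Proof.
move=> cYw x.
apply: (@cvg_comp _ _ _ _ (coef o j) _ _ _ (cYw x)).
rewrite (_ : coef o j = fun y => \sum_k coef_mx A B o j k * y k 0 + coef_cst Lam Gam o j 0);
  last by apply/funext => y; rewrite coefE.
apply: cvgD; last exact: cvg_cst.
apply: cvg_big => [|k _]; first exact: add_continuous.
by apply: cvgM; [exact: cvg_cst|exact: coord_continuous].
Qed.

Lemma ae_continuous_coef o j :
  {ae P, forall w, {within @time_set R, continuous (fun t => coef o j (Y t w))}}.
Proof. by apply: filterS cY => w; exact: continuous_coef. Qed.

(** The increment of the drift term, read off from the equation so that it is
    everywhere defined and measurable. *)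
Definition drift_inc (s t : R) (j : 'I_d) (w : T) : R :=
  Y t w j 0 - Y s w j 0 - \sum_(i < m) (I i j t w - I i j s w).

Lemma drift_inc_measurable s t j : 0 <= s -> 0 <= t ->
  measurable_fun [set: T] (drift_inc s t j).
Proof.
move=> s0 t0; apply: measurable_funB; first by apply: measurable_funB; exact: Y_measurable.
apply: measurable_sum => i; apply: measurable_funB.
  by have [_ []] := HI i j t0.
by have [_ []] := HI i j s0.
Qed.

Lemma drift_incE s t j : 0 <= s -> 0 <= t -> {ae P, forall w, drift_inc s t j w =
  \int[mu]_(r in `[0, t]) coef None j (Y r w) - \int[mu]_(r in `[0, s]) coef None j (Y r w)}.
Proof.
move=> s0 t0; apply: filterS2 (EI s0) (EI t0) => w Es Et.
rewrite /drift_inc Es Et sumrB; ring.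
Qed.

Lemma increment_decomp s t j w :
  Y t w j 0 - Y s w j 0 = drift_inc s t j w + \sum_(i < m) (I i j t w - I i j s w).
Proof. by rewrite /drift_inc subrK. Qed.

Section increment.
Context (s t : R) (eta : R -> T -> R) (E : set T) (C : R).
Hypotheses (s0 : 0 <= s) (st : s < t) (mE : measurable E).
Hypothesis etaF : forall o j r, 0 <= r -> L2F P F r (fun w => eta r w * coef o j (Y r w)).
Hypothesis eta1 : {ae P, forall w, E w -> forall r, s <= r <= t -> eta r w = 1}.
Hypothesis etaC : forall o j r, s <= r <= t ->
  mean P (fun w => (eta r w * coef o j (Y r w)) ^+ 2) <= C.

Let t0 : 0 <= t. Proof. by rewrite (le_trans s0)// ltW. Qed.

Let etaC0 o j r : s <= r <= t ->
  mean P (fun w => (eta r w * coef o j (Y r w) - (fun=> 0) w) ^+ 2) <= C.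
Proof. by move=> srt; under eq_fun do rewrite subr0; exact: etaC. Qed.

Let term (o : option 'I_m) j w : R :=
  if o is Some i then \1_E w * (I i j t w - I i j s w) else \1_E w * drift_inc s t j w.

Let term_bound o j : L2 P (term o j) /\ mean P (fun w => term o j w ^+ 2) <=
  ((t - s) ^+ 2 + (t - s)) * C.
Proof.
have C0 : 0 <= C.
  apply: le_trans (@etaC None j s _); first exact: mean_sqr_ge0.
  by rewrite lexx ltW.
have ts0 : 0 <= t - s by rewrite subr_ge0 ltW.
case: o => [i|].
  have := ito_second_moment filtF bmW s0 st mE (ae_continuous_coef (Some i) j)
    (@etaF (Some i) j) eta1 (L2F_cst P F s 0) (@etaC0 (Some i) j) (HI i j s0) (HI i j t0).
  rewrite (_ : (fun w => _ * (_ - _)) = term (Some i) j); last first.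
    by apply/funext => w; rewrite mul0r subr0.
  move=> [h1 h2]; split=> //; apply: le_trans h2 _; by rewrite ler_wpM2r// lerDr sqr_ge0.
have := drift_second_moment filtF s0 st mE (ae_continuous_coef None j)
  (@etaF None j) eta1 (L2F_cst P F s 0) (@etaC0 None j)
  (drift_inc_measurable j s0 t0) (drift_incE j s0 t0).
rewrite (_ : (fun w => _ * (_ - _)) = term None j); last first.
  by apply/funext => w; rewrite mul0r subr0.
move=> [h1 h2]; split=> //; apply: le_trans h2 _; by rewrite ler_wpM2r// lerDl.
Qed.

(** Drift and stochastic integrals alike: each of the [m + 1] terms is bounded in
    mean square on [E] by the estimates with [V = 0]. *)
Lemma increment_bound j :
  L2 P (fun w => \1_E w * (Y t w j 0 - Y s w j 0)) /\
  mean P (fun w => (\1_E w * (Y t w j 0 - Y s w j 0)) ^+ 2) <=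
  m.+1%:R ^+ 2 * ((t - s) ^+ 2 + (t - s)) * C.
Proof.
have decomp w : \1_E w * (Y t w j 0 - Y s w j 0) = \sum_o term o j w.
  rewrite increment_decomp mulrDr mulr_sumr (bigD1 None)//=; congr (_ + _).
  rewrite (reindex_omap Some id)//=.
    by apply: eq_bigl => i; rewrite eqxx.
  by case.
have L o : L2 P (term o j) := (term_bound o j).1.
split; first by under eq_fun do rewrite decomp; exact: L2_sum.
under eq_fun do rewrite decomp.
have := mean_sqr_sum_le L (fun o => (term_bound o j).2).
by rewrite card_option card_ord mulrA.
Qed.

End increment.

(** [min r |q|] runs through a dense subset of [[0, r]] containing [r]. *)
Definition rat_time (r : R) (q : rat) : R := Num.min r `|ratr q|.

Lemma rat_time_itv r q : 0 <= r -> 0 <= rat_time r q <= r.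
Proof. by move=> r0; rewrite /rat_time le_min r0 normr_ge0/= ge_min lexx. Qed.

Lemma rat_time_last r : 0 <= r -> rat_time r (Num.bound r)%:R = r.
Proof.
by move=> r0; rewrite /rat_time ratr_nat min_l// ger0_norm// ltW// archi_boundP.
Qed.

(** The event that the path stays in a ball up to time [r]; it replaces a
    stopping time, and only involves the past of [r]. *)
Definition bset (n : nat) (r : R) : set T :=
  [set w | forall q, nsq (Y (rat_time r q) w) <= n%:R].

Lemma nsq_Fmeas r : 0 <= r -> Fmeas F r (fun w => nsq (Y r w)).
Proof. by move=> r0; apply: Fmeas_sum => k _; apply: FmeasM; exact: mY. Qed.

Lemma nsq_measurable r : 0 <= r -> measurable_fun [set: T] (fun w => nsq (Y r w)).
Proof. by move=> r0; apply: (Fmeas_measurable filtF r0); exact: nsq_Fmeas. Qed.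

Lemma bset_F n r : 0 <= r -> F r (bset n r).
Proof.
move=> r0; have [sF _ _] := filtF.
have FE : <<s F r >> = F r by apply: sigma_algebra_id; exact: sF.
have : @measurable _ (g_sigma_algebraType (F r)) (bset n r).
  rewrite (_ : bset n r = ~` \bigcup_q [set w | n%:R < nsq (Y (rat_time r q) w)]).
    apply: measurableC; apply: bigcupT_measurable_rat => q.
    have /andP[q0 qr] := rat_time_itv q r0.
    have mq := Fmeas_le filtF q0 qr (nsq_Fmeas q0).
    have := mq measurableT _ (measurable_itv `]n%:R, +oo[).
    rewrite setTI; congr measurable; apply/funext => w/=.
    by rewrite in_itv/= andbT.
  rewrite setC_bigcup; apply/seteqP; split=> w /= H q => [_|].
    by apply/negP; rewrite -leNgt; exact: H.
  by rewrite leNgt; apply/negP; exact: H.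
by move=> H; rewrite -FE; exact: H.
Qed.

Lemma bset_measurable n r : 0 <= r -> measurable (bset n r).
Proof.
by move=> r0; have [_ sub _] := filtF; apply: (sub r) => //; exact: bset_F.
Qed.

Lemma continuous_nsq w : {within @time_set R, continuous (fun t => Y t w)} ->
  {within @time_set R, continuous (fun t => nsq (Y t w))}.
Proof.
move=> cYw x; apply: (@cvg_comp _ _ _ _ (@nsq R d) _ _ _ (cYw x)).
apply: cvg_big => [|k _]; first exact: add_continuous.
by under eq_fun do rewrite expr2; rewrite expr2; apply: cvgM; exact: coord_continuous.
Qed.

(** By continuity, from the dense times of the definition. *)
Lemma bset_path w n t : {within @time_set R, continuous (fun t => Y t w)} ->
  bset n t w -> forall r, 0 <= r <= t -> nsq (Y r w) <= n%:R.
Proof.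
move=> cYw bw r /andP[r0]; rewrite le_eqVlt => /predU1P[rt|rt].
  by have := bw (Num.bound r)%:R; rewrite -rt rat_time_last.
rewrite leNgt; apply/negP => nr.
have /subspace_continuousP/(_ r r0)/cvgrPdist_lt := continuous_nsq cYw.
move=> /(_ (nsq (Y r w) - n%:R)); rewrite subr_gt0 => /(_ nr).
move=> /nbhs_ballP[e /= e0 He].
have : r < Num.min (r + e) t by rewrite lt_min rt ltrDl e0.
move=> /rat_in_itvoo[q]; rewrite in_itv/= lt_min => /and3P[rq qe qt].
have q0 : 0 <= ratr q :> R by rewrite (le_trans r0)// ltW.
have qn := bw q; rewrite /rat_time ger0_norm// min_r ?(ltW qt)// in qn.
have rq_ball : ball r e (ratr q : R).
  by rewrite /ball/= ltr_distlC qe andbT ltrBlDr (lt_trans rq)// ltrDl.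
have := ltr_normlW (He (ratr q) rq_ball q0).
by rewrite /from_subspace ltrD2l ltrNl opprK ltNge qn.
Qed.

Lemma bset_le w n r t : {within @time_set R, continuous (fun t => Y t w)} ->
  0 <= r <= t -> bset n t w -> bset n r w.
Proof.
move=> cYw /andP[r0 rt] bw q; apply: (bset_path cYw bw).
by have /andP[-> qr] := rat_time_itv q r0; rewrite (le_trans qr).
Qed.

Lemma bset_large w t : 0 <= t -> {within @time_set R, continuous (fun t => Y t w)} ->
  \forall n \near \oo, bset n t w.
Proof.
move=> t0 cYw.
have [c _ cmax] := EVT_max t0 (continuous_on_itv (lexx 0) (continuous_nsq cYw)).
near=> n => q; apply: le_trans (cmax _ _) _; first by rewrite in_itv/= rat_time_itv.
by near: n; exact: nbhs_infty_ger.
Unshelve. all: by end_near. Qed.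

Definition trunc_moment n r : R := mean P (fun w => \1_(bset n r) w * nsq (Y r w)).

Lemma bset_nsq n r w : 0 <= r -> \1_(bset n r) w * nsq (Y r w) <= n%:R.
Proof.
move=> r0; rewrite indicE; have [wb|_] := boolP (w \in bset n r); last by rewrite mul0r.
by rewrite mul1r; have := set_mem wb (Num.bound r)%:R; rewrite rat_time_last.
Qed.

Lemma indic_nsq_ge0 (E : set T) r w : 0 <= \1_E w * nsq (Y r w) :> R.
Proof. by rewrite mulr_ge0// nsq_ge0. Qed.

Lemma bset_nsq_L1 n r : 0 <= r -> L1 P (fun w => \1_(bset n r) w * nsq (Y r w)).
Proof.
move=> r0; apply: (L1_le (V := fun=> n%:R)); last 2 first.
- exact: L1_cst.
- by move=> w; rewrite !ger0_norm ?bset_nsq// indic_nsq_ge0.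
apply: measurable_funM; last exact: nsq_measurable.
by apply: measurable_indic; exact: bset_measurable.
Qed.

(** This bound depends on [n]; it only makes the suprema in [trunc_interval]
    finite. *)
Lemma trunc_moment_le n r : 0 <= r -> trunc_moment n r <= n%:R.
Proof.
move=> r0; rewrite -[leRHS](mean_cst P); apply: le_mean => [||w].
- exact: bset_nsq_L1.
- exact: L1_cst.
- exact: bset_nsq.
Qed.

Lemma trunc_moment_ge0 n r : 0 <= trunc_moment n r.
Proof. by apply: mean_ge0 => w; exact: indic_nsq_ge0. Qed.

Lemma trunc_moment0 n : trunc_moment n 0 <= nsq Y0.
Proof.
have m0 := nsq_measurable (lexx 0).
have E : {ae P, forall w, nsq (Y 0 w) = nsq Y0} by apply: filterS startY => w ->.
have L0 : L1 P (fun w => nsq (Y 0 w)) := L1_ae m0 (L1_cst P (nsq Y0)) E.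
rewrite -[leRHS](mean_cst P) -(eq_mean_ae m0 (measurable_cst _) E).
apply: le_mean => // [|w]; first exact: bset_nsq_L1.
by rewrite indicE; case: (_ \in _); rewrite ?mul1r// mul0r nsq_ge0.
Qed.

Section trunc_step.
Context (K : R).
Hypothesis K0 : 0 <= K.
Hypothesis coef1 : forall o j y, coef o j y ^+ 2 <= K * (1 + nsq y).

Lemma trunc_coef_L2F n o j r : 0 <= r ->
  L2F P F r (fun w => \1_(bset n r) w * coef o j (Y r w)).
Proof.
move=> r0; have FU : Fmeas F r (fun w => \1_(bset n r) w * coef o j (Y r w)).
  by apply: FmeasM; [exact: Fmeas_indic (bset_F n r0)|exact: coef_Fmeas].
split=> //; apply: (@L2_bounded _ _ _ _ _ (1 + K * (1 + n%:R))) => [|w].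
  exact: (Fmeas_measurable filtF r0).
apply: (@le_trans _ _ (1 + `|\1_(bset n r) w * coef o j (Y r w)| ^+ 2)).
  by have := sqr_ge0 (`|\1_(bset n r) w * coef o j (Y r w)| - 1); set x := `| _ |; nra.
rewrite lerD2l real_normK ?num_real// exprMn.
apply: le_trans (ler_wpM2l (sqr_ge0 _) (coef1 o j _)) _.
have := bset_nsq n w r0; rewrite indicE; case: (w \in _) => H.
  by rewrite expr1n mul1r ler_wpM2l// lerD2l -[leLHS]mul1r.
by rewrite expr0n mul0r mulr_ge0// addr_ge0.
Qed.

Lemma trunc_coef_mean n o j r : 0 <= r ->
  mean P (fun w => (\1_(bset n r) w * coef o j (Y r w)) ^+ 2) <=
  K * (1 + trunc_moment n r).
Proof.
move=> r0; rewrite -{1}(mean_cst P 1) -meanD; last 2 first.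
- exact: L1_cst.
- exact: bset_nsq_L1.
rewrite -meanZ; last by apply: L1D; [exact: L1_cst|exact: bset_nsq_L1].
apply: le_mean => [||w].
- exact: L2_sqr (trunc_coef_L2F n o j r0).2.
- by apply: L1Z; apply: L1D; [exact: L1_cst|exact: bset_nsq_L1].
rewrite exprMn; apply: le_trans (ler_wpM2l (sqr_ge0 _) (coef1 o j _)) _.
rewrite mulrCA ler_wpM2l// indicE; case: (w \in _).
  by rewrite expr1n !mul1r.
by rewrite expr0n !mul0r addr0.
Qed.

(** On [bset n t] the cutoffs [\1_(bset n r)] equal 1 for all [r <= t], so
    [increment_bound] applies with this event; and [bset n t] is almost surely
    contained in [bset n s], which brings the truncated moment at [s]. *)
Lemma trunc_step n s t U : 0 <= s -> s < t ->
  (forall r, s <= r <= t -> trunc_moment n r <= U) ->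
  trunc_moment n t <= 2 * trunc_moment n s +
    2 * (d%:R * (m.+1%:R ^+ 2 * ((t - s) ^+ 2 + (t - s)) * (K * (1 + U)))).
Proof.
move=> s0 st uU; have t0 : 0 <= t by rewrite (le_trans s0)// ltW.
have mb := bset_measurable n t0.
have inc k := @increment_bound s t (fun r => \1_(bset n r)) (bset n t) (K * (1 + U))
  s0 st mb (trunc_coef_L2F n) _ _ k.
have {}inc k : L2 P (fun w => \1_(bset n t) w * (Y t w k 0 - Y s w k 0)) /\
  mean P (fun w => (\1_(bset n t) w * (Y t w k 0 - Y s w k 0)) ^+ 2) <=
  m.+1%:R ^+ 2 * ((t - s) ^+ 2 + (t - s)) * (K * (1 + U)).
  apply: inc => [|o j r srt].
    apply: filterS cY => w cYw Ew r /andP[sr rt].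
    rewrite indicE mem_set//; apply: (bset_le cYw _ Ew).
    by rewrite (le_trans s0 sr).
  have r0 : 0 <= r by case/andP: srt => + _; exact: le_trans.
  by apply: le_trans (trunc_coef_mean n o j r0) _; rewrite ler_wpM2l// lerD2l uU.
have L1s := bset_nsq_L1 n s0; have L1t := bset_nsq_L1 n t0.
have LI : L1 P (fun w => \sum_k (\1_(bset n t) w * (Y t w k 0 - Y s w k 0)) ^+ 2).
  by apply: L1_sum => k _; exact: L2_sqr (inc k).1.
pose X w : R := \1_(bset n s) w * (\1_(bset n t) w * nsq (Y t w)).
have LX : L1 P X by apply: L1M_indic => //; exact: bset_measurable.
have -> : trunc_moment n t = mean P X.
  apply: eq_mean_ae; [exact: L1_measurable L1t|exact: L1_measurable LX|].
  apply: filterS cY => w cYw; rewrite /X [X in X * _ = _]indicE [X in _ = _ * (X * _)]indicE.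
  have [wt|_] := boolP (w \in bset n t); last by rewrite !mul0r mulr0.
  by rewrite indicE mem_set ?mul1r//; apply: (bset_le cYw _ (set_mem wt)); rewrite s0 ltW.
apply: (@le_trans _ _ (mean P (fun w => 2 * (\1_(bset n s) w * nsq (Y s w)) +
    2 * \sum_k (\1_(bset n t) w * (Y t w k 0 - Y s w k 0)) ^+ 2))).
  apply: le_mean => [//||w]; first by apply: L1D; exact: L1Z.
  rewrite /X !indicE; case: (w \in bset n s); case: (w \in bset n t);
    rewrite ?(mul1r, mul0r, mulr0); last 3 first.
  - rewrite addr_ge0// mulr_ge0//; first exact: nsq_ge0.
    by apply: sumr_ge0 => k _; exact: sqr_ge0.
  - by rewrite add0r mulr_ge0//; apply: sumr_ge0 => k _; exact: sqr_ge0.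
  - by rewrite add0r mulr_ge0//; apply: sumr_ge0 => k _; exact: sqr_ge0.
  rewrite !mulr_sumr -big_split; apply: ler_sum => k _ /=.
  rewrite mul1r; set a := Y t w k 0; set b := Y s w k 0.
  by have := sqr_ge0 (a - b - b); nra.
rewrite meanD; [|exact: L1Z|exact: L1Z].
rewrite !meanZ// lerD2l ler_wpM2l// mean_sum => [|k _]; last exact: L2_sqr (inc k).1.
apply: le_trans (ler_sum _ (fun k _ => (inc k).2)) _.
by rewrite sumr_const card_ord mulr_natl.
Qed.

(** Short enough for the factor of [1 + U] in [trunc_step] to be at most [1 / 2]. *)
Definition step_length : R := (1 + 8 * d%:R * m.+1%:R ^+ 2 * K)^-1.

Lemma step_length_gt0 : 0 < step_length.
Proof. by rewrite invr_gt0 ltr_pwDl// !mulr_ge0// exprn_ge0. Qed.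

(** With [U] the supremum of the truncated moments over the interval,
    [trunc_step] gives [U <= 2 u + (1 + U) / 2], where [u] is the moment at the
    left end. *)
Lemma trunc_interval n s r : 0 <= s -> s <= r <= s + step_length ->
  trunc_moment n r <= 4 * trunc_moment n s + 1.
Proof.
move=> s0 srt; set t := s + step_length in srt.
pose S := [set trunc_moment n r | r in [set r | s <= r <= t]].
have hS : has_sup S.
  split; first by exists (trunc_moment n r), r.
  exists n%:R => _ [r' /andP[sr' _] <-]; apply: trunc_moment_le; exact: le_trans sr'.
have US r' : s <= r' <= t -> trunc_moment n r' <= sup S.
  by move=> sr't; apply: ub_le_sup; [exact: hS.2|exists r'].
apply: le_trans (US _ srt) _.
have U0 : 0 <= sup S by apply: le_trans (US _ srt); exact: trunc_moment_ge0.
suff : sup S <= 2 * trunc_moment n s + 2^-1 * (1 + sup S) by lra.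
apply: ge_sup; first exact: hS.1.
move=> _ [r' /andP[sr' r't] <-].
have u0 := trunc_moment_ge0 n s.
have [sr''|rs] := ltP s r'; last by rewrite (le_anti (introT andP (conj sr' rs))) in u0 *; lra.
apply: le_trans (trunc_step s0 sr'' (U := sup S) _) _.
  by move=> r1 /andP[sr1 r1r]; apply: US; rewrite sr1 (le_trans r1r).
rewrite lerD2l.
have h0 : 0 < r' - s by rewrite subr_gt0.
have h1 : r' - s <= step_length by rewrite lerBlDl.
have L := step_length_gt0.
set c : R := d%:R * m.+1%:R ^+ 2 * K.
have c0 : 0 <= c by rewrite !mulr_ge0// exprn_ge0.
have Lc : step_length * (1 + 8 * c) = 1.
  rewrite (_ : 8 * c = 8 * d%:R * m.+1%:R ^+ 2 * K); last by rewrite /c; ring.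
  by rewrite mulVf// gt_eqF// ltr_pwDl// !mulr_ge0// exprn_ge0.
have L1 : step_length <= 1 by have := mulr_ge0 (ltW L) c0; nra.
have h2 : (r' - s) ^+ 2 + (r' - s) <= 2 * step_length by nra.
have h3 : ((r' - s) ^+ 2 + (r' - s)) * c <= 2 * step_length * c by rewrite ler_wpM2r.
have h4 : ((r' - s) ^+ 2 + (r' - s)) * c <= 4^-1 by lra.
rewrite (_ : 2 * _ = 2 * (((r' - s) ^+ 2 + (r' - s)) * c) * (1 + sup S)).
  by rewrite ler_wpM2r//; [rewrite addr_ge0|lra].
by rewrite /c; ring.
Qed.

Lemma trunc_moment_bounded k : exists2 C, 0 <= C &
  forall n r, 0 <= r <= k%:R * step_length -> trunc_moment n r <= C.
Proof.
elim: k => [|k [C C0 ih]].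
  exists (nsq Y0) => [|n r]; first exact: nsq_ge0.
  by rewrite mul0r => /andP[r0 r1]; rewrite (_ : r = 0) ?trunc_moment0//; apply/le_anti; rewrite r1.
exists (4 * C + 1) => [|n r /andP[r0]]; first by rewrite addr_ge0// mulr_ge0.
rewrite -natr1 mulrDl mul1r => rk.
have [rk'|rk'] := leP r (k%:R * step_length).
  by apply: (@le_trans _ _ C); [apply: ih; rewrite r0|lra].
have k0 : 0 <= k%:R * step_length by rewrite mulr_ge0// ltW// step_length_gt0.
apply: le_trans (trunc_interval n k0 (r := r) _) _; first by rewrite rk ltW.
by have := ih n (k%:R * step_length); rewrite k0 lexx => /(_ isT); lra.
Qed.

End trunc_step.

(** The bounds on the truncated moments do not depend on [n], and almost every
    path lies in [bset n r] for large [n]. *)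
Lemma second_moment_bounded t0 : 0 <= t0 -> exists2 C, 0 <= C &
  forall r k, 0 <= r <= t0 -> L2 P (fun w => Y r w k 0) /\
    mean P (fun w => Y r w k 0 ^+ 2) <= C.
Proof.
move=> t00; have [K K0 coefK] := coef_bounds A Lam B Gam.
have coef1 o j := (coefK o j).1.
have L0 := step_length_gt0 K0.
have [C C0 HC] := trunc_moment_bounded K0 coef1 (Num.bound (t0 / step_length K)).
exists C => // r k /andP[r0 rt0].
have rL : 0 <= r <= (Num.bound (t0 / step_length K))%:R * step_length K.
  rewrite r0 (le_trans rt0)// -ler_pdivrMr// ltW//.
  by rewrite archi_boundP// divr_ge0// ltW.
have mYk := Y_measurable k r0.
pose Z n w : R := \1_(bset n r) w * Y r w k 0.
have mZ n : measurable_fun [set: T] (Z n).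
  by apply: measurable_funM => //; apply: measurable_indic; exact: bset_measurable.
have ZL n : L2 P (Z n) /\ mean P (fun w => Z n w ^+ 2) <= C.
  have Zle w : Z n w ^+ 2 <= \1_(bset n r) w * nsq (Y r w).
    rewrite /Z exprMn indicE; case: (_ \in _); rewrite ?expr1n ?expr0n ?mul0r// !mul1r.
    exact: sqr_le_nsq.
  have LZ : L1 P (fun w => Z n w ^+ 2).
    apply: (L1_le _ (bset_nsq_L1 n r0)) => [|w]; first exact: measurable_funX.
    by rewrite !ger0_norm ?sqr_ge0// indic_nsq_ge0.
  split=> //; apply: le_trans (HC n r rL).
  by apply: le_mean => //; exact: bset_nsq_L1.
have := fatou_in_probability (A := setT) measurableT (fun n => (ZL n).1) mYk
  (fun n => (ZL n).2) _.
rewrite (_ : (fun w => \1_setT w * Y r w k 0) = (fun w => Y r w k 0)); last first.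
  by apply/funext => w; rewrite indicT mul1r.
under [X in mean P X <= _]eq_fun do rewrite indicT mul1r.
apply; apply: ae_small_on => //; first by move=> n; exact: measurable_funB.
apply: filterS cY => w cYw _; apply: cvg_near_cst.
apply: filterS (bset_large r0 cYw) => n bw.
by rewrite /Z indicE mem_set// mul1r subrr.
Qed.

Section short_increments.
Context (t0 : R).
Hypothesis t00 : 0 <= t0.

(** The Euler step of the martingale part of [Y j] over [[s, t]]. *)
Definition noise (s t : R) (j : 'I_d) (w : T) : R :=
  \sum_(i < m) coef (Some i) j (Y s w) * (W i t w - W i s w).

Lemma coef_L2F o j s : 0 <= s -> L2F P F s (fun w => coef o j (Y s w)).
Proof.
move=> s0; under eq_fun do rewrite coefE.
apply: L2FD; last exact: L2F_cst.
apply: L2F_sum => k _; split; first by apply: FmeasM; [exact: Fmeas_cst|exact: mY].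
apply: L2Z; have [C _ HC] := second_moment_bounded s0.
by apply: (HC s k _).1; rewrite s0 lexx.
Qed.

Lemma Y_L2F k s : 0 <= s -> L2F P F s (fun w => Y s w k 0).
Proof.
move=> s0; split; first exact: mY.
by have [C _ HC] := second_moment_bounded s0; apply: (HC s k _).1; rewrite s0 lexx.
Qed.

Lemma mean_nsq s : 0 <= s -> L1 P (fun w => nsq (Y s w)) /\
  mean P (fun w => nsq (Y s w)) = \sum_k mean P (fun w => Y s w k 0 ^+ 2).
Proof.
move=> s0; split; first by apply: L1_sum => k _; exact: L2_sqr (Y_L2F k s0).2.
by rewrite mean_sum// => k _; exact: L2_sqr (Y_L2F k s0).2.
Qed.

Lemma coef_bounded : exists2 C, 0 <= C & forall o j s, 0 <= s <= t0 ->
  mean P (fun w => coef o j (Y s w) ^+ 2) <= C.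
Proof.
have [K K0 coefK] := coef_bounds A Lam B Gam.
have [C C0 HC] := second_moment_bounded t00.
exists (K * (1 + d%:R * C)) => [|o j s st0]; first by rewrite !mulr_ge0// addr_ge0// mulr_ge0.
have s0 : 0 <= s by case/andP: st0.
have [L E] := mean_nsq s0.
apply: (@le_trans _ _ (mean P (fun w => K * (1 + nsq (Y s w))))).
  apply: le_mean => [||w]; first exact: L2_sqr (coef_L2F o j s0).2.
    by apply: L1Z; apply: L1D => //; exact: L1_cst.
  exact: (coefK o j).1.
rewrite meanZ; last by apply: L1D => //; exact: L1_cst.
rewrite meanD ?mean_cst//; last exact: L1_cst.
rewrite ler_wpM2l// lerD2l E; apply: le_trans (ler_sum _ (fun k _ => (HC s k st0).2)) _.
by rewrite sumr_const card_ord mulr_natl.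
Qed.

Let srt_itv s t r : 0 <= s -> t <= t0 -> s <= r <= t -> 0 <= r <= t0.
Proof. by move=> s0 tt0 /andP[sr rt]; rewrite (le_trans s0 sr) (le_trans rt tt0). Qed.

Let unit_L2F o j r : 0 <= r -> L2F P F r (fun w => (fun _ _ => 1) r w * coef o j (Y r w)).
Proof. by move=> r0; under eq_fun do rewrite mul1r; exact: coef_L2F. Qed.

Let unit1 s t : {ae P, forall w, [set: T] w -> forall r, s <= r <= t ->
  (fun (_ : R) (_ : T) => 1 : R) r w = 1}.
Proof. exact: aeW. Qed.

Lemma increment_bounded : exists2 C, 0 <= C & forall s t k, 0 <= s -> s <= t -> t <= t0 ->
  mean P (fun w => (Y t w k 0 - Y s w k 0) ^+ 2) <= C * (t - s).
Proof.
have [C C0 HC] := coef_bounded.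
exists (m.+1%:R ^+ 2 * (t0 + 1) * C) => [|s t k s0].
  by rewrite !mulr_ge0// ?exprn_ge0// addr_ge0.
rewrite le_eqVlt => /orP[/eqP <- _|st tt0].
  under eq_fun do rewrite subrr expr0n/=.
  by rewrite mean_0 subrr mulr0.
have bdd o j r : s <= r <= t -> mean P (fun w => ((fun _ _ => 1) r w * coef o j (Y r w)) ^+ 2) <= C.
  move=> srt; under eq_fun do rewrite mul1r.
  by apply: HC; exact: srt_itv srt.
have [_] := @increment_bound s t (fun _ _ => 1) setT C s0 st measurableT unit_L2F (unit1 s t) bdd k.
under [X in mean P X <= _]eq_fun do rewrite indicT mul1r.
move=> h; apply: le_trans h _.
have h0 : 0 <= t - s by rewrite subr_ge0 ltW.
have h1 : t - s <= t0 by rewrite lerBlDr (le_trans tt0)// lerDl.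
rewrite [leRHS](_ : _ = m.+1%:R ^+ 2 * ((t - s) * (t0 + 1)) * C); last ring.
rewrite ler_wpM2r// ler_wpM2l ?exprn_ge0//.
by rewrite mulrDr mulr1 lerD2r expr2 ler_wpM2l.
Qed.

Lemma coef_increment_bounded : exists2 C, 0 <= C & forall o j s t r,
  0 <= s -> t <= t0 -> s <= r <= t ->
  mean P (fun w => (coef o j (Y r w) - coef o j (Y s w)) ^+ 2) <= C * (t - s).
Proof.
have [K K0 coefK] := coef_bounds A Lam B Gam.
have [C C0 HC] := increment_bounded.
exists (K * (d%:R * C)) => [|o j s t r s0 tt0 /andP[sr rt]]; first by rewrite !mulr_ge0.
have r0 := le_trans s0 sr.
have L k : L2 P (fun w => Y r w k 0 - Y s w k 0).
  by apply: L2B; [exact: (Y_L2F k r0).2|exact: (Y_L2F k s0).2].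
apply: (@le_trans _ _ (mean P (fun w => K * \sum_k (Y r w k 0 - Y s w k 0) ^+ 2))).
  apply: le_mean => [||w].
  - by apply: L2_sqr; apply: L2B; [exact: (coef_L2F o j r0).2|exact: (coef_L2F o j s0).2].
  - by apply: L1Z; apply: L1_sum => k _; exact: L2_sqr.
  - apply: le_trans ((coefK o j).2 _ _) _; rewrite /nsq ler_wpM2l//.
    by apply: ler_sum => k _; rewrite !mxE.
rewrite meanZ; last by apply: L1_sum => k _; exact: L2_sqr.
rewrite -!mulrA ler_wpM2l// mean_sum => [|k _]; last exact: L2_sqr.
apply: le_trans (ler_sum _ (fun k _ => HC s r k s0 sr (le_trans rt tt0))) _.
rewrite sumr_const card_ord -[leLHS]mulr_natl ler_wpM2l// ler_wpM2l//.
by rewrite lerD2r.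
Qed.

Let ito_inc s t i j w := I i j t w - I i j s w.

Lemma noise_L2 s t j : 0 <= s -> s <= t -> L2 P (noise s t j).
Proof.
move=> s0 st; apply: L2_sum => i _.
exact: (L2_mul_increment_le filtF bmW i s0 st (coef_L2F (Some i) j s0)).1.
Qed.

(** Freezing the coefficients at time [s]: over [[s, t]] the drift part is
    [(t - s) * a(Y s)] up to [O((t - s)^(3/2))] in mean square, and the whole
    increment is the Gaussian noise up to [O(t - s)]. Against a variable known at
    time [s], only the drift part of the increment counts. *)
Lemma frozen_increment : exists2 C, 0 <= C & forall s t, 0 <= s -> s < t -> t <= t0 ->
  [/\ forall k, mean P (fun w => Y s w k 0 ^+ 2) <= C,
    forall j, L2 P (drift_inc s t j) /\
      mean P (fun w => (drift_inc s t j w - coef None j (Y s w) * (t - s)) ^+ 2) <=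
      C * (t - s) ^+ 3,
    forall j, mean P (fun w => noise s t j w ^+ 2) <= C * (t - s),
    forall j, mean P (fun w => (Y t w j 0 - Y s w j 0 - noise s t j w) ^+ 2) <=
      C * (t - s) ^+ 2 &
    forall j U, L2F P F s U ->
      mean P (fun w => U w * (Y t w j 0 - Y s w j 0)) = mean P (fun w => U w * drift_inc s t j w)].
Proof.
have [C1 C10 H1] := coef_bounded; have [C2 C20 H2] := coef_increment_bounded.
have [C3 C30 H3] := second_moment_bounded t00.
pose C := C3 + C2 + m%:R ^+ 2 * C1 + m.+1%:R ^+ 2 * (C1 + C2).
have pC : [/\ 0 <= m%:R ^+ 2 * C1 & 0 <= m.+1%:R ^+ 2 * (C1 + C2)].
  by split; rewrite mulr_ge0// ?exprn_ge0// addr_ge0.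
exists C => [|s t s0 st tt0]; first by case: pC => p1 p2; rewrite !addr_ge0.
have [p1 p2] := pC.
have h0 : 0 <= t - s by rewrite subr_ge0 ltW.
have tpos : 0 <= t by rewrite (le_trans s0)// ltW.
have st0 : 0 <= s <= t0 by rewrite s0 (le_trans (ltW st)).
have frozen o j r : s <= r <= t ->
    mean P (fun w => ((fun _ _ => 1) r w * coef o j (Y r w) - coef o j (Y s w)) ^+ 2) <=
    C2 * (t - s).
  by move=> srt; under eq_fun do rewrite mul1r; exact: (H2 o j s t r).
have bdd o j r : s <= r <= t ->
    mean P (fun w => ((fun _ _ => 1) r w * coef o j (Y r w)) ^+ 2) <= C1.
  by move=> srt; under eq_fun do rewrite mul1r; apply: H1; exact: srt_itv srt.
have bdd0 o j r : s <= r <= t ->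
    mean P (fun w => ((fun _ _ => 1) r w * coef o j (Y r w) - (fun=> 0) w) ^+ 2) <= C1.
  by move=> srt; under eq_fun do rewrite subr0; exact: bdd.
have drift j := @drift_second_moment _ _ _ P F filtF _ (fun _ _ => 1) setT s t s0 st
  measurableT (ae_continuous_coef None j) (@unit_L2F None j) (unit1 s t).
have ito i j := @ito_second_moment _ _ _ P F filtF _ W bmW _ (fun _ _ => 1) setT s t s0 st
  measurableT (ae_continuous_coef (Some i) j) (@unit_L2F (Some i) j) (unit1 s t).
have D0 j : L2 P (drift_inc s t j) /\ mean P (fun w => drift_inc s t j w ^+ 2) <= (t - s) ^+ 2 * C1.
  have := drift j _ C1 (L2F_cst P F s 0) (@bdd0 None j) _
    (drift_inc_measurable j s0 tpos) (drift_incE j s0 tpos).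
  by under eq_fun do rewrite indicT mul1r mul0r subr0.
have D1 j : mean P (fun w => (drift_inc s t j w - coef None j (Y s w) * (t - s)) ^+ 2) <=
    (t - s) ^+ 2 * (C2 * (t - s)).
  have := drift j _ (C2 * (t - s)) (coef_L2F None j s0) (@frozen None j) _
    (drift_inc_measurable j s0 tpos) (drift_incE j s0 tpos).
  by under eq_fun do rewrite indicT mul1r; case.
have Z1 i j : L2 P (fun w => ito_inc s t i j w - coef (Some i) j (Y s w) * (W i t w - W i s w)) /\
   mean P (fun w => (ito_inc s t i j w - coef (Some i) j (Y s w) * (W i t w - W i s w)) ^+ 2) <=
   (t - s) * (C2 * (t - s)).
  have := ito i j _ (C2 * (t - s)) (coef_L2F (Some i) j s0) (@frozen (Some i) j) i _ _
    (HI i j s0) (HI i j tpos).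
  by under eq_fun do rewrite indicT mul1r.
have ito_L2 i j : L2 P (ito_inc s t i j).
  have := L2D (Z1 i j).1 (L2_mul_increment_le filtF bmW i s0 (ltW st) (coef_L2F (Some i) j s0)).1.
  by under eq_fun do rewrite subrK.
have noise_term i j :
    mean P (fun w => (coef (Some i) j (Y s w) * (W i t w - W i s w)) ^+ 2) <= C1 * (t - s).
  rewrite (L2_mul_increment_le filtF bmW i s0 (ltW st) (coef_L2F (Some i) j s0)).2.
  by rewrite mulrC ler_wpM2r// H1.
have rem j w : Y t w j 0 - Y s w j 0 - noise s t j w = \sum_o
    (if o is Some i then ito_inc s t i j w - coef (Some i) j (Y s w) * (W i t w - W i s w)
     else drift_inc s t j w).
  rewrite increment_decomp /noise -addrA -sumrB [RHS](bigD1 None)//=; congr (_ + _).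
  rewrite [RHS](reindex_omap Some id)//=.
    by apply: eq_bigl => i; rewrite eqxx.
  by case.
have le1 (x y z : R) : 0 <= z -> x <= y -> x * z <= y * z by move=> z0 xy; rewrite ler_wpM2r.
split.
- by move=> k; apply: le_trans (H3 s k st0).2 _; rewrite /C; lra.
- move=> j; split; first exact: (D0 j).1.
  apply: le_trans (D1 j) _; rewrite (_ : (t - s) ^+ 2 * _ = C2 * (t - s) ^+ 3); last ring.
  by apply: le1; [exact: exprn_ge0|rewrite /C; lra].
- move=> j; apply: (@le_trans _ _ (#|'I_m|%:R ^+ 2 * (C1 * (t - s)))).
    apply: mean_sqr_sum_le => i //.
    exact: (L2_mul_increment_le filtF bmW i s0 (ltW st) (coef_L2F (Some i) j s0)).1.
  by rewrite card_ord mulrA; apply: le1 => //; rewrite /C; lra.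
- move=> j; under eq_fun do rewrite rem.
  apply: (@le_trans _ _ (#|{: option 'I_m}|%:R ^+ 2 * ((C1 + C2) * (t - s) ^+ 2))).
    apply: mean_sqr_sum_le => -[i|]; [exact: (Z1 i j).1|exact: (D0 j).1| |].
      apply: le_trans (Z1 i j).2 _; rewrite (_ : _ * (C2 * _) = C2 * (t - s) ^+ 2); last ring.
      by apply: le1; [exact: exprn_ge0|lra].
    apply: le_trans (D0 j).2 _; rewrite mulrC.
    by apply: le1; [exact: exprn_ge0|lra].
  rewrite card_option card_ord mulrA; apply: le1; first exact: exprn_ge0.
  by rewrite /C; lra.
- move=> j U UF.
  under eq_fun do rewrite increment_decomp mulrDr mulr_sumr.
  have LU i : L1 P (fun w => U w * ito_inc s t i j w) by apply: L2M => //; exact: UF.2.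
  rewrite meanD; [|by apply: L2M; [exact: UF.2|exact: (D0 j).1]|by apply: L1_sum => i _; exact: LU].
  rewrite mean_sum => [|i _]; last exact: LU.
  rewrite big1 ?addr0// => i _.
  apply: (@ito_martingale _ _ _ P F filtF _ W bmW _ (fun _ _ => 1) setT s t s0 st
    measurableT (ae_continuous_coef (Some i) j) (@unit_L2F (Some i) j) (unit1 s t) i _ _ U C1) => //.
  + exact: HI.
  + exact: HI.
  + exact: bdd.
  + exact: ito_L2.
Qed.

(** For equal indices, by polarisation of the isometry. *)
Lemma mean_mul_increments s t i i' U V : 0 <= s -> s < t -> L2F P F s U -> L2F P F s V ->
  mean P (fun w => (U w * (W i t w - W i s w)) * (V w * (W i' t w - W i' s w))) =
  if i == i' then (t - s) * mean P (fun w => U w * V w) else 0.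
Proof.
move=> s0 st UF VF; case: eqVneq => [<-|ii']; last exact: mean_cross_increment ii' UF VF.
have [LU EU] := L2_mul_increment_le filtF bmW i s0 (ltW st) UF.
have [LV EV] := L2_mul_increment_le filtF bmW i s0 (ltW st) VF.
have [LS ES] := L2_mul_increment_le filtF bmW i s0 (ltW st) (L2FD UF VF).
have sqrD (f g : T -> R) : L2 P f -> L2 P g -> mean P (fun w => (f w + g w) ^+ 2) =
    mean P (fun w => f w ^+ 2) + mean P (fun w => g w ^+ 2) + 2 * mean P (fun w => f w * g w).
  move=> fL gL; rewrite -meanZ; last exact: L2M.
  have [[f2 g2] fg] := (L2_sqr fL, L2_sqr gL, L1Z 2 (L2M fL gL)).
  rewrite -meanD// -meanD//; last exact: L1D.
  by congr mean; apply/funext => w; ring.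
have ES' : mean P (fun w => (U w * (W i t w - W i s w) + V w * (W i t w - W i s w)) ^+ 2) =
   (t - s) * (mean P (fun w => U w ^+ 2) + mean P (fun w => V w ^+ 2) +
            2 * mean P (fun w => U w * V w)).
  by rewrite -(sqrD _ _ UF.2 VF.2) -(L2_mul_increment_le filtF bmW i s0 (ltW st) (L2FD UF VF)).2;
     congr mean; apply/funext => w; rewrite mulrDl.
rewrite (sqrD _ _ LU LV) EU EV in ES'; lra.
Qed.

Lemma mean_mul_noise s t j k : 0 <= s -> s < t ->
  mean P (fun w => noise s t j w * noise s t k w) =
  (t - s) * \sum_(i < m) mean P (fun w => coef (Some i) j (Y s w) * coef (Some i) k (Y s w)).
Proof.
move=> s0 st; under eq_fun do rewrite /noise mulr_suml.
have LN i j' := (L2_mul_increment_le filtF bmW i s0 (ltW st) (coef_L2F (Some i) j' s0)).1.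
rewrite mean_sum => [|i _]; last by apply: L2M; [exact: LN|exact: noise_L2 (ltW st)].
rewrite mulr_sumr; apply: eq_bigr => i _.
under eq_fun do rewrite mulr_sumr.
rewrite mean_sum => [|i' _]; last exact: L2M.
rewrite (eq_bigr (fun i' => if i' == i then (t - s) *
    mean P (fun w => coef (Some i) j (Y s w) * coef (Some i') k (Y s w)) else 0)).
  by rewrite -big_mkcond big_pred1_eq.
by move=> i' _; rewrite (mean_mul_increments _ _ s0 st (coef_L2F _ _ s0) (coef_L2F _ _ s0)) eq_sym.
Qed.

Lemma abs_mean_mul_le U V (c : R) : L2 P U -> L2 P V -> 0 <= c ->
  mean P (fun w => U w ^+ 2) * mean P (fun w => V w ^+ 2) <= c ^+ 2 ->
  `|mean P (fun w => U w * V w)| <= c.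
Proof.
move=> UL VL c0 h; apply: le_trans (cauchy_schwarz UL VL) _.
rewrite -sqrtrM; last exact: mean_sqr_ge0.
by rewrite -[leRHS](ger0_norm c0) -sqrtr_sqr ler_wsqrtr.
Qed.

(** The expected drift of [Y j * Y k] in Ito's product rule. *)
Definition product_drift (s : R) (j k : 'I_d) : R :=
  mean P (fun w => Y s w j 0 * coef None k (Y s w)) +
  mean P (fun w => Y s w k 0 * coef None j (Y s w)) +
  \sum_(i < m) mean P (fun w => coef (Some i) j (Y s w) * coef (Some i) k (Y s w)).

(** Cauchy-Schwarz against the constant 1, for the drift part only. *)
Lemma mean_expansion : exists2 C, 0 <= C & forall s t j, 0 <= s -> s < t -> t <= t0 ->
  `|mean P (fun w => Y t w j 0) - mean P (fun w => Y s w j 0) -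
    (t - s) * mean P (fun w => coef None j (Y s w))| <= C * ((t - s) * Num.sqrt (t - s)).
Proof.
have [C C0 HC] := frozen_increment.
exists (1 + C) => [|s t j s0 st tt0]; first by rewrite addr_ge0.
have [_ /(_ j)[LD HD] _ _ /(_ j (fun=> 1) (L2F_cst P F s 1)) M] := HC s t s0 st tt0.
have tpos : 0 <= t by rewrite (le_trans s0)// ltW.
have h0 : 0 < t - s by rewrite subr_gt0.
have Y1 r : 0 <= r -> L1 P (fun w => Y r w j 0) by move=> r0; apply: L2_L1; exact: (Y_L2F j r0).2.
have cL := (coef_L2F None j s0).2.
have cL' : L2 P (fun w => coef None j (Y s w) * (t - s)).
  by under eq_fun do rewrite mulrC; exact: L2Z.
rewrite -meanB; [|exact: Y1|exact: Y1].
under [X in mean P X - _]eq_fun do rewrite -[_ - _]mul1r.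
rewrite M; under [X in mean P X - _]eq_fun do rewrite mul1r.
rewrite -meanZ; last exact: L2_L1.
rewrite -meanB; [|exact: L2_L1|by apply: L1Z; exact: L2_L1].
rewrite (_ : (fun w => _ - _) = (fun w => 1 * (drift_inc s t j w - coef None j (Y s w) * (t - s)))); last first.
  by apply/funext => w; ring.
have q := sqr_sqrtr (ltW h0); set g := Num.sqrt (t - s) in q *.
have g0 : 0 <= g by exact: sqrtr_ge0.
apply: abs_mean_mul_le => //; first exact: L2_cst.
- exact: L2B.
- by rewrite mulr_ge0 ?addr_ge0// mulr_ge0// ltW.
under eq_fun do rewrite expr1n.
rewrite mean_cst mul1r; apply: le_trans HD _.
rewrite -q (_ : _ ^+ 3 = (g ^+ 2 * g) ^+ 2); last ring.
rewrite [leRHS]exprMn ler_wpM2r ?sqr_ge0//.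
by have := sqr_ge0 C; rewrite sqrrD expr1n; lra.
Qed.

(** Expand [Y t j * Y t k] around time [s]. The products of [Y s] with an increment
    bring the first two terms of [product_drift], and the product of the two
    noises brings the third one by the isometry. What is left are products of
    variables whose mean squares are of order 0 and 3, 1 and 2, or 2 and 2 in
    [t - s], hence at least [(t - s)^(3/2)] by Cauchy-Schwarz. *)
Lemma product_expansion : exists2 C, 0 <= C & forall s t j k, 0 <= s -> s < t -> t <= t0 ->
  `|mean P (fun w => Y t w j 0 * Y t w k 0) - mean P (fun w => Y s w j 0 * Y s w k 0) -
    (t - s) * product_drift s j k| <= C * ((t - s) * Num.sqrt (t - s)).
Proof.
have [C C0 HC] := frozen_increment.
exists (4 * C + C * Num.sqrt t0) => [|s t j k s0 st tt0].
  by rewrite addr_ge0// mulr_ge0// sqrtr_ge0.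
have [HY HD HN HR HM] := HC s t s0 st tt0.
have tpos : 0 <= t by rewrite (le_trans s0)// ltW.
have h0 : 0 < t - s by rewrite subr_gt0.
(* With [t - s = g^2] all exponents are integers. *)
have q := sqr_sqrtr (ltW h0); set g := Num.sqrt (t - s) in q *.
have g0 : 0 <= g by exact: sqrtr_ge0.
have gt0 : g <= Num.sqrt t0 by rewrite ler_wsqrtr// lerBlDr (le_trans tt0)// lerDl.
have YL r l : 0 <= r -> L2 P (fun w => Y r w l 0) by move=> r0; exact: (Y_L2F l r0).2.
have cL l := (coef_L2F None l s0).2.
have NL l : L2 P (noise s t l) by exact: noise_L2 (ltW st).
have IL l : L2 P (fun w => Y t w l 0 - Y s w l 0) by apply: L2B; exact: YL.
pose r l w := Y t w l 0 - Y s w l 0 - noise s t l w.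
have rL l : L2 P (r l) by exact: L2B.
pose e l w := drift_inc s t l w - coef None l (Y s w) * (t - s).
have cL' l : L2 P (fun w => coef None l (Y s w) * (t - s)).
  by under eq_fun do rewrite mulrC; exact: L2Z.
have eL l : L2 P (e l) by apply: L2B => //; exact: (HD l).1.
have cross a b : mean P (fun w => Y s w a 0 * (Y t w b 0 - Y s w b 0)) =
    (t - s) * mean P (fun w => Y s w a 0 * coef None b (Y s w)) +
    mean P (fun w => Y s w a 0 * e b w).
  rewrite HM; last exact: Y_L2F.
  rewrite -meanZ; last by apply: L2M => //; exact: YL.
  rewrite -meanD; [|by apply: L1Z; apply: L2M => //; exact: YL|by apply: L2M => //; exact: YL].
  by congr mean; apply/funext => w; rewrite /e; ring.
have square : mean P (fun w => (Y t w j 0 - Y s w j 0) * (Y t w k 0 - Y s w k 0)) =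
    mean P (fun w => noise s t j w * noise s t k w) + mean P (fun w => noise s t j w * r k w) +
    mean P (fun w => noise s t k w * r j w) + mean P (fun w => r j w * r k w).
  rewrite -!meanD; try by repeat apply: L1D; exact: L2M.
  by congr mean; apply/funext => w; rewrite /r; ring.
have expand : mean P (fun w => Y t w j 0 * Y t w k 0) - mean P (fun w => Y s w j 0 * Y s w k 0) =
    mean P (fun w => Y s w j 0 * (Y t w k 0 - Y s w k 0)) +
    mean P (fun w => Y s w k 0 * (Y t w j 0 - Y s w j 0)) +
    mean P (fun w => (Y t w j 0 - Y s w j 0) * (Y t w k 0 - Y s w k 0)).
  rewrite -!meanD -?meanB; try by repeat apply: L1D; apply: L2M => //; exact: YL.
  by congr mean; apply/funext => w; ring.
have b1 a b : `|mean P (fun w => Y s w a 0 * e b w)| <= C * (g ^+ 2 * g).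
  apply: abs_mean_mul_le => //; [exact: YL|by rewrite !mulr_ge0|].
  apply: le_trans (ler_pM (mean_sqr_ge0 _ _) (mean_sqr_ge0 _ _) (HY a) (HD b).2) _.
  by rewrite -q le_eqVlt; apply/orP; left; apply/eqP; ring.
have b2 a b : `|mean P (fun w => noise s t a w * r b w)| <= C * (g ^+ 2 * g).
  apply: abs_mean_mul_le => //; first by rewrite !mulr_ge0.
  apply: le_trans (ler_pM (mean_sqr_ge0 _ _) (mean_sqr_ge0 _ _) (HN a) (HR b)) _.
  by rewrite -q le_eqVlt; apply/orP; left; apply/eqP; ring.
have b3 : `|mean P (fun w => r j w * r k w)| <= C * (g ^+ 2 * g ^+ 2).
  apply: abs_mean_mul_le => //; first by rewrite !mulr_ge0.
  apply: le_trans (ler_pM (mean_sqr_ge0 _ _) (mean_sqr_ge0 _ _) (HR j) (HR k)) _.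
  by rewrite -q le_eqVlt; apply/orP; left; apply/eqP; ring.
have -> : mean P (fun w => Y t w j 0 * Y t w k 0) - mean P (fun w => Y s w j 0 * Y s w k 0) -
    (t - s) * product_drift s j k =
    mean P (fun w => Y s w j 0 * e k w) + mean P (fun w => Y s w k 0 * e j w) +
    mean P (fun w => noise s t j w * r k w) + mean P (fun w => noise s t k w * r j w) +
    mean P (fun w => r j w * r k w).
  by rewrite expand !cross square mean_mul_noise// /product_drift; ring.
apply: (@le_trans _ _ (4 * (C * (g ^+ 2 * g)) + C * (g ^+ 2 * g ^+ 2))).
  rewrite (_ : 4 * _ = C * (g ^+ 2 * g) + C * (g ^+ 2 * g) + C * (g ^+ 2 * g) + C * (g ^+ 2 * g)); last ring.
  apply: le_trans (ler_normD _ _) (lerD _ b3).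
  apply: le_trans (ler_normD _ _) (lerD _ (b2 k j)).
  apply: le_trans (ler_normD _ _) (lerD _ (b2 j k)).
  exact: le_trans (ler_normD _ _) (lerD (b1 j k) (b1 k j)).
rewrite -q [leRHS](_ : _ = 4 * (C * (g ^+ 2 * g)) + C * (g ^+ 2 * (Num.sqrt t0 * g))); last ring.
by rewrite lerD2l ler_wpM2l// ler_wpM2l ?sqr_ge0// [X in X <= _]expr2 ler_wpM2r.
Qed.

End short_increments.

End affine_sde.

(** * Kronecker products and linear differential equations *)

Section kronecker.
Context (R : comNzRingType).

Lemma vecD (k n : nat) (C D : 'M[R]_(k, n)) : vec (C + D) = vec C + vec D.
Proof. by apply/matrixP => x y; rewrite !mxE. Qed.

Lemma vec_sum (k n : nat) (I : Type) (r : seq I) (C : I -> 'M[R]_(k, n)) :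
  vec (\sum_(i <- r) C i) = \sum_(i <- r) vec (C i).
Proof.
apply/matrixP => x y; rewrite summxE mxE summxE.
by apply: eq_bigr => i _; rewrite mxE.
Qed.

(** The first index of a row of [C *t D] runs over the rows of [C], which
    correspond to the columns in the stacking of [vec]. *)
Lemma tens_mul_vec (p q r s : nat) (C : 'M[R]_(p, q)) (D : 'M[R]_(r, s)) (X : 'M[R]_(s, q)) :
  (C *t D) *m vec X = vec (D *m X *m C^T).
Proof.
apply/colP => x; rewrite [LHS]mxE [RHS]mxE; set x1 := (mxtens_unindex x).1; set x2 := (mxtens_unindex x).2.
rewrite (reindex (@mxtens_index q s)); last first.
  by exists (@mxtens_unindex q s) => y _; [exact: mxtens_indexK|exact: mxtens_unindexK].
rewrite (eq_bigr (fun y => C x1 y.1 * D x2 y.2 * X y.2 y.1)); last first.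
  by move=> y _; rewrite !mxE mxtens_indexK.
rewrite -(pair_bigA _ (fun i l => C x1 i * D x2 l * X l i)) [RHS]mxE.
apply: eq_bigr => i _; rewrite mxE [C^T _ _]mxE mulr_suml; apply: eq_bigr => l _; ring.
Qed.

Lemma kron_clE (r k n : nat) (v : 'cV[R]_r) (D : 'M[R]_(k, n)) x c :
  kron_cl v D x c = v (mxtens_unindex x).1 0 * D (mxtens_unindex x).2 c.
Proof.
rewrite /kron_cl castmxE mxE /=; congr (v _ _ * D _ _).
- by apply: val_inj.
- by rewrite [LHS]ord1.
- by apply: val_inj.
- by apply: val_inj; rewrite /= modn_small.
Qed.

Lemma kron_crE (r k n : nat) (D : 'M[R]_(k, n)) (v : 'cV[R]_r) x c :
  kron_cr D v x c = D (mxtens_unindex x).1 c * v (mxtens_unindex x).2 0.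
Proof.
rewrite /kron_cr castmxE mxE /=; congr (D _ _ * v _ _).
- by apply: val_inj.
- by apply: val_inj; rewrite /= divn1.
- by apply: val_inj.
- by rewrite [LHS]ord1.
Qed.

Lemma kron_cl_mul (r k n : nat) (v : 'cV[R]_r) (D : 'M[R]_(k, n)) (M : 'cV[R]_n) :
  kron_cl v D *m M = vec (D *m M *m v^T).
Proof.
apply/colP => x; rewrite [LHS]mxE [RHS]mxE [RHS]mxE big_ord1 mxE [v^T _ _]mxE mulr_suml.
by apply: eq_bigr => c _; rewrite kron_clE; ring.
Qed.

Lemma kron_cr_mul (r k n : nat) (D : 'M[R]_(k, n)) (v : 'cV[R]_r) (M : 'cV[R]_n) :
  kron_cr D v *m M = vec (v *m M^T *m D^T).
Proof.
apply/colP => x; rewrite [LHS]mxE [RHS]mxE [RHS]mxE; apply: eq_bigr => c _.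
by rewrite kron_crE [(v *m _) _ _]mxE big_ord1 [M^T _ _]mxE [D^T _ _]mxE; ring.
Qed.

End kronecker.

Section linear_ode.
Context (R : realType) (n : nat) (Q : R -> 'cV[R]_n) (AA : 'M[R]_n) (S : 'cV[R]_n).
Local Notation G := (fun t => AA *m Q t + S).
Hypothesis bddQ : forall t0, 0 <= t0 ->
  exists2 C, 0 <= C & forall s a, 0 <= s <= t0 -> `|Q s a 0| <= C.
Hypothesis incQ : forall t0, 0 <= t0 ->
  exists2 C, 0 <= C & forall s t a, 0 <= s -> s < t -> t <= t0 ->
    `|Q t a 0 - Q s a 0 - (t - s) * G s a 0| <= C * ((t - s) * Num.sqrt (t - s)).

Lemma cvg_col (T : Type) (F : set_system T) (f : T -> 'cV[R]_n) (l : 'cV[R]_n) :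
  Filter F -> (forall a, f x a 0 @[x --> F] --> l a 0) -> f x @[x --> F] --> l.
Proof.
move=> FF fl.
have colE (v : 'cV[R]_n) : v = \sum_a v a 0 *: delta_mx a 0.
  by rewrite {1}[v]matrix_sum_delta; apply: eq_bigr => a _; rewrite big_ord1.
rewrite [l]colE (_ : f = fun x => \sum_a f x a 0 *: delta_mx a 0); last first.
  by apply/funext => x; exact: colE.
apply: cvg_big => [|a _]; first exact: add_continuous.
exact: cvgZr_tmp.
Qed.

(** For [h < 0] the increment is expanded at the left end [t + h], where the
    right-hand side differs from its value at [t] by [O(h)] only. *)
Lemma difference_quotient t : 0 <= t -> exists C, forall h a,
  h != 0 -> `|h| <= 1 -> 0 <= t + h ->
  `|h^-1 * (Q (t + h) a 0 - Q t a 0) - G t a 0| <= C * Num.sqrt `|h|.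
Proof.
move=> t0; have t10 : 0 <= t + 1 by rewrite addr_ge0.
have [C C0 HC] := bddQ t10; have [D D0 HD] := incQ t10.
pose L := \sum_a \sum_b `|AA a b|; pose V := \sum_a `|S a 0|.
have L0 : 0 <= L by apply: sumr_ge0 => a _; exact: sumr_ge0.
have V0 : 0 <= V by exact: sumr_ge0.
have AL (x : 'cV[R]_n) c a : (forall b, `|x b 0| <= c) -> `|(AA *m x) a 0| <= L * c.
  move=> xc; rewrite mxE; apply: le_trans (ler_norm_sum _ _ _) _.
  have c0 : 0 <= c := le_trans (normr_ge0 _) (xc a).
  apply: (@le_trans _ _ ((\sum_b `|AA a b|) * c)).
    by rewrite mulr_suml; apply: ler_sum => b _; rewrite normrM ler_wpM2l.
  rewrite ler_wpM2r// /L [leRHS](bigD1 a)//= lerDl.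
  by apply: sumr_ge0 => b _; exact: sumr_ge0.
have VS a : `|S a 0| <= V.
  by rewrite /V (bigD1 a)//= lerDl; exact: sumr_ge0.
have quot (s k : R) a : 0 <= s -> 0 < k -> s + k <= t + 1 ->
    `|k^-1 * (Q (s + k) a 0 - Q s a 0) - G s a 0| <= D * Num.sqrt k.
  move=> s0 k0 sk; have := HD s (s + k) a s0 _ sk; rewrite ltrDl => /(_ k0).
  rewrite (_ : s + k - s = k); last ring.
  rewrite [leRHS]mulrCA -ler_pdivrMl// => h; apply: le_trans h.
  rewrite (_ : _ - _ = k^-1 * (Q (s + k) a 0 - Q s a 0 - k * G s a 0)).
    by rewrite normrM gtr0_norm ?invr_gt0.
  by rewrite [RHS]mulrBr mulKf// gt_eqF.
exists (D + L * (L * C + V + D)) => h a h0 h1 th0.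
have sq0 := sqrtr_ge0 `|h|.
have K0 : 0 <= L * (L * C + V + D) by rewrite mulr_ge0// !addr_ge0// mulr_ge0.
have [hpos|hneg] := ltP 0 h.
  rewrite gtr0_norm// in h1 sq0 *.
  apply: (le_trans (quot t h a t0 hpos _)); first by rewrite lerD2l.
  by rewrite ler_wpM2r// lerDl.
have {}hneg : h < 0 by rewrite lt_neqAle h0.
have k0 : 0 < - h by rewrite oppr_gt0.
rewrite ltr0_norm// in h1 sq0 *; set k := - h in k0 h1 sq0 *.
set s := t + h in th0 *.
have tE : s + k = t by rewrite /s /k addrK.
have sk : s + k <= t + 1 by rewrite tE lerDl.
have kq := sqr_sqrtr (ltW k0); set g := Num.sqrt k in sq0 kq *.
have g1 : g <= 1 by rewrite -sqrtr1 ler_wsqrtr.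
have kg : k <= g by rewrite -kq expr2 ler_piMr.
have st : 0 <= s <= t + 1.
  by rewrite th0 (le_trans _ sk)// lerDl ltW.
have dQ b : `|(Q s - Q t) b 0| <= (L * C + V + D) * k.
  have Gs : `|G s b 0| <= L * C + V.
    rewrite mxE; apply: le_trans (ler_normD _ _) (lerD _ (VS b)).
    by apply: AL => c; exact: HC.
  have := HD s (s + k) b th0 _ sk; rewrite ltrDl => /(_ k0).
  rewrite (_ : s + k - s = k); last by rewrite addrAC subrr add0r.
  rewrite tE.
  move=> Hk; rewrite !mxE distrC.
  rewrite -(subrK (k * G s b 0) (Q t b 0 - Q s b 0)) [leRHS]mulrDl addrC.
  apply: le_trans (ler_normD _ _) (lerD _ _).
    by rewrite normrM gtr0_norm// mulrC ler_wpM2r// ltW.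
  by apply: le_trans Hk _; rewrite ler_wpM2l// -[leRHS]mulr1 ler_wpM2l// ltW.
rewrite (_ : h^-1 * _ - _ = k^-1 * (Q (s + k) a 0 - Q s a 0) - G s a 0 + (AA *m (Q s - Q t)) a 0).
  rewrite mulrDl; apply: le_trans (ler_normD _ _) (lerD (quot s k a th0 k0 sk) _).
  apply: le_trans (AL _ _ a dQ) _.
  by rewrite mulrA ler_wpM2l.
rewrite tE mulmxBr /k invrN [(AA *m Q s + S) a 0]mxE [(AA *m Q t + S) a 0]mxE.
by rewrite [(AA *m Q s - _) a 0]mxE [(- (AA *m Q t)) a 0]mxE; ring.
Qed.

Lemma difference_quotient_cvg (F : set_system R) (t : R) : 0 <= t -> Filter F ->
  h @[h --> F] --> (0 : R) -> (\forall h \near F, h != 0 /\ 0 <= t + h) ->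
  h^-1 *: (Q (t + h) - Q t) @[h --> F] --> G t.
Proof.
move=> t0 FF F0 Fh; apply: cvg_col => a.
have [C HC] := difference_quotient t0.
have F1 : \forall h \near F, `|h| <= 1.
  have /cvgrPdist_le/(_ 1 ltr01) := F0.
  by apply: filterS => h; rewrite sub0r normrN.
have sq : C * Num.sqrt `|h| @[h --> F] --> (0 : R).
  rewrite -[X in _ --> X](mulr0 C) -[X in _ * X](@sqrtr0 R) -(@normr0 R R).
  apply: cvgM; first exact: cvg_cst.
  apply: (@cvg_comp _ _ _ (fun h : R => `|h|) Num.sqrt _ _ _ (cvg_norm F0)).
  exact: sqrt_continuous.
have -> : G t a 0 = 0 + G t a 0 by rewrite add0r.
rewrite (_ : (fun h => (h^-1 *: (Q (t + h) - Q t)) a 0) =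
    fun h => (h^-1 * (Q (t + h) a 0 - Q t a 0) - G t a 0) + G t a 0); last first.
  by apply/funext => h; rewrite subrK !mxE.
apply: cvgD; last exact: cvg_cst.
apply: norm_cvg0; apply: (squeeze_cvgr _ (cvg_cst 0) sq).
apply: filterS2 F1 Fh => h h1 [h0 th0]; rewrite normr_ge0/=; exact: HC.
Qed.

Lemma linear_ode_derive (t : R) : 0 < t -> is_derive t 1 Q (G t).
Proof.
move=> t0.
have H : h^-1 *: ((Q \o shift t) (h *: 1) - Q t) @[h --> (0 : R)^'] --> G t.
  rewrite (_ : (fun h => _) = fun h => h^-1 *: (Q (t + h) - Q t)); last first.
    by apply/funext => h; rewrite /= scaler1 [_ + t]addrC.
  apply: difference_quotient_cvg => //; first exact: ltW.
    exact: nbhs_dnbhs.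
  near=> h; split; first by near: h; exact: nbhs_dnbhs_neq.
  have : `|h| < t.
    near: h; apply: dnbhs0_lt => //.
  by rewrite ltr_norml => /andP[]; rewrite ltrNl -subr_gt0 opprK => /ltW.
by apply: DeriveDef; [apply/cvg_ex; exists (G t)|exact: cvg_lim].
Unshelve. all: by end_near. Qed.

Lemma linear_ode_right_derive : h^-1 *: (Q h - Q 0) @[h --> (0 : R)^'+] --> G 0.
Proof.
rewrite (_ : (fun h => _) = fun h => h^-1 *: (Q (0 + h) - Q 0)); last first.
  by apply/funext => h; rewrite add0r.
apply: difference_quotient_cvg => //; first exact: cvg_at_right_filter.
near=> h; have h0 : 0 < h by near: h; exact: nbhs_right_gt.
by rewrite gt_eqF// add0r ltW.
Unshelve. all: by end_near. Qed.

End linear_ode.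

(** * The moment equation *)

Section moments.
Context (R : realType) (disp : measure_display) (T : measurableType disp).
Context (P : probability T R) (m d : nat).
Context (A : 'M[R]_d) (Lam : 'cV[R]_d) (B : 'I_m -> 'M[R]_d) (Gam : 'I_m -> 'cV[R]_d).

Lemma EmxE (p q : nat) (Z : T -> 'M[R]_(p, q)) i j : Emx P Z i j = mean P (fun w => Z w i j).
Proof. by rewrite mxE unlock. Qed.

Lemma Emx_outerE (d' : nat) (Z : T -> 'cV[R]_d') i j :
  Emx P (fun w => Z w *m (Z w)^T) i j = mean P (fun w => Z w i 0 * Z w j 0).
Proof. by rewrite EmxE; congr mean; apply/funext => w; rewrite mxE big_ord1 mxE. Qed.

Section one_time.
Context (y : T -> 'cV[R]_d).
Hypothesis yL : forall k, L2 P (fun w => y w k 0).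
Local Notation M := (Emx P y).
Local Notation P2 := (Emx P (fun w => y w *m (y w)^T)).

Lemma mean_mul_coef o k U : L2 P U ->
  mean P (fun w => U w * coef A Lam B Gam o k (y w)) =
  \sum_l coef_mx A B o k l * mean P (fun w => U w * y w l 0) + coef_cst Lam Gam o k 0 * mean P U.
Proof.
move=> UL; have UyL l : L1 P (fun w => coef_mx A B o k l * (U w * y w l 0)) by apply: L1Z; exact: L2M.
rewrite (_ : (fun w => _) = fun w => \sum_l coef_mx A B o k l * (U w * y w l 0) +
    coef_cst Lam Gam o k 0 * U w); last first.
  apply/funext => w; rewrite coefE mulrDr mulr_sumr [U w * coef_cst _ _ _ _ _]mulrC.
  by congr (_ + _); apply: eq_bigr => l _; rewrite mulrCA.
rewrite meanD; [|by apply: L1_sum|by apply: L1Z; exact: L2_L1].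
rewrite mean_sum// meanZ; last exact: L2_L1.
by congr (_ + _); apply: eq_bigr => l _; rewrite meanZ//; exact: L2M.
Qed.

Lemma mean_coef o k : mean P (fun w => coef A Lam B Gam o k (y w)) =
  (coef_mx A B o *m M + coef_cst Lam Gam o) k 0.
Proof.
under eq_fun do rewrite -[coef _ _ _ _ _ _ _]mul1r.
rewrite mean_mul_coef ?mean_cst ?mulr1; last exact: L2_cst.
rewrite !mxE; congr (_ + _); apply: eq_bigr => l _; rewrite EmxE.
by under eq_fun do rewrite mul1r.
Qed.

Lemma coef_L2 o k : L2 P (fun w => coef A Lam B Gam o k (y w)).
Proof.
under eq_fun do rewrite coefE; apply: L2D; last exact: L2_cst.
by apply: L2_sum => l _; exact: L2Z.
Qed.

Lemma mean_entry_mul_coef o j k : mean P (fun w => y w j 0 * coef A Lam B Gam o k (y w)) =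
  (P2 *m (coef_mx A B o)^T + M *m (coef_cst Lam Gam o)^T) j k.
Proof.
rewrite mean_mul_coef// !mxE big_ord1 EmxE mxE mulrC; congr (_ + _).
by apply: eq_bigr => l _; rewrite Emx_outerE mxE mulrC.
Qed.

Lemma mean_coef_mul o j k :
  mean P (fun w => coef A Lam B Gam o j (y w) * coef A Lam B Gam o k (y w)) =
  (coef_mx A B o *m P2 *m (coef_mx A B o)^T +
   (coef_mx A B o *m M *m (coef_cst Lam Gam o)^T + coef_cst Lam Gam o *m M^T *m (coef_mx A B o)^T) +
   coef_cst Lam Gam o *m (coef_cst Lam Gam o)^T) j k.
Proof.
set C := coef_mx A B o; set c := coef_cst Lam Gam o.
rewrite mean_mul_coef; last exact: coef_L2.
rewrite (eq_bigr (fun l => C k l * ((P2 *m C^T) l j + M l 0 * c j 0))); last first.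
  move=> l _; rewrite -/C; congr (_ * _); under eq_fun do rewrite mulrC.
  by rewrite mean_entry_mul_coef -/C -/c mxE [(M *m _) l j]mxE big_ord1 [c^T _ _]mxE.
rewrite mean_coef -/C -/c.
have P2sym : P2^T = P2.
  by apply/matrixP => a b; rewrite mxE !Emx_outerE; under eq_fun do rewrite mulrC.
have -> : \sum_l C k l * ((P2 *m C^T) l j + M l 0 * c j 0) =
    (C *m P2 *m C^T) j k + (c *m M^T *m C^T) j k.
  have -> : (C *m P2 *m C^T) j k = (C *m (P2 *m C^T)) k j.
    have symE : (C *m P2 *m C^T)^T = C *m (P2 *m C^T) by rewrite !trmx_mul trmxK P2sym.
    by rewrite -symE [RHS]mxE.
  rewrite -mulmxA -trmx_mul [(C *m (_ *m _)) k j]mxE [(c *m _) j k]mxE big_ord1 [_^T 0 k]mxE [(C *m M) k 0]mxE.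
  by rewrite mulr_sumr -big_split; apply: eq_bigr => l _ /=; rewrite mulrDr; congr (_ + _); ring.
have entryD (u v : 'M[R]_d) : (u + v) j k = u j k + v j k by rewrite mxE.
rewrite !entryD [(C *m M + c) j 0]mxE [(C *m M *m c^T) j k]mxE big_ord1 [c^T _ _]mxE.
rewrite [(c *m c^T) j k]mxE big_ord1 [c^T _ _]mxE; ring.
Qed.

End one_time.

End moments.

Theorem theorem5p5 (R : realType) (disp : measure_display)
    (T : measurableType disp) (P : probability T R) (F : R -> set (set T))
    (m d : nat) (W : 'I_m -> R -> T -> R)
    (A : 'M[R]_d) (Lam : 'cV[R]_d)
    (B : 'I_m -> 'M[R]_d) (Gam : 'I_m -> 'cV[R]_d)
    (Y0 : 'cV[R]_d) (Y : R -> T -> 'cV[R]_d) :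
  filtration F ->
  brownian_motion P F W ->
  sde_solution P F W (fun y => A *m y + Lam) (fun i y => B i *m y + Gam i) Y0 Y ->
  let M : R -> 'cV[R]_d := fun t => Emx P (Y t) in
  let P2 : R -> 'M[R]_d := fun t => Emx P (fun w => Y t w *m (Y t w)^T) in
  let Q : R -> 'cV[R]_(d * d + d) := fun t => col_mx (vec (P2 t)) (M t) in
  let At : 'M[R]_(d * d) := 1%:M *t A + A *t 1%:M in
  let Bt : 'I_m -> 'M[R]_(d * d, d) :=
    fun i => kron_cl (Gam i) (B i) + kron_cr (B i) (Gam i) in
  let Ct : 'I_m -> 'cV[R]_(d * d) := fun i => kron_cl (Gam i) 1%:M *m Gam i in
  let AA : 'M[R]_(d * d + d) :=
    block_mx (At + \sum_(i < m) B i *t B i)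
             (kron_cr 1%:M Lam + kron_cl Lam 1%:M + \sum_(i < m) Bt i)
             0 A in
  let S : 'cV[R]_(d * d + d) := col_mx (\sum_(i < m) Ct i) Lam in
  (* the moments M(t) and P(t) exist *)
  (forall t : R, 0 <= t -> forall j k : 'I_d,
     P.-integrable [set: T] (fun w => (Y t w j 0)%:E) /\
     P.-integrable [set: T] (fun w => ((Y t w *m (Y t w)^T) j k)%:E)) /\
  (* Q' = AA Q + S on [0, +oo), with the right derivative at 0 *)
  (forall t : R, 0 < t -> is_derive t 1 Q (AA *m Q t + S)) /\
  h^-1 *: (Q h - Q 0) @[h --> (0 : R)^'+] --> AA *m Q 0 + S.
Proof.
move=> filtF bmW [_ aY cY startY _ [I [HI EI]]] M P2 Q At Bt Ct AA S.
have mY k (r : R) : 0 <= r -> Fmeas F r (fun w => Y r w k 0).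
  by move=> r0; exact: (adapted_Fmeas filtF (aY k) r0).
have YL k (r : R) : 0 <= r -> L2 P (fun w => Y r w k 0).
  move=> r0; exact: (Y_L2F filtF bmW mY cY startY HI EI k r0).2.
have field t : 0 <= t -> AA *m Q t + S = col_mx
    (vec (\matrix_(j, k) product_drift P A Lam B Gam Y t j k))
    (\col_j mean P (fun w => coef A Lam B Gam None j (Y t w))).
  move=> t0; rewrite /AA /Q /S mul_block_col add_col_mx mul0mx add0r.
  congr col_mx; last first.
    by apply/colP => j; rewrite [RHS]mxE (mean_coef A Lam B Gam (fun k => YL k t t0) None).
  rewrite /At /Bt /Ct !mulmxDl !mulmx_suml.
  rewrite (eq_bigr (fun i => vec (B i *m P2 t *m (B i)^T))) => [|i _]; last exact: tens_mul_vec.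
  rewrite [X in _ + (_ + X)](eq_bigr (fun i => vec (B i *m M t *m (Gam i)^T +
      Gam i *m (M t)^T *m (B i)^T))) => [|i _]; last first.
    by rewrite mulmxDl kron_cl_mul kron_cr_mul vecD.
  rewrite [X in _ + X](eq_bigr (fun i => vec (Gam i *m (Gam i)^T))) => [|i _]; last first.
    by rewrite kron_cl_mul mul1mx.
  rewrite !tens_mul_vec kron_cl_mul kron_cr_mul -!vec_sum -!vecD !mul1mx trmx1 !mulmx1.
  congr vec; apply/matrixP => j k; rewrite [RHS]mxE /product_drift.
  have Yt k' := YL k' t t0.
  rewrite (mean_entry_mul_coef A Lam B Gam Yt None j k).
  rewrite (mean_entry_mul_coef A Lam B Gam Yt None k j).
  rewrite (eq_bigr _ (fun i _ => mean_coef_mul A Lam B Gam Yt (Some i) j k)) /=.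
  rewrite -/(P2 t) -/(M t) -summxE !big_split /=.
  have entryD (u v : 'M[R]_d) a b : (u + v) a b = u a b + v a b by rewrite mxE.
  have P2sym : (P2 t)^T = P2 t.
    by apply/matrixP => a b; rewrite mxE !Emx_outerE; under eq_fun do rewrite mulrC.
  (* The drift acting on the second factor is the transpose of the drift acting on
     the first one. *)
  have -> : (P2 t *m A^T + M t *m Lam^T) k j = (A *m P2 t + Lam *m (M t)^T) j k.
    rewrite -[in RHS]P2sym -[in RHS](trmxK A) -[in RHS](trmxK Lam) -!trmx_mul.
    by rewrite !entryD !mxE.
  by rewrite !entryD; ring.
have entryM r j : 0 <= r -> Q r (rshift (d * d) j) 0 = mean P (fun w => Y r w j 0).
  by move=> r0; rewrite /Q col_mxEd EmxE.
have entryP r x : 0 <= r -> Q r (lshift d x) 0 =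
    mean P (fun w => Y r w (mxtens_unindex x).2 0 * Y r w (mxtens_unindex x).1 0).
  by move=> r0; rewrite /Q col_mxEu mxE Emx_outerE.
have bddQ t0 : 0 <= t0 -> exists2 C, 0 <= C & forall s a, 0 <= s <= t0 -> `|Q s a 0| <= C.
  move=> t00; have [C C0 HC] := second_moment_bounded filtF bmW mY cY startY HI EI t00.
  exists (1 + C) => [|s a st0]; first by rewrite addr_ge0.
  have [s0 _] := andP st0; have C1 : C <= (1 + C) ^+ 2 by have := sqr_ge0 C; nra.
  case: (split_ordP a) => [x|j] ->.
    rewrite entryP//; apply: abs_mean_mul_le; [exact: YL|exact: YL|by rewrite addr_ge0|].
    apply: le_trans (ler_pM (mean_sqr_ge0 _ _) (mean_sqr_ge0 _ _) (HC s _ st0).2 (HC s _ st0).2) _.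
    by rewrite -expr2 lerXn2r ?nnegrE ?addr_ge0// lerDr.
  rewrite entryM//; under eq_fun do rewrite -[Y _ _ _ _]mul1r.
  apply: abs_mean_mul_le; [exact: L2_cst|exact: YL|by rewrite addr_ge0|].
  under eq_fun do rewrite expr1n.
  by rewrite mean_cst mul1r (le_trans (HC s j st0).2).
have incQ t0 : 0 <= t0 -> exists2 C, 0 <= C & forall s t a, 0 <= s -> s < t -> t <= t0 ->
    `|Q t a 0 - Q s a 0 - (t - s) * (AA *m Q s + S) a 0| <= C * ((t - s) * Num.sqrt (t - s)).
  move=> t00.
  have [C1 C10 H1] := mean_expansion filtF bmW mY cY startY HI EI t00.
  have [C2 C20 H2] := product_expansion filtF bmW mY cY startY HI EI t00.
  exists (C1 + C2) => [|s t a s0 st tt0]; first by rewrite addr_ge0.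
  have t1 : 0 <= t by rewrite (le_trans s0)// ltW.
  have e0 : 0 <= (t - s) * Num.sqrt (t - s) by rewrite mulr_ge0 ?sqrtr_ge0// subr_ge0 ltW.
  rewrite field//; case: (split_ordP a) => [x|j] ->.
    rewrite !entryP// col_mxEu mxE mxE.
    by apply: le_trans (H2 s t _ _ s0 st tt0) _; rewrite ler_wpM2r// lerDr.
  rewrite !entryM// col_mxEd mxE.
  by apply: le_trans (H1 s t j s0 st tt0) _; rewrite ler_wpM2r// lerDl.
split; last by split; [exact: linear_ode_derive bddQ incQ|exact: linear_ode_right_derive bddQ incQ].
move=> t t0 j k; split; first exact: L2_L1 (YL j t t0).
have := L2M (YL j t t0) (YL k t t0).
by congr (L1 P _); apply/funext => w; rewrite mxE big_ord1 mxE.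
Qed.
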